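(* For every integer $k\ge0$ and every $x>0$, $$\begin{aligned}&\sum_{j=0}^{k}\frac{(-1)^{j+1}}{j+1}\binom{k}{j}\frac{\log^{k-j}(x)}{2^{k-j}}\left(\Phi_{j+1}(x)+(-1)^{k-j}\Phi_{j+1}\!\left(\frac1x\right)\right)\\&=\sum_{j=0}^{k}\binom{k}{j}\frac{\log^{k-j}(x)}{2^{k-j}}\Bigg[jL_{j-1}^{*}(x)-\frac12a_{j+1,0}\log^2(x)+\left(x+\frac{(-1)^{k-j}}{x}-2\right)\zeta^{(j)}(2)\\&\qquad-j\sum_{\ell=1}^{j}\frac{a_{j,\ell-1}}{\ell}\left\{\sum_{n=0}^{\ell-1}(-1)^{n+1}c_{\ell-n}\frac{(\ell+1)!}{(n+1)!}\log^{n+1}(x)+\frac{(-1)^{\ell}}{\ell+2}\log^{\ell+2}(x)\right\}+2\,\frac{(-1)^{j+1}}{j+1}\Phi_{j+1}(1)\Bigg].\end{aligned}$$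
   Context: Notation: $\log^m(x)=(\log x)^m$, with $\log^0(x)=1$; $\zeta^{(j)}$ is the $j$-th derivative of the Riemann zeta function. Ishibashi functions: for $k\in\mathbb{N}$ and $x\in\mathbb{C}\setminus(-\infty,0]$, $$\Phi_k(x):=\sum_{n=1}^{\infty}\frac{k\,\psi_{k-1}(nx)-\log^k(nx)}{n},$$ where, for $k\ge0$, $\psi_k(x):=-\gamma_k-\frac{\log^k(x)}{x}-\sum_{n=1}^{\infty}\left(\frac{\log^k(n+x)}{n+x}-\frac{\log^k(n)}{n}\right)$ is the generalized digamma function and $\gamma_k$ is the $k$-th Stieltjes constant ($\gamma_0=\gamma$ is Euler's constant, $\zeta(s)=\frac1{s-1}+\sum_{k\ge0}\frac{(-1)^k\gamma_k}{k!}(s-1)^k$). Constants $a_{k,j}$: $a_{1,0}=1$, $a_{k,k-1}=1$ for $k\ge1$, and $a_{k,j}=-\sum_{r=0}^{k-2}\binom{k-1}{r}\Gamma^{(k-r-1)}(1)\,a_{r+1,j}$ for $0\le j\le k-2$, with the convention $a_{m,j}=0$ for $j\ge m$. Constants $c_k$, $k\ge0$: defined by $\Gamma(s)\zeta(s)-\frac{1}{s-1}=\sum_{k=0}^{\infty}c_k(s-1)^k$ near $s=1$. Function $I$: for $x>0$, $$I(z,x):=\frac{1}{\Gamma(z)}\int_0^\infty t^{z-2}\log\left(\frac{1-e^{-xt}}{1-e^{-t}}\right)\log\left(\frac{1-e^{-t}}{t}\right)dt,$$ which converges and is analytic in $z$ for $\mathrm{Re}(z)>0$. $L_k^*(x):=\lim_{z\to1}\frac{d^k}{dz^k}I(z,x)$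 for integers $k\ge0$, and $L_{-1}^*(x):=0$. Empty sums are $0$. *)

(* Defs.v *)
From HB Require Import structures.
From mathcomp Require Import all_boot all_order all_algebra.
From mathcomp Require Import all_classical all_reals all_analysis.
From mathcomp Require Import complex.

Set Implicit Arguments.
Unset Strict Implicit.
Unset Printing Implicit Defensive.

Import Order.TTheory GRing.Theory Num.Theory numFieldNormedType.Exports.

Local Open Scope classical_set_scope.
Local Open Scope ring_scope.
Local Open Scope complex_scope.

(* [R[i]] itself carries no topology in the library; its regular module
   [R[i]^o] does, so [derivable f z 1] and [f^`(n)] are complex
   differentiability and complex derivatives. *)
Notation Cplx R := (R[i]^o)%type (only parsing).

Section Functions.
Variable R : realType.
Local Notation C := (Cplx R).
(* real-valued parts, as opposed to those of [numClosedFieldType] *)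
Local Notation Re := (@complex.Re R).
Local Notation Im := (@complex.Im R).

Definition cexp (z : C) : C :=
  (expR (Re z) * cos (Im z)) +i* (expR (Re z) * sin (Im z)).

(* t ^ z for real t > 0 *)
Definition cpow (t : R) (z : C) : C := cexp ((ln t)%:C * z).

(* Principal logarithm on the complement of (-oo, 0]: the formula
   arg z = 2 atan (Im z / (|z| + Re z)) gives the argument in (-pi, pi). *)
Definition clog (z : C) : C :=
  let r := Num.sqrt (Re z ^+ 2 + Im z ^+ 2) in
  ln r +i* (2 * atan (Im z / (r + Re z))).

Definition cintegral (D : set R) (f : R -> C) : C :=
  (\int[lebesgue_measure]_(t in D) Re (f t))
    +i* (\int[lebesgue_measure]_(t in D) Im (f t)).

(* Euler's integral: this is the Gamma function for Re z > 0 only, which is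
   the only region where it is used. *)
Definition cGamma (z : C) : C :=
  cintegral `]0, +oo[ (fun t => (expR (- t))%:C * cpow t (z - 1)).

(* zeta is the analytic continuation of the Dirichlet series to C \ {1}. *)
Definition is_riemann_zeta (zeta : C -> C) : Prop :=
  (forall s, s != 1 -> derivable zeta s 1) /\
  (forall s : C, 1 < Re s ->
     series (fun n => cpow n.+1%:R (- s)) @ \oo --> zeta s).

Definition power_series_near1 (u : nat -> C) (f : C -> C) : Prop :=
  \forall s \near (1 : C)^',
    series (fun k => u k * (s - 1) ^+ k) @ \oo --> f s.

Definition is_stieltjes (zeta : C -> C) (gamma : nat -> C) : Prop :=
  power_series_near1 (fun k => (-1) ^+ k * gamma k / k`!%:R)
                     (fun s => zeta s - (s - 1)^-1).

Definition is_Gamma_zeta_coef (zeta : C -> C) (c : nat -> C) : Prop :=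
  power_series_near1 c (fun s => cGamma s * zeta s - (s - 1)^-1).

Definition gen_digamma (gamma : nat -> C) (k : nat) (x : C) : C :=
  - gamma k - clog x ^+ k / x
  - limn (series (fun m => let n : C := m.+1%:R in
      clog (n + x) ^+ k / (n + x) - clog n ^+ k / n)).

(* Phi_k, for k >= 1 *)
Definition Ishibashi (gamma : nat -> C) (k : nat) (x : C) : C :=
  limn (series (fun m => let n : C := m.+1%:R in
    (k%:R * gen_digamma gamma k.-1 (n * x) - clog (n * x) ^+ k) / n)).

(* The first argument bounds the depth of the recursion; k suffices, as
   [acoef_diag], [acoef_rec] and [acoef_out] show. *)
Fixpoint acoef_fuel (d k j : nat) : C :=
  if d is d'.+1 then
    if (j.+1 == k)%N then 1
    else if (j.+1 < k)%N then
      - \sum_(0 <= r < k.-1)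
          'C(k.-1, r)%:R * derive1n (k - r - 1)%N cGamma 1
          * acoef_fuel d' r.+1 j
    else 0
  else 0.

Definition acoef (k j : nat) : C := acoef_fuel k k j.

Lemma acoef_fuelE d k j : (k <= d)%N -> acoef_fuel d k j = acoef k j.
Proof.
have E d1 : forall d2 k1, (k1 <= d1)%N -> (k1 <= d2)%N ->
    acoef_fuel d1 k1 j = acoef_fuel d2 k1 j.
  elim: d1 => [|d1 IH] [|d2] k1 //=.
  - by rewrite leqn0 => /eqP -> _; rewrite ltn0.
  - by move=> _; rewrite leqn0 => /eqP ->; rewrite ltn0.
  move=> k1d1 k1d2; case: ifP => // _; case: ifP => // _; congr (- _).
  apply: eq_big_nat => r /andP[_ rk]; congr (_ * _).
  by apply: IH; rewrite (leq_trans rk)// -ltnS;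
    case: (k1) rk k1d1 k1d2.
by move=> kd; exact: E.
Qed.

Lemma acoef_diag k : (0 < k)%N -> acoef k k.-1 = 1.
Proof. by case: k => //= k _; rewrite /acoef/= eqxx. Qed.

Lemma acoef_out k j : (k <= j)%N -> acoef k j = 0.
Proof.
case: k => // k kj; rewrite /acoef/= !eqSS ltnS ltnNge (ltnW kj)/=.
by rewrite gtn_eqF.
Qed.

Lemma acoef_rec k j : (j.+1 < k)%N ->
  acoef k j = - \sum_(0 <= r < k.-1)
    'C(k.-1, r)%:R * derive1n (k - r - 1)%N cGamma 1 * acoef r.+1 j.
Proof.
case: k => // k jk; rewrite {1}/acoef/= eqSS ltn_eqF// jk; congr (- _).
by apply: eq_big_nat => r /andP[_ rk]; rewrite acoef_fuelE.
Qed.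

Definition I_fun (x : R) (z : C) : C :=
  (cGamma z)^-1 *
  cintegral `]0, +oo[ (fun t =>
    cpow t (z - 2) *
    (ln ((1 - expR (- (x * t))) / (1 - expR (- t))) *
     ln ((1 - expR (- t)) / t))%:C).

Definition Lstar (x : R) (m : int) : C :=
  match m with
  | Posz k => lim (derive1n k (I_fun x) z @[z --> (1 : C)^'])
  | Negz _ => 0
  end.

End Functions.

(* Main.v *)
(* Put A(t) = ln(1 - e^-t), B(t) = ln(1 - e^-xt), K(t) = 1/(1 - e^-t) - 1/t and
   Mel f(w) = \int_0^oo t^w f(t) dt. The k-th Taylor coefficients at w = 0 of
   Mel(K B)(w) / Gamma(1 + w), Mel(A)(w) / Gamma(1 + w) and
   Mel((B - A) ln((1 - e^-t)/t) / t)(w) / Gamma(1 + w) are respectively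
   (-1)^k Phi_{k+1}(x) / (k+1)!, - zeta^(k)(2) / k! and L*_k(x) / k!.
   Integrating the derivative of t^w (A (B - A) - ln x ln t e^-t) over the
   half-line gives a linear relation between these transforms, in which
   Phi(1/x) enters through Mel(K(x t) A), a dilation of Mel(K ln(1 - e^(-t/x)))
   carrying a factor x^-w. Multiplying by x^(w/2) and comparing the coefficients
   of w^k gives the symmetric form of the theorem. The constants c_k come from
   the transform of (B - A - ln x e^-t)/t, which is expressed by
   Gamma(1 + w) zeta(1 + w) (x^-w - 1); that c_0 = 0 follows from the case
   k = 0 of the relation, applied to x and to 1/x. The coefficients a_{k,j} are
   those of 1/Gamma(1 + w), up to factorials. *)
Require Import Defs.
From HB Require Import structures.
From mathcomp Require Import all_boot all_order all_algebra.
From mathcomp Require Import all_classical all_reals all_analysis.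
From mathcomp Require Import measurable_realfun complex.
From mathcomp Require Import ring lra.

Set Implicit Arguments.
Unset Strict Implicit.
Unset Printing Implicit Defensive.

Import Order.TTheory GRing.Theory Num.Theory numFieldNormedType.Exports.

Local Open Scope classical_set_scope.
Local Open Scope ring_scope.
Local Open Scope complex_scope.

(** The quantities of the statement are of different kinds: [zeta] and [I_fun] have genuine complex
    derivatives, the Phi are limits of series, [c] and [gamma] come from power series. All are
    brought to one form, coefficients of an asymptotic expansion along the positive real axis. Such
    coefficients are unique and survive sums, products and inverses, so relations between transforms
    need only be checked for small real w > 0, where the transforms are real integrals. Complex
    neighbourhoods serve to establish smoothness, for instance of [zeta] at 2. Division by Gamma(1 +
    w) turns the transform of e^(-yt) into y^(-1-w), whose coefficients are, up to sign and
    factorial, the log^k(y)/y of the digamma series. The term ln x ln t e^-t is subtracted because A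
    (B - A) behaves like ln x ln t at 0; without it the separate transforms would have poles at w =
    0. The fact c_0 = 0 is needed because the sum over n in the statement stops at l - 1, whereas
    the product of power series also yields a term with c_0. *)

Section Convolution.
Variable K : comNzRingType.
Implicit Types a b c : nat -> K.

Definition conv a b (k : nat) : K := \sum_(i < k.+1) a i * b (k - i)%N.

Definition seq1 (k : nat) : K := (k == 0)%N%:R.

Definition shift_seq a (k : nat) : K := if k is k'.+1 then a k' else 0.

(** Truncations of any common length [N] above [k] give the same coefficient, so commutativity and
    associativity of Cauchy products are inherited from polynomials. *)
Lemma conv_coef a b N k : (k < N)%N ->
  conv a b k = ((\poly_(i < N) a i) * (\poly_(i < N) b i))`_k.
Proof.
move=> kN; rewrite coefM; apply: eq_bigr => i _.
by rewrite !coef_poly (leq_ltn_trans (leq_ord i) kN) (leq_ltn_trans (leq_subr _ _) kN).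
Qed.

Lemma convC a b : conv a b =1 conv b a.
Proof. by move=> k; rewrite !(@conv_coef _ _ k.+1)// mulrC. Qed.

Lemma eq_conv a a' b b' : a =1 a' -> b =1 b' -> conv a b =1 conv a' b'.
Proof. by move=> aa bb k; apply: eq_bigr => i _; rewrite aa bb. Qed.

Lemma convA a b c : conv a (conv b c) =1 conv (conv a b) c.
Proof.
move=> k; rewrite /conv.
transitivity (((\poly_(i < k.+1) a i) * ((\poly_(i < k.+1) b i) * (\poly_(i < k.+1) c i)))`_k).
  rewrite coefM; apply: eq_bigr => i _.
  by rewrite coef_poly ltn_ord -conv_coef// ltnS leq_subr.
rewrite mulrA coefM; apply: eq_bigr => i _.
by rewrite -conv_coef// coef_poly ltnS leq_subr.
Qed.

Lemma conv1 a : conv seq1 a =1 a.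
Proof.
move=> k; rewrite /conv big_ord_recl/= /seq1 eqxx mul1r subn0 big1 ?addr0// => i _.
by rewrite mul0r.
Qed.

Lemma convDr a b c : conv a (fun k => b k + c k) =1 (fun k => conv a b k + conv a c k).
Proof.
by move=> k; rewrite /conv -big_split; apply: eq_bigr => i _; rewrite mulrDr.
Qed.

Lemma convZr a b x : conv a (fun k => x * b k) =1 (fun k => x * conv a b k).
Proof.
by move=> k; rewrite /conv mulr_sumr; apply: eq_bigr => i _; rewrite mulrCA.
Qed.

Lemma conv_shift a b : conv a (shift_seq b) =1 shift_seq (conv a b).
Proof.
move=> [|k]/=; first by rewrite /conv big_ord1 mulr0.
rewrite /conv big_ord_recr/= subnn mulr0 addr0; apply: eq_bigr => i _.
by rewrite subSn// -ltnS.
Qed.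
End Convolution.

(** * Asymptotic expansions in powers of w as w tends to 0 from the right *)

Section AsymptoticExpansion.
Variable K : numFieldType.
Implicit Types (f g : K -> K) (a b : nat -> K).

Definition near0 (P : K -> Prop) : Prop :=
  exists2 d : K, 0 < d & forall w, 0 < w -> w < d -> P w.

Lemma near0W (P Q : K -> Prop) : (forall w, 0 < w -> P w -> Q w) -> near0 P -> near0 Q.
Proof. by move=> PQ [d d0 Pd]; exists d => // w w0 wd; apply/PQ/Pd. Qed.

Lemma near0T (P : K -> Prop) : (forall w, 0 < w -> P w) -> near0 P.
Proof. by move=> PT; exists 1 => // w w0 _; exact: PT. Qed.

Lemma near0_and (P Q : K -> Prop) : near0 P -> near0 Q -> near0 (fun w => P w /\ Q w).
Proof.
move=> [d d0 Pd] [e e0 Qe].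
(* The order on [K] may be partial; positive elements are real, hence comparable. *)
have /orP[de|ed] := real_leVge (gtr0_real d0) (gtr0_real e0).
- by exists d => // w w0 wd; split; [exact: Pd|apply: Qe => //; exact: lt_le_trans de].
- by exists e => // w w0 we; split; [apply: Pd => //; exact: lt_le_trans ed|exact: Qe].
Qed.

Lemma near0_lt (d : K) : 0 < d -> near0 (fun w => w < d).
Proof. by move=> d0; exists d. Qed.

Definition bigO_pow (N : nat) f : Prop :=
  exists2 M : K, 0 <= M & near0 (fun w => `|f w| <= M * w ^+ N).

(* On R[i], [0 < w] forces [w] to be real, so the expansion is along the
   positive real axis there. *)
Definition asym f a : Prop :=
  forall N, bigO_pow N (fun w => f w - \sum_(i < N) a i * w ^+ i).

Lemma bigO_eq N f g : near0 (fun w => f w = g w) -> bigO_pow N f -> bigO_pow N g.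
Proof.
move=> fg [M M0 H]; exists M => //.
by apply: near0W (near0_and fg H) => w w0 [-> ].
Qed.

Lemma bigOD N f g : bigO_pow N f -> bigO_pow N g -> bigO_pow N (fun w => f w + g w).
Proof.
move=> [M M0 H] [P P0 H']; exists (M + P); first exact: addr_ge0.
apply: near0W (near0_and H H') => w w0 [h h'].
by rewrite (le_trans (ler_normD _ _))// mulrDl lerD.
Qed.

Lemma bigOM N n f g : bigO_pow N f -> bigO_pow n g ->
  bigO_pow (N + n) (fun w => f w * g w).
Proof.
move=> [M M0 H] [P P0 H']; exists (M * P); first exact: mulr_ge0.
apply: near0W (near0_and H H') => w w0 [h h'].
by rewrite normrM exprD mulrACA ler_pM.
Qed.

Lemma bigO_cst (c : K) : bigO_pow 0 (fun=> c).
Proof. by exists `|c| => //; apply: near0T => w w0; rewrite expr0 mulr1. Qed.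

Lemma bigO_exp N : bigO_pow N (fun w => w ^+ N).
Proof.
exists 1 => //; apply: near0T => w w0.
by rewrite mul1r ger0_norm// exprn_ge0// ltW.
Qed.

Lemma bigO0 N : bigO_pow N (fun=> 0).
Proof. by exists 0 => //; apply: near0T => w w0; rewrite normr0 mul0r. Qed.

Lemma bigON N f : bigO_pow N f -> bigO_pow N (fun w => - f w).
Proof. by move=> [M M0 H]; exists M => //; apply: near0W H => w _; rewrite normrN. Qed.

Lemma bigOMl N f g : bigO_pow 0 f -> bigO_pow N g -> bigO_pow N (fun w => f w * g w).
Proof. by move=> hf hg; have := bigOM hf hg; rewrite add0n. Qed.

Lemma bigOW N n f : (n <= N)%N -> bigO_pow N f -> bigO_pow n f.
Proof.
move=> nN [M M0 H]; exists M => //.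
apply: near0W (near0_and H (near0_lt ltr01)) => w w0 [h w1].
rewrite (le_trans h)// ler_wpM2l// ler_wiXn2l//; exact: ltW.
Qed.

Lemma bigO_poly (p : {poly K}) : bigO_pow 0 (fun w => p.[w]).
Proof.
elim/poly_ind: p => [|p c IH].
  by apply: bigO_eq (bigO0 0); apply: near0T => w _; rewrite horner0.
apply: (@bigO_eq _ (fun w => p.[w] * w + c)).
  by apply: near0T => w _; rewrite hornerMXaddC.
apply: bigOD (bigO_cst c); apply: bigOMl => //.
by apply: (@bigOW 1) => //; exact: bigO_exp.
Qed.

Lemma asymE f a : asym f a <->
  forall N, bigO_pow N (fun w => f w - (\poly_(i < N) a i).[w]).
Proof.
by split=> H N; apply: bigO_eq (H N); apply: near0T => w _; rewrite horner_poly.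
Qed.

Lemma asym_eq f g a : near0 (fun w => f w = g w) -> asym f a -> asym g a.
Proof. by move=> fg H N; apply: bigO_eq (H N); apply: near0W fg => w _ ->. Qed.

Lemma asym_eqr f a b : a =1 b -> asym f a -> asym f b.
Proof.
move=> ab H N; apply: bigO_eq (H N); apply: near0T => w _.
by congr (_ - _); apply: eq_bigr => i _; rewrite ab.
Qed.

Lemma asymD f g a b : asym f a -> asym g b ->
  asym (fun w => f w + g w) (fun k => a k + b k).
Proof.
move=> fa gb N; apply: bigO_eq (bigOD (fa N) (gb N)); apply: near0T => w _.
rewrite addrACA -opprD; congr (_ - _); rewrite -big_split/=; apply: eq_bigr => i _.
by rewrite mulrDl.
Qed.

Lemma asymZ c f a : asym f a -> asym (fun w => c * f w) (fun k => c * a k).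
Proof.
move=> fa N; apply: bigO_eq (bigOMl (bigO_cst c) (fa N)); apply: near0T => w _.
rewrite mulrBr mulr_sumr; congr (_ - _); apply: eq_bigr => i _.
by rewrite mulrA.
Qed.

Lemma asymN f a : asym f a -> asym (fun w => - f w) (fun k => - a k).
Proof.
move=> /(asymZ (-1)) H; apply: asym_eqr (asym_eq _ H) => [k|]; first by rewrite mulN1r.
by apply: near0T => w _; rewrite mulN1r.
Qed.

Lemma asymB f g a b : asym f a -> asym g b ->
  asym (fun w => f w - g w) (fun k => a k - b k).
Proof. by move=> fa /asymN; exact: asymD. Qed.

Lemma asym_bounded f a : asym f a -> bigO_pow 0 f.
Proof.
move=> /(_ 0); apply: bigO_eq; apply: near0T => w _.
by rewrite big_ord0 subr0.
Qed.

Lemma poly_lowcoef0 (p : {poly K}) N : (forall i, (i < N)%N -> p`_i = 0) ->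
  exists q, p = q * 'X^N.
Proof.
move=> p0; exists (drop_poly N p); rewrite -[LHS](poly_take_drop N).
suff -> : take_poly N p = 0 by rewrite add0r.
by apply/polyP => i; rewrite coef_take_poly coef0; case: ifP => // /p0.
Qed.

(** With P and Q the truncations, f g - P Q = f (g - Q) + Q (f - P) is O(w^N), and P Q differs from
    the truncated Cauchy product by a polynomial divisible by X^N. *)
Lemma asymM f g a b : asym f a -> asym g b -> asym (fun w => f w * g w) (conv a b).
Proof.
move=> fa gb; apply/asymE => N.
have [q qE] : exists q, (\poly_(i < N) a i) * (\poly_(i < N) b i) - \poly_(i < N) conv a b i
   = q * 'X^N.
  apply: poly_lowcoef0 => i iN.
  by rewrite coefB coef_poly iN (conv_coef _ _ iN) subrr.
have Hq : bigO_pow N (fun w => q.[w] * w ^+ N).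
  by apply: bigOMl; [exact: bigO_poly|exact: bigO_exp].
have H1 := bigOMl (asym_bounded fa) ((asymE g b).1 gb N).
have H2 := bigOMl (bigO_poly (\poly_(i < N) b i)) ((asymE f a).1 fa N).
apply: bigO_eq (bigOD (bigOD H1 H2) Hq); apply: near0T => w _.
have -> : q.[w] * w ^+ N = (q * 'X^N).[w] by rewrite hornerM hornerXn.
rewrite -qE hornerD hornerN hornerM; ring.
Qed.

Lemma asym1 : asym (fun=> 1) (seq1 K).
Proof.
move=> [|N].
  by apply: bigO_eq (bigO_cst 1); apply: near0T => w _; rewrite big_ord0 subr0.
apply: bigO_eq (bigO0 _); apply: near0T => w _.
rewrite big_ord_recl big1 ?addr0 /seq1 ?eqxx ?expr0 ?mul1r ?subrr// => i _.
by rewrite mul0r.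
Qed.

Lemma asym_shift f a : asym f a -> asym (fun w => w * f w) (shift_seq a).
Proof.
move=> fa [|N].
  apply: (@bigO_eq _ (fun w => w * f w)).
    by apply: near0T => w _; rewrite big_ord0 subr0.
  apply: bigOMl (asym_bounded fa); apply: (@bigOW 1) => //; exact: bigO_exp.
have := bigOM (bigO_exp 1) (fa N); rewrite add1n.
apply: bigO_eq; apply: near0T => w _.
rewrite expr1 mulrBr big_ord_recl/= mul0r add0r mulr_sumr; congr (_ - _).
by apply: eq_bigr => i _; rewrite exprS mulrCA.
Qed.

Lemma bigO_lowcoef N (c : K) : bigO_pow N.+1 (fun w => c * w ^+ N) -> c = 0.
Proof.
move=> [M M0 [d d0 H]].
apply/eqP; apply: contraT; rewrite -normr_gt0 => c0.
have M1 : 0 < M + 1 by rewrite ltr_wpDl.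
(* A point below both [d] and |c| / (M + 1), where |c| <= M w fails; the denominator is not [M],
   which may be 0. *)
have [e [e0 ed ec]] : exists e, [/\ 0 < e, e < d & e * (M + 1) < `|c|].
  have H1 : near0 (fun e => e < d) by exact: near0_lt.
  have H2 : near0 (fun e => e < `|c| / (M + 1)) by apply: near0_lt; rewrite divr_gt0.
  have [r r0 Hr] := near0_and H1 H2.
  have r2 : 0 < r / 2 by rewrite divr_gt0.
  have [] := Hr (r / 2) r2; first by rewrite ltr_pdivrMr// ltr_pMr// ltr1n.
  by move=> ? h; exists (r / 2); split => //; rewrite -ltr_pdivlMr.
have := H e e0 ed; rewrite normrM (ger0_norm (exprn_ge0 _ (ltW e0))) exprS mulrA.
rewrite ler_pM2r ?exprn_gt0// => h.
have : e * (M + 1) < M * e by exact: lt_le_trans h.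
rewrite mulrDr mulr1 mulrC gtrDl => e0'.
by have := lt_trans e0 e0'; rewrite ltxx.
Qed.

(** The difference of the two sequences expands the zero function; by strong induction, its first
    coefficient not yet known to vanish falls under [bigO_lowcoef]. *)
Lemma asym_uniq f a b : asym f a -> asym f b -> a =1 b.
Proof.
move=> fa fb k; apply/eqP; rewrite -subr_eq0; apply/eqP.
suff H c : asym (fun w => f w - f w) c -> c k = 0 by apply: H (asymB fa fb).
move=> H; elim/ltn_ind: k => k IH.
apply: (@bigO_lowcoef k); apply: bigO_eq (bigON (H k.+1)); apply: near0T => w _.
rewrite subrr sub0r opprK big_ord_recr/= big1 ?add0r// => i _.
by rewrite IH// mul0r.
Qed.

Lemma asym_near0_neq0 f a : asym f a -> a 0%N != 0 -> near0 (fun w => `|a 0%N| / 2 <= `|f w|).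
Proof.
move=> fa a0; have [M M0 H] := fa 1%N.
have M1 : 0 < M + 1 by rewrite ltr_wpDl.
have h : near0 (fun w => w < `|a 0%N| / 2 / (M + 1)).
  by apply: near0_lt; rewrite !divr_gt0// normr_gt0.
apply: near0W (near0_and H h) => w w0 []; rewrite big_ord1 expr0 mulr1 expr1 => h1.
rewrite ltr_pdivlMr// => h2.
have h3 : `|a 0%N| <= `|f w| + M * w.
  rewrite (_ : a 0%N = f w - (f w - a 0%N)); last by ring.
  by rewrite (le_trans (ler_normB _ _))// lerD2l.
have h4 : M * w <= `|a 0%N| / 2.
  by apply: le_trans (ltW h2); rewrite mulrDr mulr1 mulrC lerDl ltW.
have := le_trans h3 (lerD (lexx _) h4); rewrite -lerBlDr.
by rewrite (_ : `|a 0%N| - `|a 0%N| / 2 = `|a 0%N| / 2)//; field.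
Qed.

(** For the truncation B of [b], 1/f - B = (1/f) (1 - f B): the first factor is bounded because f
    stays away from 0, the second is O(w^N) because the coefficients of [conv a b] are those of
    1. *)
Lemma asymV f a b : asym f a -> a 0%N != 0 -> conv a b =1 seq1 K ->
  asym (fun w => (f w)^-1) b.
Proof.
move=> fa a0 ab; apply/asymE => N.
have fn := asym_near0_neq0 fa a0.
have bV : bigO_pow 0 (fun w => (f w)^-1).
  exists (`|a 0%N| / 2)^-1; first by rewrite invr_ge0 divr_ge0.
  apply: near0W fn => w w0 h; rewrite expr0 mulr1 normfV lef_pV2 ?posrE//.
    by apply: lt_le_trans h; rewrite divr_gt0// normr_gt0.
  by rewrite divr_gt0// normr_gt0.
have bp : asym (fun w => (\poly_(i < N) b i).[w]) (fun i => if (i < N)%N then b i else 0).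
  apply/asymE => n.
  have [q qE] : exists q, (\poly_(i < N) b i) -
      \poly_(i < n) (if (i < N)%N then b i else 0) = q * 'X^n.
    by apply: poly_lowcoef0 => i iN; rewrite coefB !coef_poly iN subrr.
  apply: (@bigO_eq _ (fun w => q.[w] * w ^+ n)).
    apply: near0T => w _.
    have -> : q.[w] * w ^+ n = (q * 'X^n).[w] by rewrite hornerM hornerXn.
    by rewrite -qE hornerD hornerN.
  by apply: bigOMl; [exact: bigO_poly|exact: bigO_exp].
have H := asymB asym1 (asymM fa bp).
apply: bigO_eq (bigOMl bV (H N)).
apply: near0W fn => w w0 fw.
have fw0 : f w != 0.
  by rewrite -normr_gt0; apply: lt_le_trans fw; rewrite divr_gt0// normr_gt0.
rewrite big1 => [|i _]; first by field.
suff -> : conv a (fun i => if (i < N)%N then b i else 0) i = conv a b i.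
  by rewrite ab subrr mul0r.
apply: eq_bigr => j _; rewrite ifT//.
exact: leq_ltn_trans (leq_subr _ _) (ltn_ord i).
Qed.

End AsymptoticExpansion.

(** * Real and imaginary parts, complex exponential and logarithm *)

Section ComplexBasics.
Variable R : realType.
Local Notation C := (Cplx R).
Local Notation Re := (@complex.Re R).
Local Notation Im := (@complex.Im R).

Lemma complex_ext (z w : C) : Re z = Re w -> Im z = Im w -> z = w.
Proof. by case: z w => [a b] [c d] /= -> ->. Qed.

Lemma normC_le (z : C) : `|z| <= (`|Re z| + `|Im z|)%:C.
Proof.
rewrite normc_def lecR -[leRHS]ger0_norm ?addr_ge0// -[leRHS]sqrtr_sqr.
rewrite ler_sqrt ?sqr_ge0// -!(real_normK (num_real (Re z))) -!(real_normK (num_real (Im z))).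
by rewrite sqrrD lerD2r lerDl mulrn_wge0// mulr_ge0.
Qed.

Lemma normC_ge_Re (z : C) : (`|Re z|)%:C <= `|z|.
Proof.
rewrite normc_def lecR -sqrtr_sqr ler_sqrt ?addr_ge0 ?sqr_ge0//.
by rewrite lerDl sqr_ge0.
Qed.

Lemma normC_ge_Im (z : C) : (`|Im z|)%:C <= `|z|.
Proof.
rewrite normc_def lecR -sqrtr_sqr ler_sqrt ?addr_ge0 ?sqr_ge0//.
by rewrite lerDr sqr_ge0.
Qed.

Lemma normC_real (x : R) : `|x%:C : C| = (`|x|)%:C.
Proof. by rewrite normc_def /= expr0n addr0 sqrtr_sqr. Qed.

(** The order of [R[i]] compares only elements with equal imaginary parts. Complex epsilons, radii
    and expansion variables are reduced to real ones in this way. *)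
Lemma posC (w : C) : 0 < w -> exists2 r : R, 0 < r & w = r%:C.
Proof.
case: w => a b; rewrite ltcE /= => /andP[/eqP -> a0].
by exists a.
Qed.

Lemma cReD (z w : C) : Re (z + w) = Re z + Re w. Proof. by case: z w => ? ? []. Qed.
Lemma cImD (z w : C) : Im (z + w) = Im z + Im w. Proof. by case: z w => ? ? []. Qed.
Lemma cReN (z : C) : Re (- z) = - Re z. Proof. by case: z. Qed.
Lemma cImN (z : C) : Im (- z) = - Im z. Proof. by case: z. Qed.
Lemma cReM (z w : C) : Re (z * w) = Re z * Re w - Im z * Im w.
Proof. by case: z w => ? ? []. Qed.
Lemma cImM (z w : C) : Im (z * w) = Re z * Im w + Im z * Re w.
Proof. by case: z w => ? ? []. Qed.
Lemma cReMr (x : R) (z : C) : Re (x%:C * z) = x * Re z.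
Proof. by rewrite cReM/= mul0r subr0. Qed.
Lemma cImMr (x : R) (z : C) : Im (x%:C * z) = x * Im z.
Proof. by rewrite cImM/= mul0r addr0. Qed.

Lemma natrC n : (n%:R : C) = (n%:R : R)%:C.
Proof. by rewrite -(rmorph_nat (real_complex R)). Qed.

Lemma realCD (x y : R) : (x + y)%:C = x%:C + y%:C :> C. Proof. exact: rmorphD. Qed.
Lemma realCB (x y : R) : (x - y)%:C = x%:C - y%:C :> C. Proof. exact: rmorphB. Qed.
Lemma realCN (x : R) : (- x)%:C = - x%:C :> C. Proof. exact: rmorphN. Qed.
Lemma realCM (x y : R) : (x * y)%:C = x%:C * y%:C :> C. Proof. exact: rmorphM. Qed.
Lemma realCX (x : R) n : (x ^+ n)%:C = x%:C ^+ n :> C. Proof. exact: rmorphXn. Qed.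
Lemma realCV (x : R) : (x^-1)%:C = x%:C^-1 :> C. Proof. exact: fmorphV. Qed.
Lemma realC_sum I (s : seq I) (P : pred I) (F : I -> R) :
  (\sum_(i <- s | P i) F i)%:C = \sum_(i <- s | P i) (F i)%:C :> C.
Proof. exact: rmorph_sum. Qed.

Lemma cvg_Re (T : Type) (F : set_system T) {FF : Filter F} (f : T -> C) (l : C) :
  f x @[x --> F] --> l -> Re (f x) @[x --> F] --> Re l.
Proof.
move=> /cvgrPdist_lt fl; apply/cvgrPdist_lt => e e0.
have := fl e%:C; rewrite ltcR => /(_ e0); apply: filterS => t h.
by rewrite -ltcR; apply: le_lt_trans h; rewrite -cReN -cReD normC_ge_Re.
Qed.

Lemma cvg_Im (T : Type) (F : set_system T) {FF : Filter F} (f : T -> C) (l : C) :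
  f x @[x --> F] --> l -> Im (f x) @[x --> F] --> Im l.
Proof.
move=> /cvgrPdist_lt fl; apply/cvgrPdist_lt => e e0.
have := fl e%:C; rewrite ltcR => /(_ e0); apply: filterS => t h.
by rewrite -ltcR; apply: le_lt_trans h; rewrite -cImN -cImD normC_ge_Im.
Qed.

Lemma cvg_complex (T : Type) (F : set_system T) {FF : Filter F} (f : T -> C) (l : C) :
  Re (f x) @[x --> F] --> Re l -> Im (f x) @[x --> F] --> Im l -> f x @[x --> F] --> l.
Proof.
move=> /cvgrPdist_lt fl /cvgrPdist_lt gl; apply/cvgrPdist_lt => e.
move=> /posC[r r0 ->]; have r2 : 0 < r / 2 by rewrite divr_gt0.
apply: filterS2 (fl _ r2) (gl _ r2) => t h k.
apply: (le_lt_trans (normC_le _)); rewrite ltcR cReD cImD cReN cImN.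
by rewrite [ltRHS]splitr ltrD.
Qed.

Lemma cvg_realC (T : Type) (F : set_system T) {FF : Filter F} (f : T -> R) (l : R) :
  f x @[x --> F] --> l -> (f x)%:C @[x --> F] --> (l%:C : C).
Proof. by move=> fl; apply: cvg_complex => //=; exact: cvg_cst. Qed.

Lemma cexpD (z w : C) : cexp (z + w) = cexp z * cexp w.
Proof.
case: z w => [a b] [c d]; rewrite /cexp /=.
by apply: complex_ext => /=; rewrite expRD ?cosD ?sinD; ring.
Qed.

Lemma cexp_real (x : R) : cexp (x%:C : C) = (expR x)%:C.
Proof. by apply: complex_ext; rewrite /= ?cos0 ?sin0 ?mulr1 ?mulr0. Qed.

Lemma cexp0 : cexp (0 : C) = 1.
Proof. by rewrite (cexp_real 0) expR0. Qed.

Lemma normC_cexp (z : C) : `|cexp z| = (expR (Re z))%:C.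
Proof.
rewrite normc_def /cexp/= !exprMn -mulrDr cos2Dsin2 mulr1 sqrtr_sqr.
by rewrite ger0_norm// expR_ge0.
Qed.

Lemma clog_real (x : R) : 0 < x -> clog (x%:C : C) = (ln x)%:C.
Proof.
move=> x0; rewrite /clog/= mul0r atan0 mulr0 expr0n addr0 sqrtr_sqr.
by rewrite ger0_norm// ltW.
Qed.
End ComplexBasics.

(** * Taylor's formula with a bounded last derivative *)

Section RealTaylor.
Variable R : realType.

Lemma mvt_bound (H H' : R -> R) (d M : R) N :
  (forall s, 0 <= s <= d -> is_derive s 1 H (H' s)) -> H 0 = 0 ->
  (forall s, 0 <= s <= d -> `|H' s| <= M * s ^+ N) ->
  forall s, 0 <= s <= d -> `|H s| <= M * s ^+ N.+1.
Proof.
move=> dH H0 bH s /andP[s0 sd].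
have M0 : 0 <= M * s ^+ N by apply: le_trans (bH s _); rewrite ?normr_ge0 ?s0.
have cH : {within `[0, s], continuous H}.
  apply: derivable_within_continuous => t; rewrite in_itv/= => /andP[t0 ts].
  by have [] := dH t; rewrite // t0 (le_trans ts sd).
have dH' t : t \in `]0, s[ -> is_derive t 1 H (H' t).
  rewrite in_itv/= => /andP[t0 ts]; apply: dH.
  by rewrite (ltW t0) (le_trans (ltW ts) sd).
have [c] := MVT_segment s0 dH' cH.
rewrite in_itv/= => /andP[c0 cs]; rewrite H0 !subr0 => ->.
rewrite normrM (ger0_norm s0) exprSr mulrA ler_wpM2r//.
rewrite (le_trans (bH _ _)) ?c0 ?(le_trans cs)//.
(* For [M < 0], the bound [0 <= M * s ^+ N] leaves only the degenerate cases N = 0 and s = 0. *)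
have [M1|M1] := leP 0 M; first by rewrite ler_wpM2l// lerXn2r.
case: N {bH} M0 => [|N]; first by rewrite !expr0.
move: s0; rewrite le_eqVlt => /orP[/eqP <-|s0].
  by move=> _; rewrite expr0n/= mulr0 mulr_le0_ge0// ?exprn_ge0// ltW.
by rewrite leNgt nmulr_rlt0// exprn_gt0.
Qed.

(** The derivatives are supplied as a family [G k], so the induction passes to [G k.+1] and comes
    back with [mvt_bound]. The factor 1/N! is given up, since only the order in [s] matters. *)
Lemma taylor_bound N (G : nat -> R -> R) (d M : R) :
  (forall k s, (k < N)%N -> 0 <= s <= d -> is_derive s 1 (G k) (G k.+1 s)) ->
  (forall s, 0 <= s <= d -> `|G N s| <= M) ->
  forall s, 0 <= s <= d ->
    `|G 0%N s - \sum_(k < N) G k 0 * (s ^+ k / k`!%:R)| <= M * s ^+ N.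
Proof.
elim: N G => [|N IH] G dG bG s hs.
  by rewrite big_ord0 subr0 expr0 mulr1 bG.
pose H t := G 0%N t - \sum_(k < N.+1) G k 0 * (t ^+ k / k`!%:R).
pose H' t := G 1%N t - \sum_(k < N) G k.+1 0 * (t ^+ k / k`!%:R).
apply: (@mvt_bound H H' d) => //.
- move=> t ht; rewrite /H /H'.
  have E : (fun t => \sum_(k < N.+1) G k 0 * (t ^+ k / k`!%:R)) =
      (\sum_(k < N.+1) (fun t => (G k 0 / k`!%:R) * t ^+ k)).
    apply/funext => u; rewrite fct_sumE; apply: eq_bigr => i _.
    by rewrite mulrA [RHS]mulrAC.
  have D1 := dG 0%N t isT ht.
  have D2 : is_derive t 1 (\sum_(k < N.+1) (fun t => (G k 0 / k`!%:R) * t ^+ k))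
     (\sum_(k < N.+1) (G k 0 / k`!%:R) * (k%:R * t ^+ k.-1)).
    have D3 (i : 'I_N.+1) : is_derive t 1 (fun t => (G i 0 / i`!%:R) * t ^+ i)
        ((G i 0 / i`!%:R) * (i%:R * t ^+ i.-1)).
      have := @is_deriveX _ _ id i t 1 1 (is_derive_id _ _).
      move=> /(@is_deriveZ _ _ _ _ (G i 0 / i`!%:R) t 1) h.
      rewrite (_ : (fun t => _) = (G i 0 / i`!%:R) \*: (id ^+ i)); last first.
        by apply/funext => v; rewrite /= exprfctE.
      by apply: is_derive_eq h _; rewrite [_ *: 1]mulr1.
    exact: (is_derive_sum D3).
  have := is_deriveB D1 D2; rewrite -E.
  move=> h; apply: is_derive_eq h _; congr (_ - _).
  rewrite big_ord_recl/= mul0r mulr0 add0r; apply: eq_bigr => i _.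
  rewrite /bump/= add1n factS natrM; field.
  by rewrite pnatr_eq0 -lt0n fact_gt0 addrC natr1 pnatr_eq0.
- rewrite /H big_ord_recl/= expr0 fact0 divr1 mulr1 big1 ?addr0 ?subrr// => i _.
  by rewrite expr0n/= mul0r mulr0.
- move=> t ht; apply: (IH (fun k => G k.+1)) => // k u kN hu.
  by apply: dG.
Qed.
End RealTaylor.

(** * Complex functions along a real direction *)

Section ComplexTaylor.
Variable R : realType.
Local Notation C := (Cplx R).
Local Notation Re := (@complex.Re R).
Local Notation Im := (@complex.Im R).

Lemma cvg_dnbhs_realC : (h%:C : C) @[h --> (0 : R)^'] --> (0 : C)^'.
Proof.
move=> P [e /posC[r r0 ->] hP]; exists r => //= h hr h0; apply: hP => /=.
  by move: hr; rewrite /ball_/= !sub0r !normrN normC_real ltcR.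
by apply: contra_neq h0 => -[].
Qed.

(** Restricting the complex difference quotient to real increments makes the real Taylor bound
    available for both parts of a complex function. *)
Lemma is_derive_ReIm (f : C -> C) (z l : C) (s : R) :
  is_derive (z + s%:C) 1 f l ->
  is_derive s 1 (fun t => Re (f (z + t%:C))) (Re l) /\
  is_derive s 1 (fun t => Im (f (z + t%:C))) (Im l).
Proof.
move=> [df dl].
have H : (h%:C)^-1 * (f (z + (h + s)%:C) - f (z + s%:C)) @[h --> (0 : R)^'] --> l.
  have : h^-1 *: (f (h *: 1 + (z + s%:C)) - f (z + s%:C)) @[h --> (0 : C)^'] --> l.
    by move: df; rewrite /derivable -dl.
  move/(cvg_comp _ _ cvg_dnbhs_realC); apply: cvg_trans; apply: near_eq_cvg.
  apply: nearW => h /=; congr (_ * (f _ - _)).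
  by rewrite [_ *: 1]mulr1 realCD addrCA.
have HR := cvg_Re H; have HI := cvg_Im H.
have E1 : (fun h : R => Re ((h%:C)^-1 * (f (z + (h + s)%:C) - f (z + s%:C)))) =
  (fun h => h^-1 *: (Re (f (z + (h *: 1 + s)%:C)) - Re (f (z + s%:C)))).
  by apply/funext => h; rewrite -realCV cReMr cReD cReN [h *: 1]mulr1.
have E2 : (fun h : R => Im ((h%:C)^-1 * (f (z + (h + s)%:C) - f (z + s%:C)))) =
  (fun h => h^-1 *: (Im (f (z + (h *: 1 + s)%:C)) - Im (f (z + s%:C)))).
  by apply/funext => h; rewrite -realCV cImMr cImD cImN [h *: 1]mulr1.
rewrite E1 in HR; rewrite E2 in HI.
split; apply: DeriveDef.
- by apply/cvg_ex; exists (Re l); exact: HR.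
- by apply: cvg_lim => //; exact: HR.
- by apply/cvg_ex; exists (Im l); exact: HI.
- by apply: cvg_lim => //; exact: HI.
Qed.

(** Second-order Taylor bound on [0, 1] for the real and imaginary parts of s -> exp(s u), where
    each derivative multiplies by u; the factor 2 comes from adding the two bounds. *)
Lemma normC_cexp_taylor2 (u : C) :
  `|cexp u - 1 - u| <= 2 * `|u| ^+ 2 * (expR `|Re u|)%:C.
Proof.
pose n := complex.Re `|u|.
have nE : `|u| = n%:C.
  by rewrite /n normc_def.
have n0 : 0 <= n by rewrite -ler0c -nE.
have reu : `|Re u| <= n by rewrite -lecR -nE normC_ge_Re.
have imu : `|Im u| <= n by rewrite -lecR -nE normC_ge_Im.
pose G1 k s := Re (u ^+ k * cexp (s%:C * u)).
pose G2 k s := Im (u ^+ k * cexp (s%:C * u)).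
have dcexp (s : R) : is_derive s 1 (fun s => Re (cexp (s%:C * u))) (Re (u * cexp (s%:C * u)))
   /\ is_derive s 1 (fun s => Im (cexp (s%:C * u))) (Im (u * cexp (s%:C * u))).
  have d1 (c : R) : is_derive s 1 (fun s => s * c) c.
    have := @is_deriveM _ _ id (cst c) s 1 _ _ (is_derive_id _ _) (is_derive_cst _ _ _).
    by move=> h; apply: is_derive_eq h _; rewrite scaler0 add0r [_ *: 1]mulr1.
  have de : is_derive s 1 (fun s => expR (s * Re u)) (expR (s * Re u) * Re u).
    apply: is_derive_eq (@is_derive1_comp _ expR _ s _ _ _ (d1 _)) _.
    by rewrite mulrC.
  have dc : is_derive s 1 (fun s => cos (s * Im u)) (- sin (s * Im u) * Im u).
    apply: is_derive_eq (@is_derive1_comp _ cos _ s _ _ _ (d1 _)) _.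
    by rewrite mulrC.
  have ds : is_derive s 1 (fun s => sin (s * Im u)) (cos (s * Im u) * Im u).
    apply: is_derive_eq (@is_derive1_comp _ sin _ s _ _ _ (d1 _)) _.
    by rewrite mulrC.
  have fR : (fun s => Re (cexp (s%:C * u))) = (fun s => expR (s * Re u)) * (fun s => cos (s * Im u)).
    by apply/funext => t; rewrite /cexp/= cReMr cImMr.
  have fI : (fun s => Im (cexp (s%:C * u))) = (fun s => expR (s * Re u)) * (fun s => sin (s * Im u)).
    by apply/funext => t; rewrite /cexp/= cReMr cImMr.
  rewrite fR fI; split.
    apply: is_derive_eq (is_deriveM de dc) _.
    by rewrite cReM /cexp/= cReMr cImMr /GRing.scale/=; ring.
  apply: is_derive_eq (is_deriveM de ds) _.
  by rewrite cImM /cexp/= cReMr cImMr /GRing.scale/=; ring.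
have dG1 (k : nat) (s : R) : is_derive s 1 (G1 k) (G1 k.+1 s).
  have [d1 d2] := dcexp s.
  have -> : G1 k = Re (u ^+ k) \*: (fun s => Re (cexp (s%:C * u))) -
     Im (u ^+ k) \*: (fun s => Im (cexp (s%:C * u))).
    by apply/funext => t; rewrite /G1 cReM.
  apply: is_derive_eq (is_deriveB (is_deriveZ _ d1) (is_deriveZ _ d2)) _.
  by rewrite /G1 exprSr -mulrA [RHS]cReM.
have dG2 (k : nat) (s : R) : is_derive s 1 (G2 k) (G2 k.+1 s).
  have [d1 d2] := dcexp s.
  have -> : G2 k = Re (u ^+ k) \*: (fun s => Im (cexp (s%:C * u))) +
     Im (u ^+ k) \*: (fun s => Re (cexp (s%:C * u))).
    by apply/funext => t; rewrite /G2 cImM.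
  apply: is_derive_eq (is_deriveD (is_deriveZ _ d2) (is_deriveZ _ d1)) _.
  by rewrite /G2 exprSr -mulrA [RHS]cImM.
have bnd (s : R) : 0 <= s <= 1 -> `|u ^+ 2 * cexp (s%:C * u)| <= (n ^+ 2 * expR `|Re u|)%:C.
  move=> /andP[s0 s1]; rewrite normrM normrX nE normC_cexp -realCX -realCM lecR.
  rewrite ler_wpM2l ?exprn_ge0// ler_expR cReMr (le_trans (ler_norm _))//.
  by rewrite normrM (ger0_norm s0) ler_piMl.
have T1 := @taylor_bound _ 2 G1 1 (n ^+ 2 * expR `|Re u|) (fun k s _ _ => dG1 k s).
have T2 := @taylor_bound _ 2 G2 1 (n ^+ 2 * expR `|Re u|) (fun k s _ _ => dG2 k s).
have {}T1 : `|Re (cexp u - 1 - u)| <= n ^+ 2 * expR `|Re u|.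
  have := T1 _ 1 _; rewrite ler01 lexx => /(_ _ isT).
  rewrite expr1n mulr1 (_ : \sum_(k < 2) _ = Re (1 + u)).
    rewrite /G1 expr0 !mul1r -cReN -cReD opprD addrA; apply=> s hs.
    by rewrite -lecR; apply: le_trans (bnd _ hs); exact: normC_ge_Re.
  transitivity (G1 0%N 0 * (1 / 1) + G1 1%N 0 * (1 / 1)).
    by rewrite 2!big_ord_recl big_ord0 addr0 !expr1n.
  by rewrite divr1 !mulr1 /G1 mul0r cexp0 !mulr1 -cReD expr0 expr1.
have {}T2 : `|Im (cexp u - 1 - u)| <= n ^+ 2 * expR `|Re u|.
  have := T2 _ 1 _; rewrite ler01 lexx => /(_ _ isT).
  rewrite expr1n mulr1 (_ : \sum_(k < 2) _ = Im (1 + u)).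
    rewrite /G2 expr0 !mul1r -cImN -cImD opprD addrA; apply=> s hs.
    by rewrite -lecR; apply: le_trans (bnd _ hs); exact: normC_ge_Im.
  transitivity (G2 0%N 0 * (1 / 1) + G2 1%N 0 * (1 / 1)).
    by rewrite 2!big_ord_recl big_ord0 addr0 !expr1n.
  by rewrite divr1 !mulr1 /G2 mul0r cexp0 !mulr1 -cImD expr0 expr1.
apply: (le_trans (normC_le _)); rewrite nE -realCX (natrC R 2) -!realCM lecR.
by rewrite -mulrA mulr_natl mulr2n lerD.
Qed.

End ComplexTaylor.

(** * Iterated complex derivatives *)

Section ComplexSmooth.
Variable R : realType.
Local Notation C := (Cplx R).
Local Notation Re := (@complex.Re R).
Local Notation Im := (@complex.Im R).
Implicit Types (f g : C -> C) (U : set C) (z : C).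

(** The finite order [n] is there for induction: the derivative of a product or an inverse is built
    from products and inverses of functions smooth to one order less. *)
Definition smooth_upto U n f : Prop :=
  forall k, (k < n)%N -> forall z, U z -> derivable (derive1n k f) z 1.

Definition csmooth z f : Prop :=
  exists2 U, open_nbhs z U & forall n, smooth_upto U n f.

Lemma eq_derivable_on U f g : open U -> (forall z, U z -> f z = g z) ->
  forall z, U z -> derivable f z 1 -> derivable g z 1.
Proof.
move=> oU fg z Uz; apply: near_eq_derivable.
by apply: filterS (open_nbhs_nbhs (conj oU Uz)).
Qed.

Lemma eq_derive1n_on U f g : open U -> (forall z, U z -> f z = g z) ->
  forall k z, U z -> derive1n k f z = derive1n k g z.
Proof.
move=> oU fg; elim=> [|k IH] z Uz; first exact: fg.
rewrite !derive1nS !derive1E; apply: near_eq_derive.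
by apply: filterS (open_nbhs_nbhs (conj oU Uz)).
Qed.

Lemma eq_smooth_upto U n f g : open U -> (forall z, U z -> f z = g z) ->
  smooth_upto U n f -> smooth_upto U n g.
Proof.
move=> oU fg sf k kn z Uz.
apply: (@eq_derivable_on U (derive1n k f)) (sf k kn z Uz) => // w Uw.
exact: (eq_derive1n_on oU fg).
Qed.

Lemma smooth_uptoS U n f : smooth_upto U n.+1 f <->
  (forall z, U z -> derivable f z 1) /\ smooth_upto U n (derive1 f).
Proof.
split=> [H|[H1 H2] [|k] kn z Uz]; first split=> [z Uz|k kn z Uz].
- exact: (H 0%N).
- by rewrite -derive1Sn; exact: H.
- exact: H1.
- by rewrite derive1Sn; exact: H2.
Qed.

Lemma smooth_uptoW U n f : smooth_upto U n.+1 f -> smooth_upto U n f.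
Proof. by move=> H k kn; apply: H; exact: ltnW. Qed.

Lemma smooth_uptoD U n f g : open U -> smooth_upto U n f -> smooth_upto U n g ->
  smooth_upto U n (fun z => f z + g z).
Proof.
move=> oU; elim: n f g => [|n IH] f g; first by move=> _ _ k.
move=> /smooth_uptoS[df sf] /smooth_uptoS[dg sg]; apply/smooth_uptoS; split.
  by move=> z Uz; apply: derivableD; [exact: df|exact: dg].
apply: eq_smooth_upto (IH _ _ sf sg) => // z Uz.
by rewrite !derive1E deriveD//; [exact: df|exact: dg].
Qed.

Lemma smooth_uptoM U n f g : open U -> smooth_upto U n f -> smooth_upto U n g ->
  smooth_upto U n (fun z => f z * g z).
Proof.
move=> oU; elim: n f g => [|n IH] f g; first by move=> _ _ k.
move=> sf' sg'.
move: (sf') (sg') => /smooth_uptoS[df sf] /smooth_uptoS[dg sg]; apply/smooth_uptoS; split.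
  by move=> z Uz; apply: derivableM; [exact: df|exact: dg].
apply: eq_smooth_upto (smooth_uptoD oU (IH _ _ (smooth_uptoW sf') sg)
  (IH _ _ (smooth_uptoW sg') sf)) => // z Uz.
by rewrite !derive1E deriveM//; [exact: df|exact: dg].
Qed.

Lemma smooth_uptoN U n f : open U -> smooth_upto U n f ->
  smooth_upto U n (fun z => - f z).
Proof.
move=> oU; elim: n f => [|n IH] f; first by move=> _ k.
move=> /smooth_uptoS[df sf]; apply/smooth_uptoS; split.
  by move=> z Uz; apply: derivableN; exact: df.
apply: eq_smooth_upto (IH _ sf) => // z Uz.
by rewrite !derive1E deriveN//; exact: df.
Qed.

Lemma smooth_uptoV U n f : open U -> (forall z, U z -> f z != 0) -> smooth_upto U n f ->
  smooth_upto U n (fun z => (f z)^-1).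
Proof.
move=> oU f0; elim: n => [|n IH]; first by move=> _ k.
move=> sf; have sV := IH (smooth_uptoW sf).
move: sf => /smooth_uptoS[df sf]; apply/smooth_uptoS; split.
  by move=> z Uz; apply: derivableV; [exact: f0|exact: df].
apply: eq_smooth_upto (smooth_uptoN oU (smooth_uptoM oU (smooth_uptoM oU sV sV) sf)) => // z Uz.
rewrite !derive1E deriveV//; [|exact: f0|exact: df].
by rewrite [_ *: _]mulNr -exprVn expr2.
Qed.

(** Meant for families closed under differentiation, such as Mellin transforms with growing powers
    of [ln t]. Openness of [U] makes each equality hold near the point, hence also after
    differentiation. *)
Lemma derive1n_seq U (F : nat -> C -> C) : open U ->
  (forall k z, U z -> is_derive z 1 (F k) (F k.+1 z)) ->
  (forall k z, U z -> derive1n k (F 0%N) z = F k z) /\ (forall n, smooth_upto U n (F 0%N)).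
Proof.
move=> oU dF.
have E : forall k z, U z -> derive1n k (F 0%N) z = F k z.
  elim=> [//|k IH] z Uz; rewrite derive1nS derive1E.
  have [_ <-] := dF k z Uz; apply: near_eq_derive.
  by apply: filterS (open_nbhs_nbhs (conj oU Uz)).
split=> // n k kn z Uz.
have [h _] := dF k z Uz; apply: (eq_derivable_on oU _ Uz h) => w Uw.
by rewrite E.
Qed.

Lemma csmooth_near z f g : (\near z, f z = g z) -> csmooth z f -> csmooth z g.
Proof.
move=> fg [U [oU Uz] sf].
have : nbhs z [set w | f w = g w] by exact: fg.
rewrite nbhsE => -[V [oV Vz] {}fg].
exists (U `&` V); first exact: (conj (openI oU oV) (conj Uz Vz)).
have h : forall w, (U `&` V) w -> f w = g w by move=> w [_ /fg].
move=> n; apply: (eq_smooth_upto (openI oU oV) h) => k kn w [Uw _].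
exact: (sf n).
Qed.

Lemma derivable_continuousC f z : derivable f z 1 -> f w @[w --> z] --> f z.
Proof. by move=> /derivable1_diffP/differentiable_continuous. Qed.

Lemma csmooth_continuous z f k : csmooth z f ->
  derive1n k f w @[w --> z] --> derive1n k f z.
Proof.
move=> [U [oU Uz] sf]; apply: derivable_continuousC.
exact: (sf k.+1 k).
Qed.

Lemma csmoothM z f g : csmooth z f -> csmooth z g -> csmooth z (fun w => f w * g w).
Proof.
move=> [U [oU Uz] sf] [V [oV Vz] sg].
exists (U `&` V); first exact: (conj (openI oU oV) (conj Uz Vz)).
move=> n; apply: (smooth_uptoM (openI oU oV)).
  by move=> k kn w [Uw _]; exact: (sf n).
by move=> k kn w [_ Vw]; exact: (sg n).
Qed.

Lemma csmoothV z f : f z != 0 -> csmooth z f -> csmooth z (fun w => (f w)^-1).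
Proof.
move=> fz0 sf'; have cf := csmooth_continuous (k := 0) sf'.
have : nbhs z [set w | f w != 0].
  have /cvgrPdist_lt/(_ `|f z|) := cf; rewrite normr_gt0 => /(_ fz0).
  apply: filterS => w; rewrite /= => h; apply/eqP => fw0.
  by move: h; rewrite fw0 subr0 ltxx.
rewrite nbhsE => -[V [oV Vz] fg].
move: sf' => [U [oU Uz] sf].
exists (U `&` V); first exact: (conj (openI oU oV) (conj Uz Vz)).
move=> n; apply: (smooth_uptoV (openI oU oV)).
  by move=> w [_ /fg].
by move=> k kn w [Uw _]; exact: (sf n).
Qed.

(** The Taylor bound is applied to the real and imaginary parts on the segment from z to z + r,
    where continuity keeps the norm of the N-th derivative at most one above its value at z. *)
Lemma csmooth_asym z f : csmooth z f ->
  @asym R[i] (fun w => f (z + w)) (fun k => derive1n k f z / k`!%:R).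
Proof.
move=> sf' N; have cf := csmooth_continuous (k := N) sf'.
move: sf' => [U oU sf].
have [r r0 Ur] : exists2 r : R, 0 < r & forall s, 0 <= s <= r ->
    U (z + s%:C) /\ `|derive1n N f (z + s%:C)| <= `|derive1n N f z| + 1.
  have h1 : \near z, U z by exact: open_nbhs_nbhs.
  have h2 : \forall w \near z, `|derive1n N f w| <= `|derive1n N f z| + 1.
    have /cvgrPdist_lt/(_ 1 ltr01) := cf; apply: filterS => w /ltW h.
    rewrite -lerBlDl (le_trans _ h)//.
    by rewrite (le_trans (lerB_dist _ _))// distrC.
  have : \forall w \near z, U w /\ `|derive1n N f w| <= `|derive1n N f z| + 1.
    exact: filterS2 h1 h2.
  move=> [e /posC[r r0 ->] H]; exists (r / 2); first by rewrite divr_gt0.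
  move=> s /andP[s0 sr]; apply: H; rewrite /ball_/= opprD addrA subrr sub0r normrN normC_real.
  by rewrite ltcR ger0_norm// (le_lt_trans sr)// ltr_pdivrMr// ltr_pMr// ltr1n.
pose B := complex.Re (`|derive1n N f z| + 1).
have BE : `|derive1n N f z| + 1 = B%:C by apply: complex_ext; rewrite /B ?normc_def /= ?addr0.
have B0 : 0 <= B by rewrite -ler0c -BE addr_ge0.
exists (2 * B)%:C; first by rewrite ler0c mulr_ge0.
exists r%:C; first by rewrite ltcR.
move=> w /posC[s s0 ->]; rewrite ltcR => sr.
have hs : 0 <= s <= r by rewrite !ltW.
have d1 k t : (k < N)%N -> 0 <= t <= r -> is_derive (z + t%:C) 1 (derive1n k f) (derive1n k.+1 f (z + t%:C)).
  move=> kN /Ur[Ut _]; rewrite derive1nS derive1E; apply: derivableP.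
  exact: (sf k.+1 k).
have T1 := @taylor_bound _ N (fun k t => Re (derive1n k f (z + t%:C))) r B
  (fun k t kN ht => (is_derive_ReIm (d1 k t kN ht)).1) _ s hs.
have T2 := @taylor_bound _ N (fun k t => Im (derive1n k f (z + t%:C))) r B
  (fun k t kN ht => (is_derive_ReIm (d1 k t kN ht)).2) _ s hs.
have b1 t : 0 <= t <= r -> `|Re (derive1n N f (z + t%:C))| <= B.
  move=> /Ur[_ h]; rewrite -lecR -BE; apply: le_trans h; exact: normC_ge_Re.
have b2 t : 0 <= t <= r -> `|Im (derive1n N f (z + t%:C))| <= B.
  move=> /Ur[_ h]; rewrite -lecR -BE; apply: le_trans h; exact: normC_ge_Im.
have {T1 b1}T1 := T1 b1; have {T2 b2}T2 := T2 b2.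
have E : f (z + s%:C) - \sum_(i < N) derive1n i f z / i`!%:R * s%:C ^+ i =
  (Re (f (z + s%:C)) - \sum_(k < N) Re (derive1n k f (z + 0%:C)) * (s ^+ k / k`!%:R)) +i*
  (Im (f (z + s%:C)) - \sum_(k < N) Im (derive1n k f (z + 0%:C)) * (s ^+ k / k`!%:R)).
  have E1 : \sum_(i < N) derive1n i f z / i`!%:R * s%:C ^+ i =
     (\sum_(k < N) Re (derive1n k f (z + 0%:C)) * (s ^+ k / k`!%:R)) +i*
     (\sum_(k < N) Im (derive1n k f (z + 0%:C)) * (s ^+ k / k`!%:R)).
    elim/big_rec3: _ => [//|i y1 y2 y3 _ ->].
    rewrite addr0 natrC -realCX -realCV.
    by case: (derive1n i f z) => a b; apply: complex_ext => /=; ring.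
  by rewrite E1; apply: complex_ext; rewrite ?cReD ?cImD ?cReN ?cImN.
rewrite E; apply: (le_trans (normC_le _)); rewrite -realCX -realCM lecR /=.
by rewrite -mulrA mulr_natl mulr2n lerD.
Qed.

End ComplexSmooth.

(** * Integration on the half-line and change of scale *)

Definition dilation (R : realType) (c : R) : measurableTypeR R -> measurableTypeR R :=
  fun t => c * t.

Lemma measurable_dilation (R : realType) (c : R) : measurable_fun setT (@dilation R c).
Proof.
have : measurable_fun setT (fun t : R => c * t) by apply: measurable_funM.
exact.
Qed.

Section HalfLine.
Variable R : realType.
Local Notation mu := (@lebesgue_measure R).
Local Notation Rpos := (`]0, +oo[%classic : set R).
Implicit Types (f g : R -> R).

Definition mfp f : Prop := measurable_fun Rpos f.
Definition itg f : Prop := mu.-integrable Rpos (EFin \o f).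
Definition I0 f : R := \int[mu]_(t in Rpos) f t.

Lemma mRpos : @measurable _ (measurableTypeR R) Rpos.
Proof. exact: measurable_itv. Qed.

Lemma RposP (t : R) : Rpos t <-> 0 < t.
Proof. by rewrite /= in_itv/= andbT. Qed.

Lemma I0_eq f g : (forall t, 0 < t -> f t = g t) -> I0 f = I0 g.
Proof. by move=> fg; apply: eq_Rintegral => t; rewrite inE => /RposP; exact: fg. Qed.

Lemma itg_eq f g : (forall t, 0 < t -> f t = g t) -> itg f -> itg g.
Proof.
move=> fg; apply: eq_integrable; first exact: mRpos.
by move=> t; rewrite inE => /RposP t0 /=; rewrite fg.
Qed.

Lemma mfp_eq f g : (forall t, 0 < t -> f t = g t) -> mfp f -> mfp g.
Proof.
by move=> fg; apply: eq_measurable_fun => t; rewrite inE => /RposP; exact: fg.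
Qed.

Lemma itg_mfp f : itg f -> mfp f.
Proof. by move/measurable_int/measurable_EFinP. Qed.

Lemma itg_le f g : mfp f -> (forall t, 0 < t -> `|f t| <= g t) -> itg g -> itg f.
Proof.
move=> mf fg; apply: le_integrable; first exact: mRpos.
  exact/measurable_EFinP.
move=> t /RposP t0 /=; rewrite lee_fin (le_trans (fg _ t0))// ler_norm//.
Qed.

Lemma itgD f g : itg f -> itg g -> itg (fun t => f t + g t).
Proof. by move=> fi gi; apply: eq_integrable (integrableD mRpos fi gi) => //; exact: mRpos. Qed.

Lemma itgZ (c : R) f : itg f -> itg (fun t => c * f t).
Proof. by move=> fi; apply: eq_integrable (integrableZl mRpos c fi) => //; exact: mRpos. Qed.

Lemma itgN f : itg f -> itg (fun t => - f t).
Proof. by move=> /(itgZ (-1)); apply: itg_eq => t _; rewrite mulN1r. Qed.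

Lemma itgB f g : itg f -> itg g -> itg (fun t => f t - g t).
Proof. by move=> fi /itgN; exact: itgD. Qed.

Lemma itg_norm f : itg f -> itg (fun t => `|f t|).
Proof. by move/integrable_norm. Qed.

Lemma I0D f g : itg f -> itg g -> I0 (fun t => f t + g t) = I0 f + I0 g.
Proof. by move=> fi gi; exact: (RintegralD mRpos fi gi). Qed.

Lemma I0Z (c : R) f : itg f -> I0 (fun t => c * f t) = c * I0 f.
Proof. by move=> fi; exact: (RintegralZl c mRpos fi). Qed.

Lemma I0N f : itg f -> I0 (fun t => - f t) = - I0 f.
Proof.
move=> fi; rewrite -mulN1r -I0Z//; apply: I0_eq => t _.
by rewrite mulN1r.
Qed.

Lemma I0B f g : itg f -> itg g -> I0 (fun t => f t - g t) = I0 f - I0 g.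
Proof. by move=> fi gi; rewrite I0D ?I0N//; exact: itgN. Qed.

Lemma I0_le f g : itg f -> itg g -> (forall t, 0 < t -> f t <= g t) -> I0 f <= I0 g.
Proof.
move=> fi gi fg; apply: (le_Rintegral mRpos fi gi).
by move=> t /RposP; exact: fg.
Qed.

Lemma I0_norm_le f : itg f -> `|I0 f| <= I0 (fun t => `|f t|).
Proof. by move=> fi; exact: (le_normr_Rintegral mRpos fi). Qed.

Lemma I0_ge0 f : (forall t, 0 < t -> 0 <= f t) -> 0 <= I0 f.
Proof. by move=> f0; apply: Rintegral_ge0 => t /RposP; exact: f0. Qed.

Lemma I0_bound f g : itg f -> itg g -> (forall t, 0 < t -> `|f t| <= g t) ->
  `|I0 f| <= I0 g.
Proof.
move=> fi gi fg; apply: (le_trans (I0_norm_le fi)).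
by apply: I0_le => //; exact: itg_norm.
Qed.

Lemma I0_0 : I0 (fun=> 0) = 0.
Proof. by rewrite /I0 Rintegral_cst ?mul0r//; exact: mRpos. Qed.

Lemma itg_0 : itg (fun=> 0).
Proof. exact: integrable0. Qed.

Definition dilated_measure (c : R) : {measure set (measurableTypeR R) -> \bar R} :=
  measure_function_pushforward__canonical__measure_function_Measure
    mu (measurable_dilation c).

(** Half-open intervals pull back to []a / c, b / c]], so the rescaled push-forward has the right
    value on them, and Lebesgue measure is determined by these values. *)
Lemma lebesgue_measure_dilation (c : {posnum R}) (A : set (measurableTypeR R)) :
  measurable A -> mu A = mscale c%:num%:nng (dilated_measure c%:num) A.
Proof.
move=> mA; apply: lebesgue_measure_unique => //= _ [[a b]] _ <-.
rewrite /mscale/= /pushforward/=.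
have -> : dilation c%:num @^-1` [set` `]a, b]] = [set` `]a / c%:num, b / c%:num]].
  by apply/seteqP; split => t /=; rewrite !in_itv/= ltr_pdivrMr// ler_pdivlMr// mulrC.
rewrite !lebesgue_measure_itv/= !lte_fin ltr_pM2r//; case: ifP => _; last by rewrite mule0.
by rewrite -!EFinB -EFinM mulrBr ![c%:num * _]mulrC !divfK.
Qed.

Lemma ge0_integral_dilation (c : {posnum R}) (F : R -> \bar R) :
  measurable_fun setT F -> (forall t, (0 <= F t)%E) ->
  (\int[mu]_t F t = c%:num%:E * \int[mu]_t F (c%:num * t)%R)%E.
Proof.
move=> mF F0.
rewrite (@eq_measure_integral _ _ _ _ (mscale c%:num%:nng (dilated_measure c%:num))); last first.
  by move=> A mA _; exact: lebesgue_measure_dilation.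
rewrite ge0_integral_mscale//; congr (_ * _)%E.
by rewrite ge0_integral_pushforward//; exact: measurable_dilation.
Qed.

Lemma I0_dilation (c : R) f : 0 < c -> mfp f ->
  I0 f = c * I0 (fun t => f (c * t)).
Proof.
move=> c0; rewrite -[c]/((PosNum c0)%:num); move: (PosNum c0) => {c0}c mf.
have mF : measurable_fun setT (EFin \o (f \_ Rpos)).
  apply/measurable_EFinP.
  by apply/(measurable_restrictT _ mRpos).
pose F : R -> \bar R := EFin \o (f \_ Rpos).
have I0E h : I0 h = fine (\int[mu]_t (h \_ Rpos t)%:E)%E.
  by rewrite /I0 Rintegral_mkcond.
have -> : I0 (fun t => f (c%:num * t)) = fine (\int[mu]_t F (c%:num * t)%R)%E.
  rewrite I0E; congr fine; apply: eq_integral => t _.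
  rewrite /F /= /patch !mem_setE /= !in_itv/= !andbT.
  by rewrite pmulr_rgt0.
have -> : I0 f = fine (\int[mu]_t F t)%E by rewrite I0E.
rewrite [in LHS]integralE [in RHS]integralE.
rewrite (@ge0_integral_dilation c (F^\+)%E)//; last exact: measurable_funepos.
rewrite (@ge0_integral_dilation c (F^\-)%E)//; last exact: measurable_funeneg.
(* This covers divergent parts too: multiplication by [c > 0] preserves infinities, and [fine] sends
   them to 0. *)
have fineMB (x y : \bar R) : (0 <= x)%E -> (0 <= y)%E ->
    fine (c%:num%:E * x - c%:num%:E * y)%E = c%:num * fine (x - y)%E.
  have c0 : (0 < c%:num%:E)%E by rewrite lte_fin.
  case: x y => [x| |] [y| |] //= _ _; rewrite ?gt0_muley//= ?mulr0//.
  by rewrite mulrBr.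
rewrite fineMB.
- by congr (_ * fine (_ - _)%E); apply: eq_integral => t _; rewrite ?funeposE ?funenegE.
- by apply: integral_ge0.
- by apply: integral_ge0.
Qed.
End HalfLine.

(** * Two-sided decay, and integrals of derivatives over the half-line *)

Section Admissible.
Variable R : realType.
Local Notation mu := (@lebesgue_measure R).
Local Notation Rpos := (`]0, +oo[%classic : set R).
Implicit Types (f g : R -> R) (s t w : R).

Lemma mfp_cst (c : R) : mfp (fun=> c).
Proof. exact: measurable_cst. Qed.

Lemma mfp_id : mfp (fun t : R => t).
Proof. exact: measurable_id. Qed.

Lemma mfp_ln : mfp (@ln R).
Proof. exact: measurable_funTS. Qed.

Lemma mfpD f g : mfp f -> mfp g -> mfp (fun t => f t + g t).
Proof. exact: measurable_funD. Qed.

Lemma mfpN f : mfp f -> mfp (fun t => - f t).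
Proof. exact: measurable_funN. Qed.

Lemma mfpB f g : mfp f -> mfp g -> mfp (fun t => f t - g t).
Proof. exact: measurable_funB. Qed.

Lemma mfpM f g : mfp f -> mfp g -> mfp (fun t => f t * g t).
Proof. exact: measurable_funM. Qed.

Lemma mfpX f n : mfp f -> mfp (fun t => f t ^+ n).
Proof. exact: measurable_funX. Qed.

Lemma mfp_norm f : mfp f -> mfp (fun t => `|f t|).
Proof. by move=> mf; apply: measurableT_comp. Qed.

Lemma mfp_exp f : mfp f -> mfp (fun t => expR (f t)).
Proof. by move=> mf; apply: measurableT_comp. Qed.

Lemma mfp_lncomp f : mfp f -> mfp (fun t => ln (f t)).
Proof. by move=> mf; apply: measurableT_comp => //; exact: measurable_ln. Qed.

Lemma mfp_cos f : mfp f -> mfp (fun t => cos (f t)).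
Proof.
move=> mf; apply: measurableT_comp => //; apply: continuous_measurable_fun.
exact: continuous_cos.
Qed.

Lemma mfp_sin f : mfp f -> mfp (fun t => sin (f t)).
Proof.
move=> mf; apply: measurableT_comp => //; apply: continuous_measurable_fun.
exact: continuous_sin.
Qed.

Lemma mfpV f : (forall t, 0 < t -> 0 < f t) -> mfp f -> mfp (fun t => (f t)^-1).
Proof.
move=> f0 /mfp_lncomp/mfpN/mfp_exp; apply: mfp_eq => t /f0 ft.
by rewrite expRN lnK.
Qed.

(** This is min(t^(s-1), t^(-s-1)), integrable at both ends for s > 0. *)
Definition wgt s t : R := expR (- (s * `|ln t|)) / t.

(* The decay of [phi] at both ends of the half-line that makes its Mellin
   transform [w |-> \int t^w phi(t) dt] analytic on |Re w| < s. *)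
Definition adm s f : Prop :=
  mfp f /\ exists C, forall t, 0 < t -> `|f t| <= C * wgt s t.

Lemma wgt_gt0 s t : 0 < t -> 0 < wgt s t.
Proof. by move=> t0; rewrite divr_gt0// expR_gt0. Qed.

Lemma mfp_wgt s : mfp (wgt s).
Proof.
apply: mfpM; last by apply: mfpV => //; exact: mfp_id.
apply: mfp_exp; apply: mfpN; apply: mfpM; first exact: mfp_cst.
exact: (mfp_norm mfp_ln).
Qed.

(** Compact exhaustion by |ln t| <= n + 1, so that both endpoints get the same bound exp(- s (n +
    1)). *)
Let F (n : nat) : set R := `[expR (- n.+1%:R), expR n.+1%:R]%classic.

Let expRN_lt n : expR (- n.+1%:R) < expR n.+1%:R :> R.
Proof. by rewrite ltr_expR gtrN. Qed.

Let F_nondecreasing : nondecreasing_seq F.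
Proof.
move=> m n mn; apply/subsetPset => t; rewrite /F/= !in_itv/= => /andP[a b].
rewrite (le_trans _ a) ?(le_trans b)// ler_expR ?lerN2 ler_nat//.
Qed.

Let F_union : \bigcup_n F n = Rpos.
Proof.
apply/seteqP; split => t.
  by move=> [n _]; rewrite /F /= !in_itv/= andbT => /andP[a _]; apply: lt_le_trans a; exact: expR_gt0.
move=> /RposP t0; exists (Num.truncn `|ln t|) => //; rewrite /F/= in_itv/=.
have h : `|ln t| <= (Num.truncn `|ln t|).+1%:R by apply/ltW/truncnS_gt.
move: _.+1%:R h => r h.
by rewrite -ler_ln ?posrE ?expR_gt0// -[_ t _]ler_ln ?posrE ?expR_gt0// !expRK -ler_norml.
Qed.

Let F_sub n : F n `<=` Rpos.
Proof. by rewrite -F_union; exact: bigcup_sup. Qed.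

Lemma integral_FTC_exp G g n : (forall t, 0 < t -> is_derive t 1 G (g t)) ->
  (forall t, 0 < t -> {for t, continuous g}) ->
  (\int[mu]_(t in F n) (g t)%:E = (G (expR n.+1%:R) - G (expR (- n.+1%:R)))%:E)%E.
Proof.
move=> dG cg; rewrite EFinB; apply: continuous_FTC2 => //.
- apply/continuous_within_itvP => //; split.
  + move=> t; rewrite in_itv/= => /andP[a _]; apply: cg.
    by apply: lt_trans a; exact: expR_gt0.
  + by apply: cvg_at_right_filter; apply: cg; exact: expR_gt0.
  + by apply: cvg_at_left_filter; apply: cg; exact: expR_gt0.
- have cG t : 0 < t -> {for t, continuous G}.
    by move=> /dG[dGt _]; apply/differentiable_continuous/derivable1_diffP.
  split.
  + move=> t; rewrite in_itv/= => /andP[a _].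
    by have [] := dG t (lt_trans (expR_gt0 _) a).
  + by apply: cvg_at_right_filter; apply: cG; exact: expR_gt0.
  + by apply: cvg_at_left_filter; apply: cG; exact: expR_gt0.
- move=> t; rewrite in_itv/= => /andP[a _]; rewrite derive1E.
  by have [] := dG t (lt_trans (expR_gt0 _) a).
Qed.

(** Over each compact piece the integral is a difference of two values of [G], hence at most 2 M;
    monotone convergence passes this to the half-line. *)
Lemma itg_nonneg_derivative G g (M : R) : (forall t, 0 < t -> is_derive t 1 G (g t)) ->
  (forall t, 0 < t -> {for t, continuous g}) -> (forall t, 0 < t -> 0 <= g t) ->
  mfp g -> (forall t, 0 < t -> `|G t| <= M) -> itg g.
Proof.
move=> dG cg g0 mg GM; apply/integrableP; split; first exact/measurable_EFinP.
rewrite (_ : (\int[mu]_(t in _) _ = \int[mu]_(t in Rpos) (g t)%:E)%E); last first.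
  apply: eq_integral => t; rewrite inE => /RposP t0.
  by rewrite /= ger0_norm// g0.
have H : (\int[mu]_(t in F n) (g t)%:E @[n --> \oo] --> \int[mu]_(t in Rpos) (g t)%:E)%E.
  rewrite -F_union; apply: ge0_nondecreasing_set_cvg_integral.
  - exact: F_nondecreasing.
  - by move=> i; exact: measurable_itv.
  - move=> i; apply/measurable_EFinP; apply: measurable_funS mg; first exact: mRpos.
    exact: F_sub.
  - by move=> i t /F_sub /RposP t0; rewrite lee_fin g0.
apply: (@le_lt_trans _ _ (M + M)%:E); last exact: ltry.
apply: (cvge_le _ H) => //; apply: nearW => n.
rewrite (integral_FTC_exp _ dG cg) lee_fin.
rewrite (le_trans (ler_norm _))// (le_trans (ler_normB _ _))//.
by rewrite lerD// GM// expR_gt0.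
Qed.

(** The integrals over the pieces of the exhaustion are differences of values of [G] at endpoints
    where [|ln t|] grows, so they tend to 0; by dominated convergence they also tend to [I0 g]. *)
Lemma FTC_half_line G g s : 0 < s -> (forall t, 0 < t -> is_derive t 1 G (g t)) ->
  (forall t, 0 < t -> {for t, continuous g}) -> itg g ->
  (exists C, forall t, 0 < t -> `|G t| <= C * expR (- (s * `|ln t|))) ->
  I0 g = 0.
Proof.
move=> s0 dG cg ig [C GC].
have mg := itg_mfp ig.
have mF n : @measurable _ (measurableTypeR R) (F n) by exact: measurable_itv.
have [| | | | |_ _ H] := @dominated_convergence _ _ _ mu _ (@mRpos R)
  (fun n => (EFin \o g) \_ (F n)) (EFin \o g) (fun t => `|(g t)%:E|%E).
- move=> n; apply: (measurable_restrict (EFin \o g) (mF n) (@mRpos R)).1.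
  apply/measurable_EFinP; apply: measurable_funS mg; first exact: mRpos.
  exact: subIsetl.
- exact/measurable_EFinP.
- apply: aeW => t /= t0; apply: cvg_near_cst.
  have [n _ Fn] : (\bigcup_n F n) t by rewrite F_union.
  near=> m; rewrite /patch mem_set//.
  have /F_nondecreasing/subsetPset : (n <= m)%N by near: m; exact: nbhs_infty_ge.
  by apply.
- exact: integrable_abse.
- by apply: aeW => t n _ /=; rewrite /patch; case: ifP => //; rewrite abse0 lee_fin normr_ge0.
have E n : (\int[mu]_(t in Rpos) ((EFin \o g) \_ (F n)) t =
    (G (expR n.+1%:R) - G (expR (- n.+1%:R)))%:E)%E.
  rewrite -integral_mkcondr setIidr//.
  exact: integral_FTC_exp.
have {}H : ((G (expR n.+1%:R) - G (expR (- n.+1%:R)))%:E @[n --> \oo] -->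
    \int[mu]_(t in Rpos) (g t)%:E)%E.
  by apply: cvg_trans H; apply: near_eq_cvg; apply: nearW => n; exact: (E n).
have H0 : (G (expR n.+1%:R) - G (expR (- n.+1%:R))) @[n --> \oo] --> (0 : R).
  apply/cvgr0Pnorm_le => e e0.
  have : (expR (- (s * n.+1%:R))) @[n --> \oo] --> (0 : R).
    apply: (cvg_comp _ _ _ (@cvgr_expR R)); apply/cvgryPge => A.
    near=> n; rewrite -ler_pdivrMl//.
    by rewrite (le_trans _ (_ : n%:R <= _)) ?ler_nat//; near: n; exact: nbhs_infty_ger.
  have C0 : 0 <= C.
    have := GC 1 ltr01; rewrite ln1 normr0 mulr0 oppr0 expR0 mulr1.
    exact: le_trans.
  (* Each endpoint contributes one [C]; the extra 1 keeps the denominator positive. *)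
  have eC : 0 < e / (C + C + 1) by rewrite divr_gt0// ltr_wpDl// addr_ge0.
  move=> /cvgr0Pnorm_le/(_ _ eC); apply: filterS => n.
  rewrite ger0_norm ?expR_ge0// ler_pdivlMr ?ltr_wpDl ?addr_ge0// => h.
  apply: le_trans h; rewrite (le_trans (ler_normB _ _))// mulrC !mulrDl.
  have b1 := GC (expR n.+1%:R) (expR_gt0 _).
  have b2 := GC (expR (- n.+1%:R)) (expR_gt0 _).
  rewrite expRK (ger0_norm (ler0n _ _)) in b1.
  rewrite expRK normrN (ger0_norm (ler0n _ _)) in b2.
  by rewrite (le_trans (lerD b1 b2))// lerDl mul1r expR_ge0.
have Ifin : (\int[mu]_(t in Rpos) (g t)%:E = (I0 g)%:E)%E.
  by rewrite /I0 /Rintegral fineK//; exact: (integrable_fin_num (@mRpos R) ig).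
rewrite Ifin in H; have {H}/fine_cvg H := H.
exact: (cvg_unique _ H H0).
Unshelve. all: by end_near. Qed.

Lemma is_derive_ln_scale (a t : R) : 0 < t -> is_derive t 1 (fun t => a * ln t) (a / t).
Proof.
move=> t0; have h := @is_deriveZ _ _ _ _ a t 1 _ (is_derive1_ln t0).
by apply: is_derive_eq h _.
Qed.

Lemma is_derive_expR_comp f t (l : R) : is_derive t 1 f l ->
  is_derive t 1 (fun t => expR (f t)) (l * expR (f t)).
Proof.
move=> h; apply: is_derive_eq (@is_derive1_comp _ expR f t _ _ _ h) _.
by rewrite [LHS]mulrC.
Qed.

Lemma is_derive1_continuous f t (l : R) : is_derive t 1 f l -> {for t, continuous f}.
Proof. by move=> [h _]; apply/differentiable_continuous/derivable1_diffP. Qed.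

(** Comparison with the derivative of 1/(1 + t^-s), which is nonnegative with a bounded primitive.
    The factor 4 comes from (1 + E)^2 <= 4 max(1, E)^2 with E = t^-s. *)
Lemma itg_wgt s : 0 < s -> itg (wgt s).
Proof.
move=> s0.
pose E t := expR (- s * ln t).
pose G t := (1 + E t)^-1.
pose g t := s / t * E t / (1 + E t) ^+ 2.
have E0 t : 0 < 1 + E t by rewrite ltr_wpDl// expR_gt0.
have dE t : 0 < t -> is_derive t 1 E (- s / t * E t).
  by move=> t0; apply: is_derive_expR_comp; exact: is_derive_ln_scale.
have dG t : 0 < t -> is_derive t 1 G (g t).
  move=> t0; have d1 := is_deriveD (is_derive_cst (1 : R) t 1) (dE t t0).
  have [d2 d2E] := d1.
  have nz : (cst 1 + E) t != 0 by rewrite gt_eqF// E0.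
  apply: DeriveDef; first exact: (derivableV nz d2).
  rewrite (deriveV nz d2) d2E /g -[(cst 1 + E) t]/(1 + E t) add0r /GRing.scale/=.
  move: (E0 t); move: (E t) => e e0; field.
  by rewrite !gt_eqF.
have cg t : 0 < t -> {for t, continuous g}.
  move=> t0; have cE := is_derive1_continuous (dE t t0).
  have cD : {for t, continuous (fun t => 1 + E t)} by apply: cvgD => //; exact: cvg_cst.
  apply: cvgM; first apply: cvgM => //.
    by apply: cvgM; [exact: cvg_cst|apply: cvgV; [rewrite gt_eqF|exact: cvg_id]].
  apply: cvgV; first by rewrite expf_neq0// gt_eqF.
  exact: cvgM.
have g0 t : 0 < t -> 0 <= g t.
  move=> t0; rewrite /g !mulr_ge0// ?invr_ge0 ?exprn_ge0 ?expR_ge0// ltW//.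
have mE : mfp E.
  by apply: mfp_exp; apply: mfpM; [exact: mfp_cst|exact: mfp_ln].
have mg : mfp g.
  apply: mfpM; first apply: mfpM => //.
    by apply: mfpM; [exact: mfp_cst|apply: mfpV => //; exact: mfp_id].
  apply: mfpV; first by move=> t _; rewrite exprn_gt0.
  by apply: mfpX; apply: mfpD => //; exact: mfp_cst.
have ig : itg g.
  apply: (itg_nonneg_derivative (G := G) (M := 1)) => // t t0.
  rewrite ger0_norm ?invr_ge0 ?(ltW (E0 t))// invf_le1//.
  by rewrite lerDl expR_ge0.
apply: itg_le (itgZ (4 / s) ig); first exact: mfp_wgt.
move=> t t0; rewrite ger0_norm ?(ltW (wgt_gt0 _ _))//.
rewrite /wgt /g (_ : 4 / s * _ = 4 * E t / (1 + E t) ^+ 2 / t); last first.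
  by field; rewrite !gt_eqF// E0.
rewrite ler_pM2r ?invr_gt0// ler_pdivlMr ?exprn_gt0//.
have [t1|t1] := leP 1 t.
  rewrite ger0_norm ?ln_ge0// -mulNr -/(E t) mulrC ler_pM2r ?expR_gt0//.
  have : E t <= 1 by rewrite expR_le1 mulNr oppr_le0 mulr_ge0// ?ln_ge0// ltW.
  have : 0 <= E t by exact: expR_ge0.
  move: (E t) => e; nra.
rewrite ler0_norm ?ln_le0 ?(ltW t1)// mulrN opprK.
have -> : expR (s * ln t) = (E t)^-1 by rewrite /E mulNr expRN invrK.
have e0 : 0 < E t by exact: expR_gt0.
rewrite mulrC ler_pdivrMr//.
have : 1 <= E t.
  by rewrite -expR0 ler_expR mulNr oppr_ge0 mulr_ge0_le0// ?ltW// ln_lt0// t0 t1.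
move: (E t) => e; nra.
Qed.

Lemma adm_itg s f : 0 < s -> adm s f -> itg f.
Proof. by move=> s0 [mf [C h]]; apply: itg_le (itgZ C (itg_wgt s0)). Qed.

Lemma adm_mfp s f : adm s f -> mfp f. Proof. by case. Qed.

Lemma adm_eq s f g : (forall t, 0 < t -> f t = g t) -> adm s f -> adm s g.
Proof.
move=> fg [mf [C h]]; split; first exact: mfp_eq mf.
by exists C => t t0; rewrite -fg// h.
Qed.

Lemma adm_le s f g : mfp f -> (exists C, forall t, 0 < t -> `|f t| <= C * `|g t|) ->
  adm s g -> adm s f.
Proof.
move=> mf [C fC] [_ [C' gC]]; split => //; exists (`|C| * C') => t t0.
rewrite -mulrA (le_trans (fC t t0))//.
by rewrite (le_trans (ler_wpM2r (normr_ge0 _) (ler_norm C)))// ler_wpM2l// gC.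
Qed.

Lemma admD s f g : adm s f -> adm s g -> adm s (fun t => f t + g t).
Proof.
move=> [mf [C fC]] [mg [C' gC]]; split; first exact: mfpD.
exists (C + C') => t t0; rewrite (le_trans (ler_normD _ _))// mulrDl.
by rewrite lerD ?fC ?gC.
Qed.

Lemma admZ s c f : adm s f -> adm s (fun t => c * f t).
Proof.
move=> [mf [C fC]]; split; first by apply: mfpM => //; exact: mfp_cst.
by exists (`|c| * C) => t t0; rewrite normrM -mulrA ler_wpM2l// fC.
Qed.

Lemma admN s f : adm s f -> adm s (fun t => - f t).
Proof. by move=> /(admZ (-1)); apply: adm_eq => t _; rewrite mulN1r. Qed.

Lemma admB s f g : adm s f -> adm s g -> adm s (fun t => f t - g t).
Proof. by move=> af /admN; exact: admD. Qed.

Lemma adm_powR s w f : adm s f -> adm (s - `|w|) (fun t => expR (w * ln t) * f t).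
Proof.
move=> [mf [C fC]]; split.
  by apply: mfpM => //; apply: mfp_exp; apply: mfpM; [exact: mfp_cst|exact: mfp_ln].
exists C => t t0; rewrite normrM (ger0_norm (expR_ge0 _)).
rewrite (le_trans (ler_wpM2l (expR_ge0 _) (fC t t0)))//.
have C0 : 0 <= C by rewrite -(pmulr_lge0 _ (wgt_gt0 s t0)); apply: le_trans (fC t t0).
rewrite mulrCA ler_wpM2l// /wgt mulrA ler_pM2r ?invr_gt0// -expRD ler_expR.
rewrite mulrBl opprB addrC [leRHS]addrC lerD2l -normrM ler_norm//.
Qed.

(** A logarithm costs an arbitrarily small part of the decay, since e |ln t| <= exp(e |ln t|). *)
Lemma adm_ln s e f : 0 < e -> adm s f -> adm (s - e) (fun t => ln t * f t).
Proof.
move=> e0 [mf [C fC]]; split; first by apply: mfpM => //; exact: mfp_ln.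
exists (C / e) => t t0; rewrite normrM.
have C0 : 0 <= C by rewrite -(pmulr_lge0 _ (wgt_gt0 s t0)); apply: le_trans (fC t t0).
rewrite (le_trans (ler_wpM2l (normr_ge0 _) (fC t t0)))//.
rewrite mulrCA -mulrA ler_wpM2l// /wgt !mulrA ler_pM2r ?invr_gt0//.
have -> : expR (- ((s - e) * `|ln t|)) = expR (- (s * `|ln t|)) * expR (e * `|ln t|).
  by rewrite -expRD; congr expR; ring.
move: (expR_ge0 (- (s * `|ln t|))) (expR_ge1Dx (e * `|ln t|)).
move: (expR (- _)) (expR (e * _)) => X Y X0 Y1.
rewrite mulrC mulrCA ler_wpM2l// ler_pdivlMl// (le_trans _ Y1)// lerDr//.
Qed.

Lemma adm_lnX s s' k f : s' < s -> adm s f -> adm s' (fun t => ln t ^+ k * f t).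
Proof.
move=> + af; elim: k s' => [|k IH] s' ss'.
  have [mf [C fC]] := af; split.
    by apply: mfp_eq mf => t _; rewrite expr0 mul1r.
  exists C => t t0; rewrite expr0 mul1r (le_trans (fC t t0))//.
  have C0 : 0 <= C by rewrite -(pmulr_lge0 _ (wgt_gt0 s t0)); apply: le_trans (fC t t0).
  by rewrite ler_wpM2l// ler_pM2r ?invr_gt0// ler_expR lerN2 ler_wpM2r// ltW.
(* The gap is halved: the midpoint serves for [k] logarithms, the other half for the last one. *)
have h : (s' + s) / 2 < s by lra.
have e0 : 0 < (s' + s) / 2 - s' by lra.
have := adm_ln e0 (IH _ h); rewrite opprB addrCA subrr addr0.
by apply: adm_eq => t _; rewrite exprS mulrA.
Qed.

End Admissible.

(** * Exchange of series and integral *)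

Section SeriesExchange.
Variable R : realType.
Local Notation mu := (@lebesgue_measure R).
Local Notation Rpos := (`]0, +oo[%classic : set R).

Lemma I0_dominated (f : nat -> R -> R) (F g : R -> R) :
  (forall n, mfp (f n)) -> mfp F -> itg g ->
  (forall n t, 0 < t -> `|f n t| <= g t) ->
  (forall t, 0 < t -> f n t @[n --> \oo] --> F t) ->
  I0 (f n) @[n --> \oo] --> I0 F.
Proof.
move=> mf mF ig fg fF.
have [| | | | |iF _ H] := @dominated_convergence _ _ _ mu _ (@mRpos R)
  (fun n => EFin \o f n) (EFin \o F) (EFin \o g).
- by move=> n; apply/measurable_EFinP; exact: mf.
- exact/measurable_EFinP.
- apply: aeW => t /RposP t0; apply: cvg_EFin; last exact: fF.
  exact: nearW.
- exact: ig.
- by apply: aeW => t n /RposP t0; rewrite lee_fin; exact: fg.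
have E (h : R -> R) : itg h -> (\int[mu]_(t in Rpos) (h t)%:E = (I0 h)%:E)%E.
  by move=> ih; rewrite /I0 /Rintegral fineK//; exact: (integrable_fin_num (@mRpos R) ih).
have {}H : (I0 (f n))%:E @[n --> \oo] --> (I0 F)%:E.
  rewrite -E//; apply: cvg_trans H; apply: near_eq_cvg; apply: nearW => n.
  by apply: E; exact: itg_le (mf n) (fg n) ig.
by move/fine_cvg : H.
Qed.

Lemma I0_series (q : nat -> R -> R) (psi Q : R -> R) :
  mfp psi -> (forall n, mfp (q n)) -> (forall n t, 0 < t -> 0 <= q n t) ->
  (forall t, 0 < t -> series (fun n => q n t) @ \oo --> Q t) ->
  itg (fun t => psi t * Q t) ->
  (forall n, itg (fun t => psi t * q n t)) /\
  series (fun n => I0 (fun t => psi t * q n t)) @ \oo --> I0 (fun t => psi t * Q t).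
Proof.
move=> mpsi mq q0 qQ iQ.
have sQ n t : 0 < t -> series (fun n => q n t) n <= Q t.
  move=> t0; rewrite -(cvg_lim _ (qQ t t0))//; apply: nondecreasing_cvgn_le.
    by apply: nondecreasing_series => i _ _; exact: q0.
  by apply/cvg_ex; exists (Q t); exact: qQ.
have s0 n t : 0 < t -> 0 <= series (fun n => q n t) n.
  by move=> t0; apply: sumr_ge0 => i _; exact: q0.
have qleQ n t : 0 < t -> q n t <= Q t.
  move=> t0; apply: le_trans (sQ n.+1 t t0); rewrite seriesSr lerDr.
  exact: s0.
have Q0 t : 0 < t -> 0 <= Q t.
  by move=> t0; apply: le_trans (qleQ 0%N t t0); exact: q0.
have iq n : itg (fun t => psi t * q n t).
  apply: itg_le (itg_norm iQ); first exact: mfpM.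
  move=> t t0; rewrite !normrM ler_wpM2l//.
  by rewrite !ger0_norm ?q0 ?Q0 ?qleQ.
split=> //.
have isr n : itg (fun t => psi t * series (fun n => q n t) n) /\
    series (fun n => I0 (fun t => psi t * q n t)) n =
    I0 (fun t => psi t * series (fun n => q n t) n).
  elim: n => [|n [IH1 IH2]].
    have E t : 0 < t -> 0 = psi t * series (fun n => q n t) 0%N.
      by move=> _; rewrite /series/= big_geq// mulr0.
    by split; [apply: itg_eq E (@itg_0 R)|rewrite -(I0_eq E) I0_0 /series/= big_geq].
  have E t : 0 < t -> psi t * series (fun n => q n t) n + psi t * q n t =
      psi t * series (fun n => q n t) n.+1.
    by move=> _; rewrite seriesSr mulrDr.
  split; first by apply: itg_eq E (itgD IH1 (iq n)).
  by rewrite seriesSr IH2 -(I0_eq E) I0D.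
rewrite (_ : series _ = (fun n => I0 (fun t => psi t * series (fun n => q n t) n))); last first.
  by apply/funext => n; have [] := isr n.
apply: (I0_dominated (g := fun t => `|psi t * Q t|)).
- by move=> n; apply: itg_mfp; have [] := isr n.
- exact: itg_mfp.
- exact: itg_norm.
- move=> n t t0; rewrite !normrM ler_wpM2l//.
  by rewrite !ger0_norm ?s0 ?Q0 ?sQ.
- by move=> t t0; apply: cvgM; [exact: cvg_cst|exact: qQ].
Qed.

End SeriesExchange.

(** * Complex Mellin transforms and differentiation under the integral *)

Section ComplexMellin.
Variable R : realType.
Local Notation C := (Cplx R).
Local Notation Re := (@complex.Re R).
Local Notation Im := (@complex.Im R).
Local Notation Rpos := (`]0, +oo[%classic : set R).
Implicit Types (f g : R -> C) (phi : R -> R) (z : C).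

Definition citg f : Prop := itg (fun t => Re (f t)) /\ itg (fun t => Im (f t)).

Lemma cintegral_eq f g : (forall t, 0 < t -> f t = g t) ->
  cintegral Rpos f = cintegral Rpos g.
Proof.
by move=> fg; apply: complex_ext; apply: I0_eq => t t0; rewrite fg.
Qed.

Lemma cintegralB f g : citg f -> citg g ->
  cintegral Rpos (fun t => f t - g t) = cintegral Rpos f - cintegral Rpos g.
Proof.
move=> [f1 f2] [g1 g2]; apply: complex_ext.
- by rewrite [RHS]cReD cReN /= -I0B//; apply: I0_eq => t _; rewrite cReD cReN.
- by rewrite [RHS]cImD cImN /= -I0B//; apply: I0_eq => t _; rewrite cImD cImN.
Qed.

Lemma citgZ z f : citg f -> citg (fun t => z * f t).
Proof.
move=> [f1 f2]; split.
- by apply: itg_eq (itgB (itgZ (Re z) f1) (itgZ (Im z) f2)) => t _; rewrite cReM.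
- by apply: itg_eq (itgD (itgZ (Re z) f2) (itgZ (Im z) f1)) => t _; rewrite cImM.
Qed.

Lemma citgB f g : citg f -> citg g -> citg (fun t => f t - g t).
Proof.
move=> [f1 f2] [g1 g2]; split.
- by apply: itg_eq (itgB f1 g1) => t _; rewrite cReD cReN.
- by apply: itg_eq (itgB f2 g2) => t _; rewrite cImD cImN.
Qed.

Lemma cintegralZ z f : citg f -> cintegral Rpos (fun t => z * f t) = z * cintegral Rpos f.
Proof.
move=> [f1 f2]; apply: complex_ext.
- rewrite [RHS]cReM /= -!I0Z// -I0B ?itgZ//; try exact: itgZ.
  by apply: I0_eq => t _; rewrite cReM.
- rewrite [RHS]cImM /= -!I0Z// -I0D ?itgZ//; try exact: itgZ.
  by apply: I0_eq => t _; rewrite cImM.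
Qed.

Lemma cintegral_bound f (h : R -> R) : citg f -> itg h ->
  (forall t, 0 < t -> `|f t| <= (h t)%:C) -> `|cintegral Rpos f| <= (2 * I0 h)%:C.
Proof.
move=> [f1 f2] ih fh; apply: (le_trans (normC_le _)); rewrite lecR /= mulr_natl mulr2n.
apply: lerD; apply: I0_bound => // t t0; rewrite -lecR; apply: le_trans (fh t t0).
- exact: normC_ge_Re.
- exact: normC_ge_Im.
Qed.

Definition cMel phi z : C := cintegral Rpos (fun t => cpow t z * (phi t)%:C).

Definition Mel phi (w : R) : R := I0 (fun t => expR (w * ln t) * phi t).

Lemma cpow_real (t w : R) : cpow t (w%:C) = (expR (w * ln t))%:C.
Proof. by rewrite /cpow -realCM cexp_real mulrC. Qed.

Lemma cMel_real phi (w : R) : cMel phi w%:C = (Mel phi w)%:C.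
Proof.
apply: complex_ext.
- by apply: I0_eq => t _; rewrite cpow_real -realCM.
- transitivity (I0 (fun=> 0 : R)); last exact: I0_0.
  by apply: I0_eq => t _; rewrite cpow_real -realCM.
Qed.

Lemma normC_cpow (t : R) z : `|cpow t z| = (expR (Re z * ln t))%:C.
Proof. by rewrite normC_cexp cReMr mulrC. Qed.

Lemma cpowD (t : R) z w : cpow t (z + w) = cpow t z * cpow t w.
Proof. by rewrite /cpow mulrDr cexpD. Qed.

Lemma mfp_Re_cpow phi z : mfp phi -> mfp (fun t => Re (cpow t z * (phi t)%:C)).
Proof.
move=> mphi; have ml c : mfp (fun t => ln t * c : R).
  by apply: mfpM; [exact: mfp_ln|exact: mfp_cst].
apply: (@mfp_eq _ (fun t => expR (ln t * Re z) * cos (ln t * Im z) * phi t)).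
  by move=> t _; rewrite [in RHS]mulrC cReMr /cpow /cexp/= cReMr cImMr [RHS]mulrC.
by apply: mfpM => //; apply: mfpM; [exact: mfp_exp|exact: mfp_cos].
Qed.

Lemma mfp_Im_cpow phi z : mfp phi -> mfp (fun t => Im (cpow t z * (phi t)%:C)).
Proof.
move=> mphi; have ml c : mfp (fun t => ln t * c : R).
  by apply: mfpM; [exact: mfp_ln|exact: mfp_cst].
apply: (@mfp_eq _ (fun t => expR (ln t * Re z) * sin (ln t * Im z) * phi t)).
  by move=> t _; rewrite [in RHS]mulrC cImMr /cpow /cexp/= cReMr cImMr [RHS]mulrC.
by apply: mfpM => //; apply: mfpM; [exact: mfp_exp|exact: mfp_sin].
Qed.

Lemma citg_cpow s phi z : adm s phi -> `|Re z| < s ->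
  citg (fun t => cpow t z * (phi t)%:C).
Proof.
move=> aphi zs; have s0 : 0 < s - `|Re z| by rewrite subr_gt0.
have ia := itg_norm (adm_itg s0 (adm_powR (Re z) aphi)).
have E (t : R) : `|cpow t z * (phi t)%:C| = (`|expR (Re z * ln t) * phi t|)%:C.
  by rewrite normrM normC_cpow normC_real -realCM normrM (ger0_norm (expR_ge0 _)).
split; apply: itg_le ia.
- by apply: mfp_Re_cpow; exact: adm_mfp aphi.
- by move=> t _; rewrite -lecR -E normC_ge_Re.
- by apply: mfp_Im_cpow; exact: adm_mfp aphi.
- by move=> t _; rewrite -lecR -E normC_ge_Im.
Qed.

Lemma is_derive_cMel s phi z : adm s phi -> `|Re z| < s ->
  is_derive z 1 (cMel phi) (cMel (fun t => ln t * phi t) z).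
Proof.
move=> aphi zs.
(* A third of the gap: one share for the displacement [h], one for the factor [ln t ^+ 2], one to
   keep the inequalities strict. *)
pose e := (s - `|Re z|) / 3.
have e0 : 0 < e by rewrite divr_gt0// subr_gt0.
pose s' := s - e.
have zs' : `|Re z| + e < s' by rewrite /s' /e; lra.
(* Majorant of the second-order term. Both powers occur because [ln t] changes sign at 1 and exp|ln
   t Re h| has to be dominated on both sides. *)
pose bnd t := 2 * (ln t ^+ 2 * `|phi t|) * (expR ((Re z + e) * ln t) + expR ((Re z - e) * ln t)).
have abs_phi : adm s (fun t => `|phi t|).
  apply: (adm_le _ _ aphi); first by apply: mfp_norm; exact: (adm_mfp aphi).
  by exists 1 => t t0; rewrite normr_id mul1r.
have a2 : adm s' (fun t => ln t ^+ 2 * `|phi t|).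
  by apply: adm_lnX abs_phi; rewrite /s' gtrBl.
have ib : itg bnd.
  have h1 : 0 < s' - `|Re z + e|.
    by rewrite subr_gt0 (le_lt_trans (ler_normD _ _))// (gtr0_norm e0).
  have h2 : 0 < s' - `|Re z - e|.
    by rewrite subr_gt0 (le_lt_trans (ler_normB _ _))// (gtr0_norm e0).
  have := itgZ 2 (itgD (adm_itg h1 (adm_powR _ a2)) (adm_itg h2 (adm_powR _ a2))).
  by apply: itg_eq => t _; rewrite /bnd; ring.
pose B := 2 * I0 bnd.
(* Quantitative form of differentiability: with u = h ln t, the bound on e^u - 1 - u leaves an error
   of order |h| in the difference quotient. *)
have quot (h : C) : h != 0 -> `|h| <= e%:C ->
    `|h^-1 * (cMel phi (h + z) - cMel phi z) - cMel (fun t => ln t * phi t) z| <= `|h| * B%:C.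
  move=> h0 he.
  have reh : `|Re h| <= e by rewrite -lecR; apply: le_trans he; exact: normC_ge_Re.
  have i1 : citg (fun t => cpow t (h + z) * (phi t)%:C).
    apply: (citg_cpow aphi); rewrite cReD (le_lt_trans (ler_normD _ _))//.
    by rewrite addrC (le_lt_trans (lerD (lexx _) reh))// (lt_trans zs')// /s' gtrBl.
  have i2 : citg (fun t => cpow t z * (phi t)%:C) by exact: (citg_cpow aphi).
  have i3 : citg (fun t => cpow t z * (ln t * phi t)%:C).
    have a1 : adm s' (fun t => ln t * phi t) by apply: adm_ln.
    by apply: (citg_cpow a1); apply: lt_trans zs'; rewrite ltrDl.
  rewrite /cMel -cintegralB// -cintegralZ; last exact: citgB.
  rewrite -cintegralB//; last by apply: citgZ; exact: citgB.
  have i4 : citg (fun t => h^-1 * (cpow t (h + z) * (phi t)%:C - cpow t z * (phi t)%:C)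
     - cpow t z * (ln t * phi t)%:C).
    by apply: citgB => //; apply: citgZ; exact: citgB.
  pose nh := Re `|h|.
  have nhE : `|h| = nh%:C by rewrite /nh normc_def.
  have nh0 : 0 < nh by rewrite -ltcR -nhE normr_gt0.
  rewrite nhE -realCM /B mulrCA -I0Z//; apply: cintegral_bound => //; first exact: itgZ.
  move=> t t0.
  pose u : C := (ln t)%:C * h.
  have -> : h^-1 * (cpow t (h + z) * (phi t)%:C - cpow t z * (phi t)%:C)
     - cpow t z * (ln t * phi t)%:C = h^-1 * cpow t z * (phi t)%:C * (cexp u - 1 - u).
    rewrite cpowD realCM {1}/cpow -/u; move: (cpow t z) (cexp u) => cz E.
    by rewrite /u; field.
  have T := normC_cexp_taylor2 u.
  rewrite !normrM normfV nhE normC_cpow normC_real -realCV.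
  move: T; move: `|cexp u - 1 - u| => N T; rewrite -!realCM.
  have uE : `|u| = (`|ln t| * nh)%:C by rewrite normrM normC_real nhE realCM.
  rewrite uE cReMr -realCX natrC -!realCM in T.
  apply: (le_trans (ler_wpM2l _ T)).
    by rewrite ler0c !mulr_ge0// ?expR_ge0// invr_ge0 ltW.
  rewrite -realCM lecR /bnd exprMn real_normK ?num_real//.
  have ex : expR `|ln t * Re h| <= expR (e * ln t) + expR (- e * ln t).
    have [l0|l0] := leP 0 (ln t).
      rewrite (@le_trans _ _ (expR (e * ln t))) ?lerDl ?expR_ge0// ler_expR.
      by rewrite normrM mulrC (ger0_norm l0) ler_wpM2r.
    rewrite (@le_trans _ _ (expR (- e * ln t))) ?lerDr ?expR_ge0// ler_expR.
    by rewrite normrM mulrC (ltr0_norm l0) mulrN mulNr lerN2 ler_wnM2r// ltW.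
  rewrite (_ : _ * _ =
    nh * (2 * (ln t ^+ 2 * `|phi t|) * expR (Re z * ln t)) * expR `|ln t * Re h|); last first.
    by field; rewrite gt_eqF.
  rewrite (_ : nh * (_ * (_ + _)) = nh * (2 * (ln t ^+ 2 * `|phi t|) * expR (Re z * ln t)) *
     (expR (e * ln t) + expR (- e * ln t))); last first.
    rewrite (_ : (Re z + e) * ln t = Re z * ln t + e * ln t); last by ring.
    rewrite (_ : (Re z - e) * ln t = Re z * ln t + - e * ln t); last by ring.
    by rewrite !expRD; ring.
  rewrite ler_wpM2l//; apply: mulr_ge0; first exact: ltW.
  apply: mulr_ge0; last exact: expR_ge0.
  by apply: mulr_ge0 => //; apply: mulr_ge0 => //; exact: sqr_ge0.
have B0 : 0 <= B.
  rewrite mulr_ge0// I0_ge0// => t t0; rewrite /bnd.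
  apply: mulr_ge0; last by rewrite addr_ge0// expR_ge0.
  by apply: mulr_ge0 => //; apply: mulr_ge0 => //; exact: sqr_ge0.
have H : h^-1 *: (cMel phi (h *: 1 + z) - cMel phi z) @[h --> (0 : C)^'] -->
    cMel (fun t => ln t * phi t) z.
  apply/cvgrPdist_le => _ /posC[eps eps0 ->].
  pose d := Num.min e (eps / (B + 1)).
  have d0 : 0 < d by rewrite lt_min e0 divr_gt0// ltr_wpDl.
  exists d%:C; first by rewrite /= ltcR.
  move=> h; rewrite /ball_/= sub0r normrN => hd h0.
  have he : `|h| <= e%:C by apply: le_trans (ltW hd) _; rewrite lecR ge_min lexx.
  rewrite distrC [h *: 1]mulr1; apply: (le_trans (quot h h0 he)).
  have : `|h| * (B + 1)%:C <= eps%:C.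
    apply: (@le_trans _ _ ((eps / (B + 1))%:C * (B + 1)%:C)).
      rewrite ler_wpM2r// ?ler0c ?addr_ge0//.
      by apply: le_trans (ltW hd) _; rewrite lecR ge_min lexx orbT.
    by rewrite -realCM divfK// gt_eqF// ltr_wpDl.
  by apply: le_trans; rewrite ler_wpM2l// lecR lerDl.
by apply: DeriveDef; [apply/cvg_ex; exists (cMel (fun t => ln t * phi t) z); exact: H|
  apply: cvg_lim => //; exact: H].
Qed.

End ComplexMellin.

(** * Taylor coefficients of Mellin transforms *)

Section MellinExpansion.
Variable R : realType.
Local Notation C := (Cplx R).
Local Notation Re := (@complex.Re R).
Implicit Types (phi : R -> R) (s : R) (a z : C).

Lemma is_derive_shiftC (f : C -> C) a z (l : C) : is_derive (z - a) 1 f l ->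
  is_derive z 1 (fun z => f (z - a)) l.
Proof.
move=> [df fl].
have E : (fun h => h^-1 *: (((fun z => f (z - a)) \o shift z) (h *: 1) - f (z - a))) =
  (fun h => h^-1 *: ((f \o shift (z - a)) (h *: (1 : C)) - f (z - a))).
  by apply/funext => h /=; rewrite addrA.
by split; rewrite /derivable /derive E.
Qed.

(** Differentiation in [z] inserts a factor [ln t], so the transforms of [ln t ^+ k * phi t] form a
    family closed under derivation. The base point [a] is 1 for Gamma and [I_fun], 2 for [zeta]. *)
Lemma cMel_csmooth s phi a : 0 < s -> adm s phi ->
  csmooth a (fun z => cMel phi (z - a)) /\
  forall k, derive1n k (fun z => cMel phi (z - a)) a = (I0 (fun t => ln t ^+ k * phi t))%:C.
Proof.
move=> s0 aphi.
pose F k z := cMel (fun t => ln t ^+ k * phi t) (z - a).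
have s2 : 0 < s / 2 by rewrite divr_gt0.
pose U : set C := ball a (s / 2)%:C.
have oU : open U by exact: ball_open.
have Ua : U a by apply: ballxx; rewrite ltcR.
have F0 : F 0%N = (fun z => cMel phi (z - a)).
  apply/funext => z; apply: cintegral_eq => t _.
  by rewrite expr0 mul1r.
have dF k z : U z -> is_derive z 1 (F k) (F k.+1 z).
  move=> Uz; apply: is_derive_shiftC.
  have ak : adm (s / 2) (fun t => ln t ^+ k * phi t).
    by apply: (adm_lnX _ _ aphi); rewrite ltr_pdivrMr// ltr_pMr// ltr1n.
  have rz : `|Re (z - a)| < s / 2.
    rewrite -ltcR; apply: le_lt_trans (normC_ge_Re _) _.
    by rewrite distrC; exact: Uz.
  have -> : F k.+1 z = cMel (fun t => ln t * (ln t ^+ k * phi t)) (z - a).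
    by apply: cintegral_eq => t _; rewrite exprS mulrA.
  exact: (is_derive_cMel ak rz).
have [H1 H2] := derive1n_seq oU dF.
rewrite -F0; split; first by exists U.
by move=> k; rewrite H1// /F subrr (cMel_real _ 0); congr (_%:C); apply: I0_eq => t _;
  rewrite mul0r expR0 mul1r.
Qed.

(* The Taylor coefficients at 0 of the Mellin transform of [phi]. *)
Definition mom phi (k : nat) : R[i] := (I0 (fun t => ln t ^+ k * phi t) / k`!%:R)%:C.

Lemma cMel_asym s phi : 0 < s -> adm s phi -> @asym R[i] (cMel phi) (mom phi).
Proof.
move=> s0 aphi.
have [H1 H2] := cMel_csmooth 0 s0 aphi.
apply: (asym_eqr (a := fun k => derive1n k (fun z => cMel phi (z - 0)) 0 / k`!%:R)).
  by move=> k; rewrite H2 /mom natrC -realCV -realCM.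
apply: (asym_eq _ (csmooth_asym H1)).
by apply: near0T => w _; rewrite add0r subr0.
Qed.

Lemma Mel_eq phi psi (w : R) : (forall t, 0 < t -> phi t = psi t) -> Mel phi w = Mel psi w.
Proof. by move=> E; apply: I0_eq => t t0; rewrite E. Qed.

Lemma Mel_itg s phi (w : R) : `|w| < s -> adm s phi -> itg (fun t => expR (w * ln t) * phi t).
Proof.
move=> ws aphi; apply: (adm_itg _ (adm_powR w aphi)).
by rewrite subr_gt0.
Qed.

Lemma mom_ln phi k : mom (fun t => ln t * phi t) k = k.+1%:R * mom phi k.+1.
Proof.
rewrite natrC /mom -realCM; congr (_%:C).
rewrite (I0_eq (g := fun t => ln t ^+ k.+1 * phi t)); last by move=> t _; rewrite exprSr mulrA.
rewrite factS natrM; field.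
by rewrite !pnatr_eq0 -lt0n fact_gt0 addrC natr1 pnatr_eq0.
Qed.

End MellinExpansion.

(** * Size estimates for the kernels *)

Section Kernels.
Variable R : realType.
Implicit Types (s t v x y p : R).

(** In the notation of the overview, A is [lnE t], B is [lnE (x * t)], B - A is [Df x t] and K is
    [Kf t]. [Df] and [Lf] keep the quotients found in [I_fun]. *)
Definition lnE v : R := ln (1 - expR (- v)).
Definition Kf t : R := (1 - expR (- t))^-1 - t^-1.
Definition Lf t : R := ln ((1 - expR (- t)) / t).
Definition Df x t : R := ln ((1 - expR (- (x * t))) / (1 - expR (- t))).
Definition Ey y t : R := expR (- (y * t)).

Lemma one_sub_expN_gt0 v : 0 < v -> 0 < 1 - expR (- v).
Proof. by move=> v0; rewrite subr_gt0 expR_lt1 oppr_lt0. Qed.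

Lemma one_sub_expN_le v : 1 - expR (- v) <= v.
Proof. have := expR_ge1Dx (- v); lra. Qed.

Lemma one_sub_expN_ge v : v * expR (- v) <= 1 - expR (- v).
Proof.
rewrite -(ler_pM2r (expR_gt0 v)) mulrBl -mulrA -expRD addNr expR0 mulr1 mul1r.
have := expR_ge1Dx v; lra.
Qed.

Lemma lnE_le0 v : 0 < v -> lnE v <= 0.
Proof. by move=> v0; rewrite ln_le0// gerBl expR_ge0. Qed.

Lemma expR_lnE v : 0 < v -> expR (lnE v) = 1 - expR (- v).
Proof. by move=> v0; rewrite lnK// posrE one_sub_expN_gt0. Qed.

(** Interpolates between the logarithmic singularity at 0 and the exponential decay at infinity.
    With a = [lnE v] <= 0, - p a <= e^(-pa) - 1 = e^(-pa) (1 - e^(pa)), where 1 - e^(pa) <= 1 - e^a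
    = e^-v and e^a >= v e^-v. *)
Lemma lnE_bound p v : 0 < p -> p <= 1 -> 0 < v ->
  `|lnE v| <= p^-1 * (expR (- (p * ln v)) * expR (- ((1 - p) * v))).
Proof.
move=> p0 p1 v0; have a0 := lnE_le0 v0; rewrite ler0_norm//.
rewrite ler_pdivlMl//.
have ea := expR_lnE v0.
set a := lnE v in a0 ea *.
have h1 : p * - a <= expR (p * - a) - 1 by have := expR_ge1Dx (p * - a); lra.
apply: (le_trans h1).
have h2 : expR (p * - a) - 1 = expR (p * - a) * (1 - expR (p * a)).
  by rewrite mulrBr mulr1 -expRD mulrN addNr expR0.
have h3 : expR a <= expR (p * a) by rewrite ler_expR; nra.
have h4 : 1 - expR (p * a) <= expR (- v) by rewrite ea in h3; lra.
rewrite h2; apply: (le_trans (ler_wpM2l (expR_ge0 _) h4)).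
have h5 : ln v - v <= a.
  rewrite -ler_expR ea expRD lnK ?posrE//; exact: one_sub_expN_ge.
rewrite -!expRD ler_expR; nra.
Qed.

Lemma Kf_ge0 t : 0 < t -> 0 <= Kf t.
Proof.
move=> t0; rewrite subr_ge0 lef_pV2 ?posrE ?one_sub_expN_gt0//.
exact: one_sub_expN_le.
Qed.

Lemma Kf_le1 t : 0 < t -> Kf t <= 1.
Proof.
move=> t0; have p := one_sub_expN_gt0 t0; have q := one_sub_expN_ge t.
have e0 := expR_gt0 (- t).
rewrite /Kf; move: (expR (- t)) p q e0 => e p q e0.
rewrite -(ler_pM2r t0) -(ler_pM2l p).
rewrite (_ : (1 - e) * (((1 - e)^-1 - t^-1) * t) = t - (1 - e)); last first.
  by field; rewrite !gt_eqF.
nra.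
Qed.

Lemma Kf_norm t : 0 < t -> `|Kf t| <= 1.
Proof. by move=> t0; rewrite ger0_norm ?Kf_le1 ?Kf_ge0. Qed.

Lemma mfp_lin x : mfp (fun t => x * t : R).
Proof. by apply: mfpM; [exact: mfp_cst|exact: mfp_id]. Qed.

Lemma mfp_Ey y : mfp (Ey y).
Proof. by apply: mfp_exp; apply: mfpN; exact: mfp_lin. Qed.

Lemma mfp_1subE x : mfp (fun t => 1 - expR (- (x * t))).
Proof. by apply: mfpB; [exact: mfp_cst|exact: mfp_Ey]. Qed.

Lemma mfp_1subE1 : mfp (fun t => 1 - expR (- t)).
Proof. by apply: mfp_eq (mfp_1subE 1) => t _; rewrite mul1r. Qed.

Lemma mfp_inv : mfp (fun t => t^-1 : R).
Proof. by apply: mfpV => //; exact: mfp_id. Qed.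

Lemma mfp_lnE x : mfp (fun t => lnE (x * t)).
Proof. by apply: mfp_lncomp; exact: mfp_1subE. Qed.

Lemma mfp_Kf : mfp Kf.
Proof.
apply: mfpB; last exact: mfp_inv.
by apply: mfpV; [exact: one_sub_expN_gt0|exact: mfp_1subE1].
Qed.

Lemma mfp_Lf : mfp Lf.
Proof. by apply: mfp_lncomp; apply: mfpM; [exact: mfp_1subE1|exact: mfp_inv]. Qed.

Lemma mfp_Df x : mfp (Df x).
Proof.
apply: mfp_lncomp; apply: mfpM; first exact: mfp_1subE.
by apply: mfpV; [exact: one_sub_expN_gt0|exact: mfp_1subE1].
Qed.

(** At infinity t^(2s) e^(-yt) must be bounded; for [s <= 2^-1] one has t^(2s) <= t there, and t
    e^(-yt) <= 1/y. This is where the strip width 1/2 comes from. *)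
Lemma adm_crit s y C (f : R -> R) : 0 < s -> s <= 2^-1 -> 0 < y -> mfp f ->
  (forall t, 0 < t -> `|f t| <= C * (expR ((s - 1) * ln t) * Ey y t)) -> adm s f.
Proof.
move=> s0 s2 y0 mf fC; split => //; exists (`|C| * (1 + y^-1)) => t t0.
apply: (le_trans (fC t t0)); rewrite -mulrA.
have X0 : 0 <= expR ((s - 1) * ln t) * Ey y t by rewrite mulr_ge0// expR_ge0.
rewrite (le_trans (ler_wpM2r X0 (ler_norm C)))// ler_wpM2l//.
have yi : 0 < y^-1 by rewrite invr_gt0.
have E : expR ((s - 1) * ln t) = expR (s * ln t) / t.
  by rewrite mulrBl mul1r expRD expRN lnK.
rewrite E /wgt mulrA mulrAC ler_pM2r ?invr_gt0// /Ey.
have [t1|t1] := leP 1 t; last first.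
  rewrite ler0_norm ?ln_le0 ?(ltW t1)// mulrN opprK.
  have h : expR (- (y * t)) <= 1 by rewrite expR_le1 oppr_le0 mulr_ge0// ltW.
  rewrite (le_trans (ler_wpM2l (expR_ge0 _) h))// mulr1 ler_peMl ?expR_ge0//.
  by rewrite lerDl ltW.
rewrite ger0_norm ?ln_ge0//.
have h1 : t * expR (- (y * t)) <= y^-1.
  rewrite -[leRHS]mul1r ler_pdivlMr// mulrAC -ler_pdivlMr ?expR_gt0// -expRN opprK mul1r mulrC.
  by have := expR_ge1Dx (y * t); lra.
have h2 : expR (s * ln t) <= expR (- (s * ln t)) * t.
  rewrite expRN [leRHS]mulrC ler_pdivlMr ?expR_gt0// -expRD -ler_ln ?posrE ?expR_gt0// expRK.
  have := ln_ge0 t1; nra.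
apply: (le_trans (ler_wpM2r (expR_ge0 _) h2)).
rewrite -mulrA mulrC ler_wpM2r ?expR_ge0//; apply: (le_trans h1).
by rewrite lerDr.
Qed.

Lemma adm_exp_bound (C : R) y (f : R -> R) : 0 < y -> mfp f ->
  (forall t, 0 < t -> `|f t| <= C * Ey y t) -> adm 2^-1 f.
Proof.
move=> y0 mf fC; apply: (@adm_crit _ (y / 2) (`|C| * (1 + 2 / y))) => //.
  by rewrite divr_gt0.
move=> t t0; apply: (le_trans (fC t t0)).
rewrite (le_trans (ler_wpM2r (expR_ge0 _) (ler_norm C)))// -mulrA ler_wpM2l//.
(* One half of the exponential absorbs t^(1/2) <= 1 + t, at the cost of the constant 1 + 2/y; the
   other half is left for [adm_crit]. *)
have -> : expR (- (y * t)) = Ey (y / 2) t * Ey (y / 2) t.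
  by rewrite /Ey -expRD; congr expR; field.
rewrite mulrA ler_wpM2r ?expR_ge0// (_ : (2^-1 - 1) * ln t = - (2^-1 * ln t)); last by field.
rewrite expRN ler_pdivlMr ?expR_gt0//.
have h2 : expR (2^-1 * ln t) <= 1 + t.
  have tz : t = expR (2^-1 * ln t) * expR (2^-1 * ln t).
    by rewrite -expRD -mulrDl (_ : 2^-1 + 2^-1 = 1 :> R) ?mul1r ?lnK//; field.
  rewrite [in leRHS]tz; move: (expR (2^-1 * ln t)) => z; nra.
rewrite mulrC; apply: (le_trans (ler_wpM2r (expR_ge0 _) h2)).
rewrite mulrDl mul1r; apply: lerD; first by rewrite expR_le1 oppr_le0 mulr_ge0 ?ltW// divr_gt0.
have y2 : 0 < y / 2 by rewrite divr_gt0.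
rewrite -[2 / y]invf_div -[leRHS]mul1r ler_pdivlMr// mulrAC.
rewrite -ler_pdivlMr ?expR_gt0// /Ey -expRN opprK mul1r mulrC.
by have := expR_ge1Dx (y / 2 * t); lra.
Qed.

Lemma adm_Ey y : 0 < y -> adm 2^-1 (Ey y).
Proof.
move=> y0; apply: (adm_exp_bound (C := 1) y0 (mfp_Ey y)) => t t0.
by rewrite mul1r ger0_norm// expR_ge0.
Qed.

Lemma expN_sub_bound (a b : R) : a <= b -> `|expR (- a) - expR (- b)| <= (b - a) * expR (- a).
Proof.
move=> ab; rewrite ger0_norm ?subr_ge0 ?ler_expR ?lerN2//.
have -> : expR (- b) = expR (- a) * expR (- (b - a)) by rewrite -expRD; congr expR; ring.
rewrite -[X in X - _]mulr1 -mulrBr mulrC ler_wpM2r ?expR_ge0//.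
exact: one_sub_expN_le.
Qed.

(** Frullani's integrand, of integral - ln y. Its transform is Gamma(w) (y^-w - 1), regular at w =
    0. *)
Definition dEy y t : R := (Ey y t - Ey 1 t) / t.

Lemma mfp_dEy y : mfp (dEy y).
Proof. by apply: mfpM; [apply: mfpB; exact: mfp_Ey|exact: mfp_inv]. Qed.

Lemma adm_dEy y : 0 < y -> adm 2^-1 (dEy y).
Proof.
move=> y0; pose m := Num.min y 1.
have m0 : 0 < m by rewrite lt_min y0 ltr01.
apply: (adm_exp_bound (C := `|y - 1|) m0 (mfp_dEy y)) => t t0.
rewrite /dEy normrM normfV (gtr0_norm t0) ler_pdivrMr// /Ey.
have [y1|y1] := leP y 1.
  have /expN_sub_bound : y * t <= 1 * t by rewrite ler_wpM2r// ltW.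
  rewrite /m (min_idPl y1) => h; apply: (le_trans h).
  by rewrite ler0_norm ?subr_le0// opprB -mulrBl mulrAC.
have /expN_sub_bound : 1 * t <= y * t by rewrite ler_wpM2r// ltW.
rewrite distrC /m (min_idPr (ltW y1)) => h; apply: (le_trans h).
by rewrite gtr0_norm ?subr_gt0// -mulrBl mulrAC.
Qed.

Lemma adm_Kf s (f : R -> R) : adm s f -> adm s (fun t => Kf t * f t).
Proof.
move=> af; apply: (adm_le _ _ af); first by apply: mfpM; [exact: mfp_Kf|exact: adm_mfp af].
by exists 1 => t t0; rewrite normrM ler_wpM2r// Kf_norm.
Qed.

Lemma lnE_crit p x : 0 < p -> p <= 1 -> 0 < x -> exists C, forall t, 0 < t ->
  `|lnE (x * t)| <= C * (expR (- (p * ln t)) * Ey ((1 - p) * x) t).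
Proof.
move=> p0 p1 x0; exists (p^-1 * expR (- (p * ln x))) => t t0.
apply: (le_trans (lnE_bound p0 p1 (mulr_gt0 x0 t0))).
rewrite -!mulrA ler_wpM2l ?invr_ge0 ?(ltW p0)// lnM ?posrE// mulrDr opprD expRD.
by rewrite /Ey !mulrA.
Qed.

Lemma adm_lnE x : 0 < x -> adm 2^-1 (fun t => lnE (x * t)).
Proof.
move=> x0; have h0 : 0 < 2^-1 :> R by [].
have h1 : 2^-1 <= 1 :> R by rewrite invf_le1 ?ler1n.
have [C HC] := lnE_crit h0 h1 x0.
have y0 : 0 < (1 - 2^-1) * x by rewrite mulr_gt0// subr_gt0 invf_lt1// ltr1n.
apply: (adm_crit (C := C) h0 (lexx _) y0 (mfp_lnE x)) => t t0.
apply: (le_trans (HC t t0)).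
by rewrite (_ : (2^-1 - 1) * ln t = - (2^-1 * ln t))//; field.
Qed.

Lemma Lf_bound t : 0 < t -> `|Lf t| <= t.
Proof.
move=> t0; have p := one_sub_expN_gt0 t0.
have q0 : 0 < (1 - expR (- t)) / t by rewrite divr_gt0.
rewrite ler_norml; apply/andP; split.
  rewrite -ler_expR lnK ?posrE// ler_pdivlMr// mulrC.
  exact: one_sub_expN_ge.
apply: (@le_trans _ _ 0); last exact: ltW.
by rewrite ln_le0// ler_pdivrMr// mul1r one_sub_expN_le.
Qed.

Lemma LfE t : 0 < t -> lnE t = Lf t + ln t.
Proof.
by move=> t0; rewrite /Lf ln_div ?posrE ?one_sub_expN_gt0// subrK.
Qed.

Lemma DfE x t : 0 < x -> 0 < t -> Df x t = lnE (x * t) - lnE t.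
Proof.
by move=> x0 t0; rewrite /Df ln_div ?posrE ?one_sub_expN_gt0// mulr_gt0.
Qed.

Lemma Df_ln_bound x t : 0 < x -> 0 < t -> `|Df x t - ln x| <= (x + 1) * t.
Proof.
move=> x0 t0; have xt := mulr_gt0 x0 t0.
rewrite DfE// !LfE// lnM ?posrE//.
rewrite (_ : _ - _ = Lf (x * t) - Lf t); last by ring.
rewrite (le_trans (ler_normB _ _))// mulrDl mul1r lerD// Lf_bound//.
Qed.

Lemma expN_div_bound t : 0 < t -> t * expR (- t) / (1 - expR (- t)) <= 2 * expR (- (t / 2)).
Proof.
move=> t0.
have p := one_sub_expN_gt0 t0.
have h : (1 - expR (- t))^-1 <= 1 + t^-1 by have := Kf_le1 t0; rewrite /Kf; lra.
apply: (le_trans (ler_wpM2l _ h)); first by rewrite mulr_ge0 ?expR_ge0// ltW.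
rewrite (_ : t * expR (- t) * (1 + t^-1) = (1 + t) * expR (- t)); last by field; rewrite gt_eqF.
have -> : expR (- t) = expR (- (t / 2)) * expR (- (t / 2)).
  by rewrite -expRD; congr expR; field.
rewrite mulrA ler_wpM2r ?expR_ge0// expRN ler_pdivrMr ?expR_gt0//.
have := expR_ge1Dx (t / 2); lra.
Qed.

Lemma lnE_sub_bound (a b : R) : 0 < a -> a <= b ->
  `|lnE b - lnE a| <= (b - a) / a * (2 * expR (- (a / 2))).
Proof.
move=> a0 ab; have b0 := lt_le_trans a0 ab.
have pa := one_sub_expN_gt0 a0; have pb := one_sub_expN_gt0 b0.
have m : lnE a <= lnE b by rewrite ler_ln ?posrE// lerD2l lerN2 ler_expR lerN2.
rewrite ger0_norm ?subr_ge0// -ln_div ?posrE//.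
have h1 : ln ((1 - expR (- b)) / (1 - expR (- a))) <= (1 - expR (- b)) / (1 - expR (- a)) - 1.
  have := expR_ge1Dx (ln ((1 - expR (- b)) / (1 - expR (- a)))).
  by rewrite lnK ?posrE ?divr_gt0//; lra.
apply: (le_trans h1).
rewrite (_ : _ - 1 = (expR (- a) - expR (- b)) / (1 - expR (- a))); last first.
  by field; rewrite gt_eqF.
have h2 : expR (- a) - expR (- b) <= (b - a) * expR (- a).
  by apply: le_trans (expN_sub_bound ab); exact: ler_norm.
have ia : 0 <= (1 - expR (- a))^-1 by rewrite invr_ge0 ltW.
apply: (le_trans (ler_wpM2r ia h2)).
rewrite (_ : _ / _ = (b - a) / a * (a * expR (- a) / (1 - expR (- a)))); last first.
  by field; rewrite !gt_eqF.
by rewrite ler_wpM2l ?expN_div_bound// divr_ge0 ?subr_ge0// ltW.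
Qed.

(** [lnE_sub_bound] is applied with the smaller of t and x t as [a], which yields the rate min(1, x)
    / 2. *)
Lemma Df_exp_bound x : 0 < x -> exists C y, [/\ 0 <= C, 0 < y, y <= 2^-1 &
  forall t, 0 < t -> `|Df x t| <= C * Ey y t].
Proof.
move=> x0; have [x1|x1] := leP 1 x.
  exists (2 * (x - 1)), 2^-1; split => //; first by rewrite mulr_ge0// subr_ge0.
  move=> t t0; have h : t <= x * t by rewrite ler_peMl// ltW.
  rewrite DfE//; apply: (le_trans (lnE_sub_bound t0 h)); rewrite /Ey.
  rewrite (_ : (x * t - t) / t = x - 1); last by field; rewrite gt_eqF.
  by rewrite [t / 2]mulrC mulrCA mulrA.
exists (2 * ((1 - x) / x)), (x / 2); split.
- by rewrite mulr_ge0// divr_ge0 ?subr_ge0 ?(ltW x1) ?(ltW x0).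
- by rewrite divr_gt0.
- by rewrite ler_pdivrMr// mulVf// ltW.
move=> t t0; have h : x * t <= t by rewrite ler_piMl// ltW.
rewrite DfE// distrC; apply: (le_trans (lnE_sub_bound (mulr_gt0 x0 t0) h)); rewrite /Ey.
rewrite (_ : (t - x * t) / (x * t) = (1 - x) / x); last by field; rewrite !gt_eqF.
rewrite (_ : x * t / 2 = x / 2 * t); last by field.
by rewrite mulrCA mulrA.
Qed.

(** The integrand of [I_fun] with t^(z-2) split as t^(z-1) times 1/t; the 1/t is compensated at 0 by
    [Lf], which is O(t). *)
Definition DLf x t : R := Df x t * Lf t / t.

Lemma mfp_DLf x : mfp (DLf x).
Proof. by apply: mfpM; [apply: mfpM; [exact: mfp_Df|exact: mfp_Lf]|exact: mfp_inv]. Qed.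

Lemma adm_DLf x : 0 < x -> adm 2^-1 (DLf x).
Proof.
move=> x0; have [C [y [C0 y0 _ DC]]] := Df_exp_bound x0.
apply: (adm_exp_bound (C := C) y0 (mfp_DLf x)) => t t0.
rewrite /DLf !normrM normfV (gtr0_norm t0) ler_pdivrMr//.
by apply: ler_pM; [exact: normr_ge0|exact: normr_ge0|exact: DC|exact: Lf_bound].
Qed.

(** [Df x t] tends to [ln x] at 0. Removing ln x e^-t leaves O(t), so that division by t is
    harmless, and keeps the exponential decay. *)
Definition D1f x t : R := Df x t - ln x * Ey 1 t.

Lemma mfp_D1f x : mfp (D1f x).
Proof.
by apply: mfpB; [exact: mfp_Df|apply: mfpM; [exact: mfp_cst|exact: mfp_Ey]].
Qed.

Lemma D1f_lin_bound x t : 0 < x -> 0 < t -> `|D1f x t| <= (x + 1 + `|ln x|) * t.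
Proof.
move=> x0 t0; rewrite (_ : D1f x t = (Df x t - ln x) + ln x * (1 - expR (- t))); last first.
  by rewrite /D1f /Ey mul1r; ring.
rewrite (le_trans (ler_normD _ _))// mulrDl lerD ?Df_ln_bound// normrM ler_wpM2l//.
by rewrite gtr0_norm ?one_sub_expN_gt0// one_sub_expN_le.
Qed.

Lemma D1f_exp_bound x : 0 < x -> exists C y, [/\ 0 <= C, 0 < y, y <= 1 &
  forall t, 0 < t -> `|D1f x t| <= C * Ey y t].
Proof.
move=> x0; have [C [y [C0 y0 y2 DC]]] := Df_exp_bound x0.
have y1 : y <= 1 by rewrite (le_trans y2)// invf_le1// ler1n.
exists (C + `|ln x|), y; split => // [|t t0]; first exact: addr_ge0.
rewrite (le_trans (ler_normB _ _))// mulrDl lerD ?DC// normrM ler_wpM2l//.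
by rewrite ger0_norm ?expR_ge0// ler_expR lerN2 ler_wpM2r// ltW.
Qed.

Definition D1tf x t : R := D1f x t / t.

Lemma mfp_D1tf x : mfp (D1tf x).
Proof. by apply: mfpM; [exact: mfp_D1f|exact: mfp_inv]. Qed.

Lemma adm_D1tf x : 0 < x -> adm 2^-1 (D1tf x).
Proof.
move=> x0; have [C [y [C0 y0 y1 DC]]] := D1f_exp_bound x0.
pose B := x + 1 + `|ln x|.
have B0 : 0 <= B by rewrite !addr_ge0// ltW.
(* [C] serves for t >= 1; for t < 1 the linear bound with [B] needs the factor [expR y] to
   compensate e^(-yt) >= e^-y. *)
apply: (adm_exp_bound (C := C + B * expR y) y0 (mfp_D1tf x)) => t t0.
rewrite /D1tf normrM normfV (gtr0_norm t0) ler_pdivrMr// mulrDl mulrDl.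
have [t1|t1] := leP 1 t.
  apply: (@le_trans _ _ (C * Ey y t * t)).
    by rewrite (le_trans (DC t t0))// ler_peMr// mulr_ge0// expR_ge0.
  by rewrite lerDl !mulr_ge0// ?expR_ge0// ltW.
apply: (@le_trans _ _ (B * expR y * Ey y t * t)).
  rewrite (le_trans (D1f_lin_bound x0 t0))// -/B ler_wpM2r ?(ltW t0)//.
  rewrite -mulrA ler_peMr// /Ey -expRD -expR0 ler_expR -[X in X - _]mulr1 -mulrBr.
  by rewrite mulr_ge0// ?subr_ge0 ltW.
by rewrite lerDr !mulr_ge0// ?expR_ge0// ltW.
Qed.

Lemma adm_EyV s : 0 < s -> s <= 2^-1 -> adm s (fun t => expR (s * ln t) * (Ey 1 t / t)).
Proof.
move=> s0 s1; apply: (adm_crit (C := 1) s0 s1 ltr01).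
  apply: mfpM; last by apply: mfpM; [exact: mfp_Ey|exact: mfp_inv].
  by apply: mfp_exp; apply: mfpM; [exact: mfp_cst|exact: mfp_ln].
move=> t t0; rewrite mul1r ger0_norm; last first.
  by rewrite !mulr_ge0// ?expR_ge0// invr_ge0 ltW.
by rewrite mulrBl mul1r expRD expRN lnK ?posrE// mulrA mulrAC.
Qed.

(** Serves kernels such as e^(-yt) / t, not integrable at 0, whose transforms exist for w > 0 only;
    a part [s] of the exponent [w] is kept as margin of integrability. *)
Lemma itg_powV (w : R) (f : R -> R) s y C : 0 < s -> s <= 2^-1 -> s <= w -> w <= 1 -> 0 < y -> mfp f ->
  (forall t, 0 < t -> `|f t| <= C * (expR ((s - w) * ln t) * Ey y t)) ->
  itg (fun t => expR (w * ln t) * (f t / t)).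
Proof.
move=> s0 s2 sw w1 y0 mf fC; apply: (adm_itg s0); apply: (adm_crit (C := C) s0 s2 y0).
  apply: mfpM; last by apply: mfpM => //; exact: mfp_inv.
  by apply: mfp_exp; apply: mfpM; [exact: mfp_cst|exact: mfp_ln].
move=> t t0; rewrite normrM (ger0_norm (expR_ge0 _)) normrM normfV (gtr0_norm t0).
rewrite mulrA mulrC ler_pdivrMl//.
rewrite (le_trans (ler_wpM2l (expR_ge0 _) (fC t t0)))//.
rewrite le_eqVlt; apply/orP; left; apply/eqP.
have -> : expR ((s - w) * ln t) = expR ((s - 1) * ln t) * expR (- w * ln t) * t.
  by rewrite -{4}[t]lnK// -!expRD; congr expR; ring.
have e : expR (w * ln t) * expR (- w * ln t) = 1.
  by rewrite -expRD mulNr subrr expR0.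
by rewrite (_ : expR (w * ln t) * _ = t * (C * (expR ((s - 1) * ln t) * Ey y t)) *
  (expR (w * ln t) * expR (- w * ln t))); [rewrite e mulr1|ring].
Qed.

Lemma itg_powV_Ey (w y : R) : 0 < w -> w <= 2^-1 -> 0 < y ->
  itg (fun t => expR (w * ln t) * (Ey y t / t)).
Proof.
move=> w0 w2 y0; have w1 : w <= 1 by rewrite (le_trans w2)// invf_le1// ler1n.
apply: (itg_powV (C := 1) w0 w2 (lexx w) w1 y0 (mfp_Ey y)) => t t0.
by rewrite subrr mul0r expR0 !mul1r ger0_norm// expR_ge0.
Qed.

Lemma itg_powV_lnE (w x : R) : 0 < w -> w <= 2^-1 -> 0 < x ->
  itg (fun t => expR (w * ln t) * (lnE (x * t) / t)).
Proof.
move=> w0 w2 x0; have w1 : w < 1 by rewrite (le_lt_trans w2)// invf_lt1// ltr1n.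
(* Half of [w] pays for the logarithmic singularity of [lnE], half remains for the factor 1/t. *)
have v0 : 0 < w / 2 by rewrite divr_gt0.
have vw : w / 2 <= w by lra.
have v1 : w / 2 <= 1 by lra.
have v2 : w / 2 <= 2^-1 by lra.
have [C HC] := lnE_crit v0 v1 x0.
have y0 : 0 < (1 - w / 2) * x by rewrite mulr_gt0// subr_gt0; lra.
apply: (itg_powV (C := C) v0 v2 vw (ltW w1) y0 (mfp_lnE x)) => t t0.
apply: (le_trans (HC t t0)).
by rewrite (_ : (w / 2 - w) * ln t = - (w / 2 * ln t))//; field.
Qed.
End Kernels.

(** * Gamma integrals, logarithmic and geometric series *)

Section GammaZeta.
Variable R : realType.
Local Notation C := (Cplx R).
Local Notation Re := (@complex.Re R).
Local Notation Im := (@complex.Im R).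
Implicit Types (x y w t : R).

(** For small real w, [G1 w] is Gamma(1 + w), regular at 0, and [G0 w] is Gamma(w), meaningful for w
    > 0 only. *)
Definition G1 w : R := Mel (Ey (1 : R)) w.
Definition G0 w : R := I0 (fun t => expR (w * ln t) * (Ey 1 t / t)).

Lemma half_gt0 : 0 < 2^-1 :> R. Proof. by []. Qed.

Lemma cGammaE (z : C) : cGamma z = cMel (Ey 1) (z - 1).
Proof. by apply: cintegral_eq => t _; rewrite mulrC /Ey mul1r. Qed.

Lemma cGamma1D (z : C) : cGamma (1 + z) = cMel (Ey 1) z.
Proof. by rewrite cGammaE addrAC subrr add0r. Qed.

Lemma is_derive_lin (c t : R) : is_derive t 1 (fun t => c * t) c.
Proof.
have := @is_deriveZ _ _ _ id c t 1 1 (is_derive_id _ _).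
by move=> h; apply: is_derive_eq h _; rewrite [_ *: 1]mulr1.
Qed.

Lemma is_derive_Ey y t : is_derive t 1 (Ey y) (- y * Ey y t).
Proof.
have -> : Ey y = (fun t => expR (- y * t)) by apply/funext => u; rewrite /Ey mulNr.
by apply: is_derive_expR_comp; exact: is_derive_lin.
Qed.

Lemma is_derive_mul (f g : R -> R) (a b t : R) : is_derive t 1 f a -> is_derive t 1 g b ->
  is_derive t 1 (fun t => f t * g t) (a * g t + f t * b).
Proof.
move=> df dg; apply: is_derive_eq (is_deriveM df dg) _.
by rewrite addrC [_ *: _]mulrC [X in _ + X]mulrC /=; ring.
Qed.

Lemma is_derive_add (f g : R -> R) (a b t : R) : is_derive t 1 f a -> is_derive t 1 g b ->
  is_derive t 1 (fun t => f t + g t) (a + b).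
Proof. by move=> df dg; exact: is_deriveD. Qed.

Lemma is_derive_sub (f g : R -> R) (a b t : R) : is_derive t 1 f a -> is_derive t 1 g b ->
  is_derive t 1 (fun t => f t - g t) (a - b).
Proof. by move=> df dg; exact: is_deriveB. Qed.

Lemma is_derive_pow w t : 0 < t ->
  is_derive t 1 (fun t => expR (w * ln t)) (w / t * expR (w * ln t)).
Proof. by move=> t0; apply: is_derive_expR_comp; exact: is_derive_ln_scale. Qed.

Lemma continuous_inv t : 0 < t -> {for t, continuous (fun t : R => t^-1)}.
Proof. by move=> t0; apply: cvgV; [rewrite gt_eqF|exact: cvg_id]. Qed.

(** The division by t matches the 1/t built into [wgt]: what is expressed is the decay of [G] itself
    at both ends. *)
Lemma FTC_adm (G g : R -> R) s : 0 < s -> (forall t, 0 < t -> is_derive t 1 G (g t)) ->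
  (forall t, 0 < t -> {for t, continuous g}) -> itg g ->
  adm s (fun t => G t / t) -> I0 g = 0.
Proof.
move=> s0 dG cg ig [_ [C GC]]; apply: (FTC_half_line s0 dG cg ig).
exists C => t t0; have := GC t t0.
by rewrite normrM normfV (gtr0_norm t0) /wgt mulrA ler_pM2r ?invr_gt0.
Qed.

(** The functional equation of Gamma: the derivative of t^w e^-t integrates to 0. *)
Lemma G0G1 w : 0 < w -> w < 2^-1 -> w * G0 w = G1 w.
Proof.
move=> w0 w2.
pose G t : R := expR (w * ln t) * Ey 1 t.
pose g t : R := w * (expR (w * ln t) * (Ey 1 t / t)) - expR (w * ln t) * Ey 1 t.
have i1 := itg_powV_Ey w0 (ltW w2) ltr01.
have i2 : itg (fun t => expR (w * ln t) * Ey 1 t).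
  by apply: (Mel_itg _ (adm_Ey ltr01)); rewrite gtr0_norm.
have dG t : 0 < t -> is_derive t 1 G (g t).
  move=> t0; apply: is_derive_eq (is_derive_mul (is_derive_pow w t0) (is_derive_Ey 1 t)) _.
  by rewrite /g; ring.
have cg t : 0 < t -> {for t, continuous g}.
  move=> t0; have cE := is_derive1_continuous (is_derive_Ey 1 t).
  have cp := is_derive1_continuous (is_derive_pow w t0).
  apply: cvgB; last by apply: cvgM.
  apply: cvgM; first exact: cvg_cst.
  apply: cvgM => //; apply: cvgM => //; exact: continuous_inv.
have := FTC_adm w0 dG cg (itgB (itgZ w i1) i2).
rewrite /g I0B ?I0Z//; last exact: itgZ.
move=> H; apply/eqP; rewrite -subr_eq0; apply/eqP; apply: H.
by apply: adm_eq (adm_EyV w0 (ltW w2)) => t _; rewrite mulrA.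
Qed.

Lemma G1_0 : G1 0 = 1.
Proof.
rewrite /G1 /Mel (@I0_eq _ _ (fun t => expR (- t))); last first.
  by move=> t _; rewrite mul0r expR0 mul1r /Ey mul1r.
have iE : itg (fun t : R => expR (- t)).
  apply: itg_eq (adm_itg half_gt0 (adm_Ey ltr01)) => t _.
  by rewrite /Ey mul1r.
rewrite /I0 Rintegral_itv_obnd_cbnd//.
have dE (t : R) : is_derive t 1 (fun t => - expR (- t)) (expR (- t)).
  have E : (fun t : R => - expR (- t)) = (fun t => -1 * Ey 1 t).
    by apply/funext => u; rewrite mulN1r /Ey mul1r.
  rewrite E; apply: is_derive_eq (@is_deriveZ _ _ _ _ (-1) t 1 _ (is_derive_Ey 1 t)) _.
  by rewrite [_ *: _]mulNr mul1r mulN1r opprK /Ey mul1r.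
have cE (t : R) : {for t, continuous (fun t : R => expR (- t))}.
  by apply: continuous_comp; [exact: continuousN|exact: continuous_expR].
rewrite (@Rintegral_ge0_continuous_FTC2y _ _ (fun t => - expR (- t)) 0 0).
- by rewrite oppr0 expR0 sub0r opprK.
- by move=> t _; exact: expR_ge0.
- by apply: continuous_subspaceT.
- by rewrite -[X in _ --> X]oppr0; apply: cvgN; exact: cvgr_expR.
- by move=> t _; have [] := dE t.
- by apply: cvg_at_right_filter; exact: (is_derive1_continuous (dE 0)).
- by move=> t _; rewrite derive1E; have [_ ->] := dE t.
Qed.

Lemma cGamma1 : cGamma (1 : C) = 1.
Proof.
by rewrite -[X in cGamma X]addr0 cGamma1D (cMel_real _ 0) -/(G1 0) G1_0.
Qed.

Lemma I0_pow_dilation w y (f : R -> R) : 0 < y -> mfp f ->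
  itg (fun t => expR (w * ln t) * f (y * t)) ->
  Mel f w = y * expR (w * ln y) * Mel (fun t => f (y * t)) w.
Proof.
move=> y0 mf ifc; rewrite /Mel (I0_dilation y0); last first.
  by apply: mfpM => //; apply: mfp_exp; apply: mfpM; [exact: mfp_cst|exact: mfp_ln].
rewrite -mulrA; congr (_ * _); rewrite -I0Z//; apply: I0_eq => t t0.
by rewrite lnM ?posrE// mulrDr expRD mulrA.
Qed.

Lemma Mel_Ey w y : `|w| < 2^-1 -> 0 < y ->
  Mel (Ey y) w = y^-1 * expR (- w * ln y) * G1 w.
Proof.
move=> w2 y0.
have E t : Ey 1 (y * t) = Ey y t by rewrite /Ey mul1r.
have i1 : itg (fun t => expR (w * ln t) * Ey 1 (y * t)).
  by apply: itg_eq (Mel_itg w2 (adm_Ey y0)) => t _; rewrite E.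
rewrite /G1 (I0_pow_dilation y0 (mfp_Ey 1) i1).
rewrite (_ : Mel (fun t => Ey 1 (y * t)) w = Mel (Ey y) w); last by apply: Mel_eq => t _; rewrite E.
move: (Mel _ _) => M.
rewrite (_ : _ * (_ * M) = (y^-1 * y) * (expR (- w * ln y) * expR (w * ln y)) * M); last by ring.
by rewrite mulVf ?gt_eqF// -expRD mulNr addNr expR0 !mul1r.
Qed.

Lemma I0_powV_Ey w y : 0 < w -> w < 2^-1 -> 0 < y ->
  I0 (fun t => expR (w * ln t) * (Ey y t / t)) = expR (- w * ln y) * G0 w.
Proof.
move=> w0 w2 y0; apply: (mulfI (x := w)); first by rewrite gt_eqF.
have i1 := itg_powV_Ey w0 (ltW w2) y0.
have m : mfp (fun t => expR (w * ln t) * (Ey 1 t / t)).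
  exact: itg_mfp (itg_powV_Ey w0 (ltW w2) ltr01).
congr (w * _); rewrite /G0 (I0_dilation y0 m).
have E t : 0 < t -> expR (w * ln (y * t)) * (Ey 1 (y * t) / (y * t)) =
    (y^-1 * expR (w * ln y)) * (expR (w * ln t) * (Ey y t / t)).
  move=> t0; rewrite lnM ?posrE// mulrDr expRD /Ey mul1r; field.
  by rewrite !gt_eqF.
rewrite (I0_eq E) I0Z//; move: (I0 _) => M.
rewrite (_ : _ * (_ * _) = (y * y^-1) * (expR (- w * ln y) * expR (w * ln y)) * M); last by ring.
by rewrite mulfV ?gt_eqF// -expRD mulNr addNr expR0 !mul1r.
Qed.

(** Stated for complex [z] because the Dirichlet series is needed on a complex neighbourhood of
    2. *)
Lemma cMel_Ey (z : C) y : `|Re z| < 2^-1 -> 0 < y ->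
  cMel (Ey y) z = y^-1%:C * cpow y (- z) * cGamma (1 + z).
Proof.
move=> z2 y0; rewrite cGamma1D.
have [c1 c2] := citg_cpow (adm_Ey ltr01) z2.
have [d1 d2] := citg_cpow (adm_Ey y0) z2.
have cy : cpow y (- z) * cpow y z = 1.
  by rewrite -cpowD addNr /cpow mulr0 cexp0.
have E (t : R) : 0 < t -> cpow (y * t) z * (Ey 1 (y * t))%:C = cpow y z * (cpow t z * (Ey y t)%:C).
  move=> t0; rewrite mulrA; congr (_ * _); last by rewrite /Ey mul1r.
  by rewrite /cpow lnM ?posrE// realCD mulrDl cexpD.
have H : cMel (Ey 1) z = y%:C * (cpow y z * cMel (Ey y) z).
  rewrite -[in RHS]cintegralZ//; apply: complex_ext.
  - rewrite cReMr; transitivity (y * I0 (fun t => Re (cpow (y * t) z * (Ey 1 (y * t))%:C))).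
      exact: (I0_dilation y0 (itg_mfp c1)).
    by congr (_ * _); apply: I0_eq => t t0; rewrite E.
  - rewrite cImMr; transitivity (y * I0 (fun t => Im (cpow (y * t) z * (Ey 1 (y * t))%:C))).
      exact: (I0_dilation y0 (itg_mfp c2)).
    by congr (_ * _); apply: I0_eq => t t0; rewrite E.
rewrite H; move: (cMel (Ey y) z) => M.
have yy : y^-1%:C * y%:C = 1 :> C by rewrite -realCM mulVf ?gt_eqF.
transitivity ((y^-1%:C * y%:C) * (cpow y (- z) * cpow y z) * M); last by ring.
by rewrite yy cy !mul1r.
Qed.

(** The N-th remainder vanishes at 0 and has derivative s^N / (1 - s), at most (1 - u)^-1 s^N on
    [0, u]; [mvt_bound] then gives a geometric rate. *)
Lemma log_series (u : R) : 0 <= u -> u < 1 ->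
  series (fun n => u ^+ n.+1 / n.+1%:R) @ \oo --> - ln (1 - u).
Proof.
move=> u0 u1.
have bnd N : `|- ln (1 - u) - series (fun n => u ^+ n.+1 / n.+1%:R) N| <=
    (1 - u)^-1 * u ^+ N.+1.
  pose H (s : R) := - ln (1 - s) - series (fun n => s ^+ n.+1 / n.+1%:R) N.
  pose H' (s : R) := s ^+ N / (1 - s).
  have dH (s : R) : 0 <= s <= u -> is_derive s 1 H (H' s).
    move=> /andP[s0 su]; have s1 : 0 < 1 - s by rewrite subr_gt0 (le_lt_trans su).
    have d1 : is_derive s 1 (fun s : R => 1 - s) (0 - 1) by apply: is_derive_sub.
    have d2 := @is_derive1_comp _ (@ln R) (fun s : R => 1 - s) s _ _ (is_derive1_ln s1) d1.
    have d3 : is_derive s 1 (fun s : R => series (fun n => s ^+ n.+1 / n.+1%:R) N)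
       (series (fun n => s ^+ n) N).
      elim: N {H H'} => [|N IH].
        rewrite (_ : (fun s : R => _) = cst 0); last first.
          by apply/funext => v; rewrite /series/= big_geq.
        by rewrite /series/= big_geq//; exact: is_derive_cst.
      rewrite (_ : (fun s : R => _) = (fun s : R => series (fun n => s ^+ n.+1 / n.+1%:R) N +
          N.+1%:R^-1 * s ^+ N.+1)); last first.
        by apply/funext => v; rewrite seriesSr [_ * _^-1]mulrC.
      rewrite seriesSr; apply: is_derive_add => //.
      have := @is_deriveX _ _ id N.+1 s 1 1 (is_derive_id _ _).
      move=> /(@is_deriveZ _ _ _ _ N.+1%:R^-1 s 1) h.
      rewrite (_ : (fun t => _) = N.+1%:R^-1 \*: (id ^+ N.+1)); last first.
        by apply/funext => v; rewrite /= exprfctE.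
      apply: is_derive_eq h _; by rewrite [_ *: 1]mulr1 /= [_ *: _]mulrA mulVf ?mul1r.
    have -> : H' s = - ((1 - s)^-1 * (0 - 1)) - series (fun n => s ^+ n) N.
      have sN0 : 1 - s != 0 by rewrite gt_eqF.
      have g : series (fun n => s ^+ n) N = (1 - s ^+ N) / (1 - s).
        apply: (mulIf sN0); rewrite divfK// mulrC /series/= big_mkord.
        by rewrite -[X in X - s ^+ N](expr1n _ N) subrXX; congr (_ * _);
          apply: eq_bigr => i _; rewrite expr1n mul1r.
      by rewrite g /H'; field.
    by apply: is_derive_sub => //; exact: is_deriveN.
  have H0 : H 0 = 0.
    rewrite /H subr0 ln1 oppr0 sub0r /series/= big1 ?oppr0// => i _.
    by rewrite exprS mul0r mul0r.
  apply: (mvt_bound dH H0 _ (s := u)); last by rewrite u0 lexx.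
  move=> s /andP[s0 su]; have s1 : 0 < 1 - s by rewrite subr_gt0 (le_lt_trans su).
  rewrite /H' normrM normfV (gtr0_norm s1) ger0_norm ?exprn_ge0// mulrC.
  rewrite ler_wpM2r ?exprn_ge0// lef_pV2 ?posrE ?subr_gt0//; lra.
apply/cvgrPdist_le => e e0.
have : (1 - u)^-1 * u ^+ n.+1 @[n --> \oo] --> (1 - u)^-1 * 0.
  apply: cvgM; first exact: cvg_cst.
  have := @cvg_expr R u; rewrite ger0_norm// => /(_ u1).
  by rewrite -(cvg_shiftS (fun n => u ^+ n)).
rewrite mulr0 => /cvgr0Pnorm_le/(_ _ e0); apply: filterS => N.
rewrite ger0_norm; last by rewrite mulr_ge0 ?invr_ge0 ?exprn_ge0// subr_ge0 ltW.
exact: le_trans (bnd N).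
Qed.

Lemma lnE_series x t : 0 < x -> 0 < t ->
  series (fun n => Ey (n.+1%:R * x) t / n.+1%:R) @ \oo --> - lnE (x * t).
Proof.
move=> x0 t0; rewrite /lnE.
have := @log_series (expR (- (x * t))) (expR_ge0 _).
rewrite expR_lt1 oppr_lt0 mulr_gt0// => /(_ isT).
rewrite (_ : (fun n => _) = (fun n => Ey (n.+1%:R * x) t / n.+1%:R))//.
apply/funext => n; congr (_ / _).
by rewrite /Ey -expRM_natl mulrN mulrA.
Qed.

Lemma geo_series t : 0 < t -> series (fun n => Ey n.+1%:R t) @ \oo --> Ey 1 t / (1 - expR (- t)).
Proof.
move=> t0.
have := @cvg_geometric_series R (expR (- t)) (expR (- t)).
rewrite ger0_norm ?expR_ge0// expR_lt1 oppr_lt0 t0 => /(_ isT).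
rewrite /Ey mul1r (_ : geometric _ _ = (fun n => expR (- (n.+1%:R * t))))//.
apply/funext => n; rewrite /geometric/= -expRM_natl -expRD; congr expR.
by rewrite -natr1; ring.
Qed.
End GammaZeta.

(** * Mellin transforms expressed by zeta *)

Section ZetaMellin.
Variable R : realType.
Local Notation C := (Cplx R).
Local Notation Re := (@complex.Re R).
Local Notation Im := (@complex.Im R).
Implicit Types (x y w t : R).
Variable zeta : C -> C.
Hypothesis hzeta : is_riemann_zeta zeta.

Lemma series_realC (u : nat -> R) :
  series (fun n => (u n)%:C : C) = (fun n => (series u n)%:C).
Proof. by apply/funext => n; rewrite /series/= realC_sum. Qed.

Lemma cvg_series_realC (u : nat -> R) (l : R) : series u @ \oo --> l ->
  series (fun n => (u n)%:C : C) @ \oo --> (l%:C : C).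
Proof. by move=> ul; rewrite series_realC; exact: cvg_realC. Qed.

Lemma cvg_seriesMl (u : nat -> C) (c l : C) : series u @ \oo --> l ->
  series (fun n => c * u n) @ \oo --> c * l.
Proof.
move=> ul; rewrite (_ : series _ = (fun n => c * series u n)).
  by exact: (cvgM (@cvg_cst C c nat \oo _) ul).
by apply/funext => n; rewrite /series/= mulr_sumr.
Qed.

Lemma zeta_real_eq (u : nat -> R) (c w l : R) : 0 < w ->
  (forall n, u n = c * expR (- (1 + w) * ln n.+1%:R)) ->
  series u @ \oo --> l -> l%:C = c%:C * zeta (1 + w%:C).
Proof.
move=> w0 uE ul.
have h1 : 1 < Re (1 + w%:C) by rewrite cReD/= ltrDl.
have := cvg_seriesMl (c := c%:C) (hzeta.2 _ h1).
rewrite (_ : (fun n => _) = (fun n => (u n)%:C)); last first.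
  apply/funext => n; rewrite uE realCM; congr (_ * _).
  by rewrite -(cpow_real _ (- (1 + w))) realCN realCD.
move=> H; have H' := cvg_series_realC ul.
by apply/esym; apply: (cvg_unique _ H H').
Qed.

Lemma half_norm w : 0 < w -> w < 2^-1 -> `|w| < 2^-1.
Proof. by move=> w0 w2; rewrite gtr0_norm. Qed.

Lemma adm_KEy y : 0 < y -> adm 2^-1 (fun t => Kf t * Ey y t).
Proof. by move=> y0; apply: adm_Kf; exact: adm_Ey. Qed.

Lemma mfp_pow w : mfp (fun t => expR (w * ln t)).
Proof. by apply: mfp_exp; apply: mfpM; [exact: mfp_cst|exact: mfp_ln]. Qed.

Lemma KEyE y t : 0 < t -> Ey y t / (1 - expR (- t)) = Kf t * Ey y t + Ey y t / t.
Proof. by move=> t0; rewrite /Kf; ring. Qed.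

(** K(t) e^-t is the sum of the e^(-nt), n >= 1, minus e^-t / t. The sum gives Gamma(1 + w) zeta(1 +
    w), the other term Gamma(w) = Gamma(1 + w) / w, which removes the pole of zeta. *)
Lemma Mel_KEy1 w : 0 < w -> w < 2^-1 ->
  (Mel (fun t => Kf t * Ey 1 t) w)%:C = (G1 w)%:C * (zeta (1 + w%:C) - w%:C^-1).
Proof.
move=> w0 w2; have nw := half_norm w0 w2.
have i1 : itg (fun t => expR (w * ln t) * (Kf t * Ey 1 t)) := Mel_itg nw (adm_KEy ltr01).
have i2 := itg_powV_Ey w0 (ltW w2) ltr01.
have E t : 0 < t -> expR (w * ln t) * (Kf t * Ey 1 t) + expR (w * ln t) * (Ey 1 t / t) =
    expR (w * ln t) * (Ey 1 t / (1 - expR (- t))).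
  by move=> t0; rewrite KEyE// mulrDr.
have [iq H] := I0_series (mfp_pow w) (fun n => mfp_Ey n.+1%:R)
  (fun n t _ => expR_ge0 _) (@geo_series R) (itg_eq E (itgD i1 i2)).
have uE n : I0 (fun t => expR (w * ln t) * Ey n.+1%:R t) = G1 w * expR (- (1 + w) * ln n.+1%:R).
  rewrite -/(Mel _ _) Mel_Ey// mulrC; congr (_ * _).
  rewrite (_ : - (1 + w) * ln n.+1%:R = - ln n.+1%:R + - w * ln n.+1%:R); last by ring.
  by rewrite expRD expRN lnK ?posrE.
have := zeta_real_eq w0 uE H.
rewrite -(I0_eq E) I0D// -/(G0 w) -/(Mel _ _) realCD mulrBr => <-.
rewrite -(G0G1 w0 w2) realCM.
have wC : w%:C != 0 :> C by apply: contra_neq (lt0r_neq0 w0) => -[].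
by rewrite [w%:C * _]mulrC mulfK// addrK.
Qed.

(** Termwise integration of the logarithmic series; [0 < w] makes both Gamma(w) and the Dirichlet
    series at 1 + w converge. *)
Lemma I0_powV_lnE w x : 0 < w -> w < 2^-1 -> 0 < x ->
  (I0 (fun t => expR (w * ln t) * (lnE (x * t) / t)))%:C =
  - ((expR (- w * ln x) * G0 w)%:C * zeta (1 + w%:C)).
Proof.
move=> w0 w2 x0.
have i1 := itg_powV_lnE w0 (ltW w2) x0.
have E t : 0 < t -> - (expR (w * ln t) * (lnE (x * t) / t)) =
    expR (w * ln t) / t * - lnE (x * t).
  by move=> t0; ring.
have mpsi : mfp (fun t => expR (w * ln t) / t).
  by apply: mfpM; [exact: mfp_pow|exact: mfp_inv].
have mq n : mfp (fun t => Ey (n.+1%:R * x) t / n.+1%:R).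
  by apply: mfpM; [exact: mfp_Ey|exact: mfp_cst].
have q0 n t : 0 < t -> 0 <= Ey (n.+1%:R * x) t / n.+1%:R.
  by move=> _; rewrite divr_ge0// expR_ge0.
have [iq H] := I0_series mpsi mq q0 (fun t => @lnE_series R x t x0) (itg_eq E (itgN i1)).
have uE n : I0 (fun t => expR (w * ln t) / t * (Ey (n.+1%:R * x) t / n.+1%:R)) =
    (expR (- w * ln x) * G0 w) * expR (- (1 + w) * ln n.+1%:R).
  have nx : 0 < n.+1%:R * x by rewrite mulr_gt0.
  rewrite (@I0_eq _ _ (fun t => n.+1%:R^-1 * (expR (w * ln t) * (Ey (n.+1%:R * x) t / t)))).
    rewrite I0Z ?I0_powV_Ey//; last exact: (itg_powV_Ey w0 (ltW w2) nx).
    rewrite lnM ?posrE// mulrDr expRD.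
    rewrite (_ : - (1 + w) * ln n.+1%:R = - ln n.+1%:R + - w * ln n.+1%:R); last by ring.
    by rewrite expRD expRN lnK ?posrE//; ring.
  by move=> t t0; ring.
have := zeta_real_eq w0 uE H.
by rewrite -(I0_eq E) I0N// => <-; rewrite realCN opprK.
Qed.

(** On a complex strip this presents zeta(2 + z) as a quotient of Mellin transforms, the source of
    its smoothness at 2. The real and imaginary parts of t^z act as the signed factor in
    [I0_series]. *)
Lemma cMel_lnE (z : C) : `|Re z| < 2^-1 ->
  cMel (fun t => - lnE t) z = cGamma (1 + z) * zeta (2 + z).
Proof.
move=> z2.
have aL : adm 2^-1 (fun t => - lnE t).
  by apply: adm_eq (admN (adm_lnE ltr01)) => t _; rewrite mul1r.
have [c1 c2] := citg_cpow aL z2.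
have mq n : mfp (fun t => Ey n.+1%:R t / n.+1%:R : R).
  by apply: mfpM; [exact: mfp_Ey|exact: mfp_cst].
have q0 n t : 0 < t -> 0 <= Ey n.+1%:R t / n.+1%:R.
  by move=> _; rewrite divr_ge0// expR_ge0.
have ls t : 0 < t -> series (fun n => Ey n.+1%:R t / n.+1%:R) @ \oo --> - lnE t.
  move=> t0; have := lnE_series ltr01 t0; rewrite mul1r.
  by rewrite (_ : (fun n => _) = (fun n => Ey n.+1%:R t / n.+1%:R))//;
    apply/funext => n; rewrite mulr1.
have m1 : mfp (fun t => Re (cpow t z)).
  by apply: mfp_eq (mfp_Re_cpow z (mfp_cst 1)) => t _; rewrite mulr1.
have m2 : mfp (fun t => Im (cpow t z)).
  by apply: mfp_eq (mfp_Im_cpow z (mfp_cst 1)) => t _; rewrite mulr1.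
have E1 t : 0 < t -> Re (cpow t z * (- lnE t)%:C) = Re (cpow t z) * - lnE t.
  by move=> _; rewrite mulrC cReMr mulrC.
have E2 t : 0 < t -> Im (cpow t z * (- lnE t)%:C) = Im (cpow t z) * - lnE t.
  by move=> _; rewrite mulrC cImMr mulrC.
have [iq1 H1] := I0_series m1 mq q0 ls (itg_eq E1 c1).
have [iq2 H2] := I0_series m2 mq q0 ls (itg_eq E2 c2).
pose u n : C := n.+1%:R^-1%:C * cMel (Ey n.+1%:R) z.
have H : series u @ \oo --> cMel (fun t => - lnE t) z.
  apply: cvg_complex.
  - rewrite (_ : (fun n => _) = series (fun n => I0 (fun t => Re (cpow t z) * (Ey n.+1%:R t / n.+1%:R)))).
      have -> : Re (cMel (fun t => - lnE t) z) = I0 (fun t => Re (cpow t z) * - lnE t) by exact: (I0_eq E1).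
      by [].
    apply/funext => n; rewrite /series.
    transitivity (\sum_(0 <= i < n) Re (u i)); first exact: (big_morph Re (@cReD R) (erefl _)).
    apply: eq_bigr => i _; rewrite /u cReMr -I0Z.
      by apply: I0_eq => t _; rewrite [_ * (Ey _ _)%:C]mulrC cReMr; ring.
    by have [] := citg_cpow (adm_Ey (ltr0Sn _ i)) z2.
  - rewrite (_ : (fun n => _) = series (fun n => I0 (fun t => Im (cpow t z) * (Ey n.+1%:R t / n.+1%:R)))).
      have -> : Im (cMel (fun t => - lnE t) z) = I0 (fun t => Im (cpow t z) * - lnE t) by exact: (I0_eq E2).
      by [].
    apply/funext => n; rewrite /series.
    transitivity (\sum_(0 <= i < n) Im (u i)); first exact: (big_morph Im (@cImD R) (erefl _)).
    apply: eq_bigr => i _; rewrite /u cImMr -I0Z.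
      by apply: I0_eq => t _; rewrite [_ * (Ey _ _)%:C]mulrC cImMr; ring.
    by have [] := citg_cpow (adm_Ey (ltr0Sn _ i)) z2.
have h1 : 1 < Re (2 + z).
  rewrite cReD (_ : Re 2 = 2 :> R); last by rewrite natrC.
  by move: z2; rewrite ltr_norml => /andP[]; lra.
have := cvg_seriesMl (c := cGamma (1 + z)) (hzeta.2 _ h1).
rewrite (_ : (fun n => _) = u) => [H'|]; first exact: (cvg_unique _ H H').
apply/funext => n; rewrite /u cMel_Ey//.
have e : cpow n.+1%:R (- (2 + z)) = (n.+1%:R^-1 * n.+1%:R^-1)%:C * cpow n.+1%:R (- z).
  rewrite opprD cpowD; congr (_ * _).
  rewrite (_ : - 2 = (-2)%:C :> C); last by rewrite realCN -natrC.
  rewrite cpow_real; congr (_%:C).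
  by rewrite (_ : -2 * ln n.+1%:R = - ln n.+1%:R + - ln n.+1%:R :> R) ?expRD ?expRN ?lnK ?posrE//; ring.
by rewrite e realCM; ring.
Qed.

End ZetaMellin.

(** * The functional equation between Mellin transforms *)

Section MainIdentity.
Variable R : realType.
Implicit Types (x w t s : R).

Lemma MelD s (f g : R -> R) w : `|w| < s -> adm s f -> adm s g ->
  Mel (fun t => f t + g t) w = Mel f w + Mel g w.
Proof.
move=> ws af ag; rewrite /Mel -(I0D (Mel_itg ws af) (Mel_itg ws ag)).
by apply: I0_eq => t _; rewrite mulrDr.
Qed.

Lemma MelZ s (c : R) (f : R -> R) w : `|w| < s -> adm s f ->
  Mel (fun t => c * f t) w = c * Mel f w.
Proof.
move=> ws af; rewrite /Mel -(I0Z c (Mel_itg ws af)).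
by apply: I0_eq => t _; rewrite mulrCA.
Qed.

Lemma MelB s (f g : R -> R) w : `|w| < s -> adm s f -> adm s g ->
  Mel (fun t => f t - g t) w = Mel f w - Mel g w.
Proof.
move=> ws af ag; rewrite /Mel -(I0B (Mel_itg ws af) (Mel_itg ws ag)).
by apply: I0_eq => t _; rewrite mulrBr.
Qed.

Definition dlnE t : R := Ey 1 t / (1 - Ey 1 t).

(** After the product rule, [Kf] feeds the Phi terms, the constant -1 the terms in zeta at 2, and
    t^-1 the quotient (B - A) / t. *)
Lemma dlnEK t : 0 < t -> dlnE t = Kf t + t^-1 - 1.
Proof.
move=> t0; have p := one_sub_expN_gt0 t0.
by rewrite /dlnE /Kf /Ey mul1r; field; rewrite !gt_eqF.
Qed.

Lemma is_derive_lnE t : 0 < t -> is_derive t 1 (@lnE R) (dlnE t).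
Proof.
move=> t0; have p := one_sub_expN_gt0 t0.
have d1 : is_derive t 1 (fun t => 1 - Ey 1 t) (0 - - 1 * Ey 1 t).
  by apply: is_derive_sub; exact: is_derive_Ey.
have p' : 0 < 1 - Ey 1 t by rewrite /Ey mul1r.
have := @is_derive1_comp _ (@ln R) (fun t => 1 - Ey 1 t) t _ _ (is_derive1_ln p') d1.
rewrite (_ : @ln R \o _ = @lnE R); last by apply/funext => u; rewrite /lnE /Ey/= mul1r.
move=> h; apply: is_derive_eq h _; rewrite /dlnE; move: (Ey 1 t) p' => e p'; field.
by rewrite gt_eqF.
Qed.

Lemma is_derive_lnEx x t : 0 < x -> 0 < t ->
  is_derive t 1 (fun t => lnE (x * t)) (x * dlnE (x * t)).
Proof.
move=> x0 t0; have xt := mulr_gt0 x0 t0.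
have := @is_derive1_comp _ (@lnE R) (fun t => x * t) t _ _ (is_derive_lnE xt) (is_derive_lin x t).
by move=> h; apply: is_derive_eq h _; rewrite mulrC.
Qed.

Lemma continuous_dlnE t : 0 < t -> {for t, continuous (@dlnE)}.
Proof.
move=> t0; have p := one_sub_expN_gt0 t0.
have cE := is_derive1_continuous (is_derive_Ey 1 t).
apply: cvgM => //; apply: cvgV; first by rewrite gt_eqF// /Ey mul1r.
by apply: cvgB => //; exact: cvg_cst.
Qed.

Lemma continuous_dlnEx x t : 0 < x -> 0 < t -> {for t, continuous (fun t => dlnE (x * t))}.
Proof.
move=> x0 t0; apply: continuous_comp; last by apply: continuous_dlnE; exact: mulr_gt0.
exact: (is_derive1_continuous (is_derive_lin x t)).
Qed.

Definition KlnE x t : R := Kf t * lnE (x * t).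
Definition xKlnE x t : R := x * (Kf (x * t) * lnE t).

Lemma adm_KlnE x : 0 < x -> adm 2^-1 (KlnE x).
Proof. by move=> x0; apply: adm_Kf; exact: adm_lnE. Qed.

Lemma adm_lnE1 : adm 2^-1 (@lnE R).
Proof. by apply: adm_eq (adm_lnE (ltr01 : 0 < 1 :> R)) => t _; rewrite mul1r. Qed.

Lemma mfp_Kfx x : 0 < x -> mfp (fun t => Kf (x * t)).
Proof.
move=> x0; apply: mfpB; last by apply: mfpV; [move=> t t0; exact: mulr_gt0|exact: mfp_lin].
apply: mfpV; last exact: mfp_1subE.
by move=> t t0; rewrite one_sub_expN_gt0// mulr_gt0.
Qed.

Lemma adm_xKlnE x : 0 < x -> adm 2^-1 (xKlnE x).
Proof.
move=> x0; apply: admZ; apply: (adm_le _ _ adm_lnE1).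
  by apply: mfpM; [exact: mfp_Kfx|exact: adm_mfp adm_lnE1].
by exists 1 => t t0; rewrite normrM ler_wpM2r// Kf_norm// mulr_gt0.
Qed.

Lemma adm_lnmul s (f : R -> R) : s < 2^-1 -> adm 2^-1 f -> adm s (fun t => ln t * f t).
Proof. by move=> s2 /(adm_lnX 1 s2); apply: adm_eq => t _; rewrite expr1. Qed.

Lemma admW s s' (f : R -> R) : s < s' -> adm s' f -> adm s f.
Proof. by move=> s2 /(adm_lnX 0 s2); apply: adm_eq => t _; rewrite expr0 mul1r. Qed.

(* This is [\int_0^oo G' = 0] for
   [G t = t^w (lnE t (lnE (x t) - lnE t) - ln x ln t e^-t)], which vanishes at
   both ends. *)
Lemma Mellin_functional_equation x w : 0 < x -> 0 < w -> w < 2^-1 ->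
  Mel (KlnE x) w + Mel (xKlnE x) w - 2 * Mel (KlnE 1) w
  - (Mel (fun t => lnE (x * t)) w + (x - 2) * Mel (@lnE R) w)
  + (ln x * Mel (fun t => ln t * Ey 1 t) w
     + (w * Mel (fun t => ln t * D1tf x t) w + Mel (D1tf x) w))
  + w * Mel (DLf x) w = 0.
Proof.
move=> x0 w0 w2.
(* The gap below 1/2 pays for the factors [ln t], the gap above [w] for the factor t^w. *)
pose s : R := (w + 2^-1) / 2.
have s2 : s < 2^-1 by rewrite /s; lra.
have ws : w < s by rewrite /s; lra.
have nws : `|w| < s by rewrite gtr0_norm.
pose F t : R := lnE t * (lnE (x * t) - lnE t) - ln x * (ln t * Ey 1 t).
pose F' t : R := (dlnE t * (lnE (x * t) - lnE t) + lnE t * (x * dlnE (x * t) - dlnE t)) -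
  ln x * (t^-1 * Ey 1 t + ln t * (- 1 * Ey 1 t)).
pose pw t : R := expR (w * ln t).
pose G t : R := pw t * F t.
pose g t : R := w / t * pw t * F t + pw t * F' t.
have dF t : 0 < t -> is_derive t 1 F (F' t).
  move=> t0; apply: is_derive_sub.
    apply: is_derive_mul; first exact: is_derive_lnE.
    by apply: is_derive_sub; [exact: is_derive_lnEx|exact: is_derive_lnE].
  have d1 := is_derive_mul (is_derive1_ln t0) (is_derive_Ey 1 t).
  by have := @is_deriveZ _ _ _ _ (ln x) t 1 _ d1.
have dG t : 0 < t -> is_derive t 1 G (g t).
  by move=> t0; apply: is_derive_mul; [exact: is_derive_pow|exact: dF].
have cg t : 0 < t -> {for t, continuous g}.
  move=> t0.
  have c1 := is_derive1_continuous (is_derive_pow w t0).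
  have c2 := is_derive1_continuous (dF t t0).
  have c3 := is_derive1_continuous (is_derive_lnE t0).
  have c4 := is_derive1_continuous (is_derive_lnEx x0 t0).
  have c5 := is_derive1_continuous (is_derive1_ln t0).
  have c6 := is_derive1_continuous (is_derive_Ey 1 t).
  have c7 := continuous_dlnE t0.
  have c8 := continuous_dlnEx x0 t0.
  have c9 := continuous_inv t0.
  have cc (c : R) : {for t, continuous (fun=> c : R)} by exact: cvg_cst.
  have cF' := cvgB (cvgD (cvgM c7 (cvgB c4 c3)) (cvgM c3 (cvgB (cvgM (cc x) c8) c7)))
    (cvgM (cc (ln x)) (cvgD (cvgM c9 c6) (cvgM c5 (cvgM (cc (-1)) c6)))).
  have cF'' : {for t, continuous F'} by exact: cF'.
  have cpF : {for t, continuous (fun t => pw t * F' t)} by exact: (cvgM c1 cF'').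
  have cwp : {for t, continuous (fun t => w / t * pw t * F t)}.
    exact: (cvgM (cvgM (cvgM (cc w) c9) c1) c2).
  exact: (cvgD cwp cpF).
have a1 := admW s2 (adm_KlnE x0).
have a2 := admW s2 (adm_xKlnE x0).
have a3 := admW s2 (adm_KlnE (ltr01 : 0 < 1 :> R)).
have a4 := admW s2 (adm_lnE x0).
have a5 := admW s2 adm_lnE1.
have a6 := adm_lnmul s2 (adm_Ey (ltr01 : 0 < 1 :> R)).
have a7 := adm_lnmul s2 (adm_D1tf x0).
have a8 := admW s2 (adm_D1tf x0).
have a9 := admW s2 (adm_DLf x0).
have b1 := admB (admD a1 a2) (admZ 2 a3).
have b2 := admD a4 (admZ (x - 2) a5).
have b3' := admD (admZ w a7) a8.
have b3 := admD (admZ (ln x) a6) b3'.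
have b4 := admZ w a9.
have b12 := admB b1 b2.
have b123 := admD b12 b3.
rewrite -(MelZ 2 nws a3) -(MelD nws a1 a2) -(MelB nws (admD a1 a2) (admZ 2 a3)).
rewrite -(MelZ (x - 2) nws a5) -(MelD nws a4 (admZ (x - 2) a5)) -(MelB nws b1 b2).
rewrite -(MelZ (ln x) nws a6) -(MelZ w nws a7) -(MelD nws (admZ w a7) a8).
rewrite -(MelD nws (admZ (ln x) a6) b3') -(MelD nws b12 b3).
rewrite -(MelZ w nws a9) -(MelD nws b123 b4).
set Q := (X in Mel X w).
(* The two 1/t in x dlnE(x t) - dlnE(t) cancel, and since A = [Lf t + ln t], the part F / t becomes
   [DLf] plus [ln t] times [D1tf]. *)
have gE t : 0 < t -> expR (w * ln t) * Q t = g t.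
  move=> t0; rewrite /g /Q /F /F' /pw -/(expR _); move: (expR (w * ln t)) => p.
  have xt := mulr_gt0 x0 t0.
  rewrite /KlnE /xKlnE /D1tf /D1f /DLf DfE// (dlnEK t0) (dlnEK xt) mul1r.
  have L := LfE t0; move: (Lf t) L => l ->.
  move: (Kf t) (Kf (x * t)) (lnE (x * t)) (ln t) (ln x) (Ey 1 t) => k k' b lt lx e.
  by field; rewrite !gt_eqF.
rewrite /Mel (I0_eq gE).
have ig : itg g by apply: itg_eq gE (Mel_itg nws (admD b123 b4)).
have sw : 0 < s - w by rewrite subr_gt0.
apply: (FTC_adm sw dG cg ig).
have := adm_powR w (admD a9 a7); rewrite (gtr0_norm w0).
apply: adm_eq => t t0; rewrite /G /F /pw /DLf /D1tf /D1f DfE// (LfE t0).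
by ring.
Qed.

End MainIdentity.

(** * Coefficients of 1/Gamma and of normalised transforms *)

Section Coefficients.
Variable R : realType.
Local Notation C := (Cplx R).
Local Notation Re := (@complex.Re R).
Implicit Types (y t s : R) (w : R[i]).

Definition gam (k : nat) : R[i] := derive1n k (@cGamma R) 1 / k`!%:R.

(* The Taylor coefficients of 1 / Gamma at 1: the recursion defining [acoef]
   is the one inverting the power series of Gamma. *)
Definition invgam (k : nat) : R[i] := acoef R k.+1 0 / k`!%:R.

Lemma factC_neq0 n : n`!%:R != 0 :> R[i].
Proof. by rewrite pnatr_eq0 -lt0n fact_gt0. Qed.

Lemma gam0 : gam 0 = 1.
Proof. by rewrite /gam /= cGamma1 divr1. Qed.

(** Dividing by factorials absorbs the binomials, and the recursion becomes a convolution with the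
    Taylor coefficients of Gamma at 1. *)
Lemma acoef_norm_rec n m : (m < n)%N ->
  acoef R n.+1 m / n`!%:R = - \sum_(r < n) gam (n - r) * (acoef R r.+1 m / r`!%:R).
Proof.
move=> mn; rewrite acoef_rec// big_mkord mulNr mulr_suml; congr (- _).
apply: eq_bigr => r _; rewrite subSn ?(ltnW (ltn_ord r))// subn1 /= /gam.
have := bin_fact (ltnW (ltn_ord r)) => /(congr1 (fun n => n%:R : R[i])).
rewrite !natrM => E.
have n0 := factC_neq0 n; have r0 := factC_neq0 r; have nr0 := factC_neq0 (n - r).
have -> : 'C(n, r)%:R = n`!%:R / (r`!%:R * (n - r)`!%:R) :> R[i].
  by apply: (mulIf (mulf_neq0 r0 nr0)); rewrite E divfK// mulf_neq0.
by field; rewrite ?n0 ?r0 ?nr0.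
Qed.

(** Every column of the array obeys the same recursion from its diagonal entry 1 on, the earlier
    entries being 0; so column [m] is column 0 shifted, up to factorials. *)
Lemma acoef_invgam d m : acoef R (m + d).+1 m / (m + d)`!%:R = invgam d / m`!%:R.
Proof.
elim/ltn_ind: d => -[|d] IH.
  by rewrite addn0 acoef_diag// /invgam acoef_diag// fact0 divr1.
rewrite acoef_norm_rec ?addnS ?ltnS ?leq_addr// -addnS.
rewrite /invgam acoef_norm_rec// mulNr mulr_suml; congr (- _).
rewrite big_split_ord/= big1 ?add0r => [|i _]; last first.
  by rewrite acoef_out ?ltn_ord// mul0r mulr0.
apply: eq_bigr => i _; rewrite subnDl IH//.
by rewrite /invgam mulrA.
Qed.

Lemma acoefE n m : (m <= n)%N -> acoef R n.+1 m = n`!%:R * invgam (n - m) / m`!%:R.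
Proof.
move=> mn; have := acoef_invgam (n - m) m; rewrite subnKC// => E.
by rewrite -[LHS](divfK (factC_neq0 n)) E mulrC mulrA.
Qed.

Lemma conv_gam_invgam : conv gam invgam =1 seq1 R[i].
Proof.
case=> [|d].
  by rewrite /conv big_ord1 gam0 mul1r /invgam acoef_diag// fact0 divr1.
rewrite /seq1/= convC /conv big_ord_recr/= subnn gam0 mulr1.
rewrite {2}/invgam acoef_norm_rec//; apply/eqP; rewrite subr_eq0; apply/eqP.
by apply: eq_bigr => i _; rewrite mulrC.
Qed.

Lemma csmooth_cGamma : csmooth 1 (@cGamma R).
Proof.
have [H _] := cMel_csmooth 1 (half_gt0 R) (adm_Ey (ltr01 : 0 < 1 :> R)).
rewrite (_ : @cGamma R = (fun z => cMel (Ey 1) (z - 1)))//.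
by apply/funext => z; rewrite cGammaE.
Qed.

Lemma asym_cGamma : @asym R[i] (fun w => cGamma (1 + w)) gam.
Proof. exact: (csmooth_asym csmooth_cGamma). Qed.

Lemma asym_invGamma : @asym R[i] (fun w => (cGamma (1 + w))^-1) invgam.
Proof.
by apply: (asymV asym_cGamma _ conv_gam_invgam); rewrite gam0 oner_neq0.
Qed.

Lemma cGamma_near_neq0 : near0 (fun w : R[i] => cGamma (1 + w) != 0).
Proof.
have := asym_near0_neq0 asym_cGamma; rewrite gam0 oner_neq0 normr1 => /(_ isT).
apply: near0W => w w0 h; rewrite -normr_gt0; apply: lt_le_trans h.
by rewrite divr_gt0.
Qed.

(* The Taylor coefficients at [w = 0] of [Mel phi w / Gamma (1 + w)]. *)
Definition Tcoef (phi : R -> R) : nat -> R[i] := conv invgam (mom phi).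

Lemma asym_Tcoef s phi : 0 < s -> adm s phi ->
  @asym R[i] (fun w => (cGamma (1 + w))^-1 * cMel phi w) (Tcoef phi).
Proof. by move=> s0 aphi; apply: asymM; [exact: asym_invGamma|exact: cMel_asym aphi]. Qed.

Definition expseq (a : R) (k : nat) : R[i] := a%:C ^+ k / k`!%:R.

Lemma asym_exp (a : R) : @asym R[i] (fun w => cexp (a%:C * w)) (expseq a).
Proof.
move=> N; exists (`|a| ^+ N * expR `|a|)%:C.
  by rewrite ler0c mulr_ge0 ?exprn_ge0 ?expR_ge0.
exists 1; first by rewrite ltr01.
move=> w /posC[r r0 ->]; rewrite ltcR => r1.
have dG (k : nat) (s : R) : is_derive s 1 (fun s => a ^+ k * expR (a * s)) (a ^+ k.+1 * expR (a * s)).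
  have d1 := is_derive_expR_comp (is_derive_lin a s).
  have := @is_deriveZ _ _ _ _ (a ^+ k) s 1 _ d1.
  by move=> h; apply: is_derive_eq h _; rewrite [_ *: _]mulrA exprSr.
have := @taylor_bound _ N (fun k s => a ^+ k * expR (a * s)) 1 (`|a| ^+ N * expR `|a|)
  (fun k s _ _ => dG k s) _ r.
rewrite (ltW r0) (ltW r1) => /(_ _ isT) H.
rewrite -realCM cexp_real (_ : \sum_(i < N) _ =
   (\sum_(k < N) a ^+ k * expR (a * 0) * (r ^+ k / k`!%:R))%:C).
  rewrite -realCB -realCX -realCM normC_real lecR.
  have := H; rewrite expr0 mul1r; apply=> s /andP[s0 s1].
  rewrite normrM normrX (ger0_norm (expR_ge0 _)) ler_wpM2l ?exprn_ge0// ler_expR.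
  by rewrite (le_trans (ler_norm _))// normrM (ger0_norm s0) ler_piMr.
rewrite realC_sum; apply: eq_bigr => i _.
by rewrite mulr0 expR0 mulr1 !realCM realCV -natrC !realCX /expseq mulrA mulrAC.
Qed.

Lemma cpowNE y w : cpow y (- w) = cexp ((- ln y)%:C * w).
Proof. by rewrite /cpow mulrN realCN mulNr. Qed.

Lemma near0_real (P : R -> Prop) (d : R) : 0 < d ->
  (forall r, 0 < r -> r < d -> P r) -> near0 (fun w : R[i] => P (Re w)).
Proof.
move=> d0 H; exists d%:C; first by rewrite ltcR.
by move=> w /posC[r r0 ->]; rewrite ltcR => rd; exact: H.
Qed.

Lemma near0_realC (P : R[i] -> Prop) (d : R) : 0 < d ->
  (forall r : R, 0 < r -> r < d -> P r%:C) -> near0 P.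
Proof.
move=> d0 H; exists d%:C; first by rewrite ltcR.
by move=> w /posC[r r0 ->]; rewrite ltcR => rd; exact: H.
Qed.

Lemma Tcoef_Ey y : 0 < y -> Tcoef (Ey y) =1 (fun k => y^-1%:C * expseq (- ln y) k).
Proof.
move=> y0; apply: (asym_uniq (asym_Tcoef (half_gt0 R) (adm_Ey y0))).
apply: asym_eq (asymZ y^-1%:C (asym_exp (- ln y))).
have h : near0 (fun w : R[i] => `|Re w| < 2^-1).
  by apply: (near0_real (P := fun r => `|r| < 2^-1) (half_gt0 R)) => r r0 r2; rewrite gtr0_norm.
apply: near0W (near0_and h cGamma_near_neq0) => w w0 [h1 h2].
by rewrite cMel_Ey// cpowNE mulrCA mulVf// mulr1.
Qed.

(** The integrals of e^(-yt) / t and e^-t / t exist separately for w > 0 only. Multiplying by [w]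
    turns Gamma(w) into Gamma(1 + w), whence the shift from [k] to [k.+1]. *)
Lemma Tcoef_dEy y k : 0 < y -> Tcoef (dEy y) k = expseq (- ln y) k.+1.
Proof.
move=> y0.
have H1 := asym_shift (asym_Tcoef (half_gt0 R) (adm_dEy y0)).
have H2 := asymB (asym_exp (- ln y)) (@asym1 R[i]).
suff H : @asym R[i] (fun w => w * ((cGamma (1 + w))^-1 * cMel (dEy y) w))
    (fun k => expseq (- ln y) k - seq1 R[i] k).
  by have := asym_uniq H1 H k.+1; rewrite /= /seq1 /= subr0.
apply: asym_eq H2.
have h : near0 (fun w : R[i] => w * cMel (dEy y) w = cGamma (1 + w) * (cexp ((- ln y)%:C * w) - 1)).
  apply: (near0_realC (half_gt0 R)) => r r0 r2.
  rewrite cMel_real cGamma1D cMel_real -[(- ln y)%:C * _]realCM cexp_real.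
  rewrite -(realCB _ 1) -!realCM; congr (_%:C).
  rewrite -/(G1 r) -(G0G1 r0 r2) -mulrA; congr (_ * _).
  have i1 := itg_powV_Ey r0 (ltW r2) y0.
  have i2 := itg_powV_Ey r0 (ltW r2) (ltr01 : 0 < 1 :> R).
  rewrite mulrBr mulr1 mulNr -mulrN mulrC [ln y * - r]mulrC -(I0_powV_Ey r0 r2 y0) /G0 -I0B//.
  by apply: I0_eq => t _; rewrite /dEy; ring.
apply: near0W (near0_and h cGamma_near_neq0) => w w0 [h1 h2].
by rewrite mulrCA h1 mulKf.
Qed.

(** At q = r/2 the terms of the convergent series are bounded, say by M, so for s < q/2 the tail
    from N on is at most 2 M (s/q)^N by comparison with a geometric series. *)
Lemma asym_power_series (u : nat -> C) (f : C -> C) :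
  power_series_near1 u f -> @asym R[i] (fun w => f (1 + w)) u.
Proof.
move=> [e /posC[r r0 ->] H].
have H' (q : R) : 0 < q -> q < r -> series (fun k => u k * q%:C ^+ k) @ \oo --> f (1 + q%:C).
  move=> q0 qr.
  have h1 : ball_ [eta Num.Def.normr] (1 : C) r%:C (1 + q%:C).
    by rewrite /ball_/= opprD addrA subrr sub0r normrN normC_real ltcR gtr0_norm.
  have h2 : (1 + q%:C : C) != 1.
    by rewrite -subr_eq0 addrAC subrr add0r; apply: contra_neq (lt0r_neq0 q0) => -[].
  have := H _ h1 h2; rewrite addrAC subrr add0r.
  exact.
pose q := r / 2; have q0 : 0 < q by rewrite divr_gt0.
have qr : q < r by rewrite /q ltr_pdivrMr// ltr_pMr// ltr1n.
have [M [M0 HM]] : exists M : R, 0 <= M /\ forall k, `|u k * q%:C ^+ k| <= M%:C.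
  have c0 : u k * q%:C ^+ k @[k --> \oo] --> (0 : C).
    have hs := H' q q0 qr.
    have hs' := hs; rewrite -cvg_shiftS in hs'.
    rewrite (_ : (fun k => _) = (fun n => series (fun k => u k * q%:C ^+ k) n.+1 -
        series (fun k => u k * q%:C ^+ k) n)).
      by rewrite -[X in _ --> X](subrr (f (1 + q%:C))); exact: (cvgB hs' hs).
    by apply/funext => n; rewrite seriesSr addrAC subrr add0r.
  have [N _ HN] : \forall k \near \oo, `|u k * q%:C ^+ k| <= 1.
    by move/cvgr0Pnorm_le : c0; apply; exact: ltr01.
  exists (1 + \sum_(k < N) Re `|u k * q%:C ^+ k|); split.
    rewrite addr_ge0// sumr_ge0// => i _; rewrite -ler0c; apply: le_trans (normr_ge0 (u i * q%:C ^+ i)) _.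
    by rewrite normc_def.
  move=> k; have [kN|kN] := ltnP k N; last first.
    apply: (le_trans (HN k kN)); rewrite realCD lerDl ler0c sumr_ge0// => i _.
    rewrite -ler0c; apply: le_trans (normr_ge0 (u i * q%:C ^+ i)) _.
    by rewrite normc_def.
  rewrite (bigD1 (Ordinal kN))//= realCD realCD addrCA.
  rewrite (_ : (Re `|u k * q%:C ^+ k|)%:C = `|u k * q%:C ^+ k|); last by rewrite normc_def.
  rewrite lerDl -realCD ler0c addr_ge0// sumr_ge0// => i _.
  by rewrite -ler0c; apply: le_trans (normr_ge0 (u i * q%:C ^+ i)) _; exact: lexx.
(* The summand 1 accounts for replacing [f] by a partial sum within [s ^+ N] of it. *)
move=> N; exists (2 * M / q ^+ N + 1)%:C.
  by rewrite ler0c addr_ge0// mulr_ge0 ?mulr_ge0// invr_ge0 exprn_ge0// ltW.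
exists (q / 2)%:C; first by rewrite ltcR divr_gt0.
move=> w /posC[s s0 ->]; rewrite ltcR => sq.
have sr : s < r by apply: lt_trans qr; apply: lt_trans sq _; rewrite ltr_pdivrMr// ltr_pMr// ltr1n.
have := H' s s0 sr.
have bnd n : (N <= n)%N -> `|series (fun k => u k * s%:C ^+ k) n - \sum_(i < N) u i * s%:C ^+ i|
    <= (2 * M / q ^+ N * s ^+ N)%:C.
  move=> Nn; rewrite /series/= -(big_mkord xpredT (fun i => u i * s%:C ^+ i)).
  rewrite (big_cat_nat _ _ (n := N))//= addrAC subrr add0r.
  apply: (le_trans (ler_norm_sum _ _ _)).
  have tb k : `|u k * s%:C ^+ k| <= (M * (s / q) ^+ k)%:C.
    have -> : u k * s%:C ^+ k = u k * q%:C ^+ k * (s / q)%:C ^+ k.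
      rewrite -mulrA -exprMn -realCM; congr (_ * (_%:C) ^+ _).
      by rewrite mulrCA mulfV ?mulr1// gt_eqF.
    have zq : 0 <= (s / q) ^+ k by apply: exprn_ge0; apply: divr_ge0; exact: ltW.
    rewrite normrM (realCM M) -[(s / q)%:C ^+ k]realCX normC_real (ger0_norm zq).
    by rewrite ler_wpM2r// ler0c.
  apply: (@le_trans _ _ (\sum_(N <= k < n) M * (s / q) ^+ k)%:C).
    by rewrite realC_sum; apply: ler_sum => k _; exact: tb.
  rewrite lecR -mulr_sumr.
  have g : \sum_(N <= k < n) (s / q) ^+ k <= 2 * (s / q) ^+ N.
    have z0 : 0 <= s / q by apply: divr_ge0; exact: ltW.
    have z1 : s / q <= 2^-1 by rewrite ler_pdivrMr// mulrC ltW.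
    move: (s / q) z0 z1 => z z0 z1.
    have : \sum_(N <= k < n) z ^+ k * (1 - z) = z ^+ N - z ^+ n.
      rewrite (eq_bigr (fun k => - (z ^+ k.+1 - z ^+ k))); last by move=> i _; rewrite exprS; ring.
      by rewrite sumrN telescope_sumr// opprB.
    rewrite -mulr_suml => E.
    have zn : 0 <= z ^+ n by rewrite exprn_ge0.
    have S0 : 0 <= \sum_(N <= k < n) z ^+ k by apply: sumr_ge0 => i _; rewrite exprn_ge0.
    move: (\sum_(_ <= k < _) _) (z ^+ N) (z ^+ n) zn S0 E => S a b b0 S0 E.
    have h : 0 <= S * (2^-1 - z) by rewrite mulr_ge0// subr_ge0.
    by move: E h; rewrite !mulrBr mulr1; lra.
  apply: (le_trans (ler_wpM2l M0 g)); rewrite exprMn exprVn.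
  by rewrite le_eqVlt; apply/orP; left; apply/eqP; ring.
move=> /cvgrPdist_le/(_ (s ^+ N)%:C); rewrite ltcR exprn_gt0// => /(_ isT)[m _ hm].
have hn := hm (maxn m N) (leq_maxl _ _).
rewrite -realCX -realCM mulrDl mul1r realCD.
rewrite (_ : _ - _ = (series (fun k => u k * s%:C ^+ k) (maxn m N) - \sum_(i < N) u i * s%:C ^+ i) +
  (f (1 + s%:C) - series (fun k => u k * s%:C ^+ k) (maxn m N))); last by ring.
by rewrite (le_trans (ler_normD _ _))// lerD// bnd// leq_maxr.
Qed.

End Coefficients.

(** * Generalised digamma and Ishibashi functions as Taylor coefficients *)

Section Digamma.
Variable R : realType.
Local Notation C := (Cplx R).
Implicit Types (x t : R) (phi psi : R -> R).
Variable zeta : C -> C.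
Hypothesis hzeta : is_riemann_zeta zeta.
Variable gamma : nat -> C.
Hypothesis hgamma : is_stieltjes zeta gamma.

(** By [Mel_KEy1], division by Gamma(1 + w) leaves zeta(1 + w) - 1/w, whose expansion defines the
    Stieltjes constants. *)
Lemma Tcoef_KEy1 k : Tcoef (fun t : R => Kf t * Ey 1 t) k = (-1) ^+ k * gamma k / k`!%:R.
Proof.
have H1 := asym_Tcoef (half_gt0 R) (adm_KEy (ltr01 : 0 < 1 :> R)).
have H2 := asym_power_series hgamma.
suff H : @asym R[i] (fun w => (cGamma (1 + w))^-1 * cMel (fun t => Kf t * Ey 1 t) w)
    (fun k => (-1) ^+ k * gamma k / k`!%:R) by exact: (asym_uniq H1 H).
apply: asym_eq H2.
have h : near0 (fun w : R[i] => cMel (fun t => Kf t * Ey 1 t) w = cGamma (1 + w) * (zeta (1 + w) - w^-1)).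
  apply: (near0_realC (half_gt0 R)) => r r0 r2.
  by rewrite cMel_real cGamma1D cMel_real (Mel_KEy1 hzeta r0 r2).
apply: near0W (near0_and h (@cGamma_near_neq0 R)) => w w0 [-> g0].
by rewrite mulKf// addrAC subrr add0r.
Qed.

Lemma mom_eq phi psi : (forall t, 0 < t -> phi t = psi t) -> mom phi =1 mom psi.
Proof. by move=> E k; congr ((_ / _)%:C); apply: I0_eq => t t0; rewrite E. Qed.

Lemma Tcoef_eq phi psi : (forall t, 0 < t -> phi t = psi t) -> Tcoef phi =1 Tcoef psi.
Proof. by move=> /mom_eq E; exact: eq_conv. Qed.

Lemma adm_lnX_itg s phi k : 0 < s -> adm s phi -> itg (fun t => ln t ^+ k * phi t).
Proof.
move=> s0 aphi; have s2 : s / 2 < s by rewrite ltr_pdivrMr// ltr_pMr// ltr1n.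
by apply: (adm_itg _ (adm_lnX k s2 aphi)); rewrite divr_gt0.
Qed.

Lemma mom_lin s phi psi (c : R) k : 0 < s -> adm s phi -> adm s psi ->
  mom (fun t => phi t + c * psi t) k = mom phi k + c%:C * mom psi k.
Proof.
move=> s0 a1 a2; rewrite /mom -realCM -realCD; congr (_%:C).
have i1 := adm_lnX_itg k s0 a1; have i2 := adm_lnX_itg k s0 a2.
rewrite (_ : I0 _ = I0 (fun t => ln t ^+ k * phi t) + c * I0 (fun t => ln t ^+ k * psi t)).
  by rewrite mulrDl mulrA.
rewrite -I0Z// -I0D//; last exact: itgZ.
by apply: I0_eq => t _; ring.
Qed.

Lemma Tcoef_lin s phi psi (c : R) k : 0 < s -> adm s phi -> adm s psi ->
  Tcoef (fun t => phi t + c * psi t) k = Tcoef phi k + c%:C * Tcoef psi k.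
Proof.
move=> s0 a1 a2; rewrite /Tcoef -convZr -convDr; apply: eq_conv => // j.
by rewrite (mom_lin _ _ s0 a1 a2).
Qed.

Lemma TcoefZ s phi (c : R) k : 0 < s -> adm s phi ->
  Tcoef (fun t => c * phi t) k = c%:C * Tcoef phi k.
Proof.
move=> s0 a1; rewrite /Tcoef -convZr; apply: eq_conv => // j.
rewrite /mom -realCM; congr (_%:C); rewrite mulrA -(I0Z _ (adm_lnX_itg j s0 a1)).
by congr (_ / _); apply: I0_eq => t _; rewrite mulrCA.
Qed.

Lemma cvg_sum_ord k (u : nat -> nat -> C) (l : nat -> C) :
  (forall i, u i n @[n --> \oo] --> l i) ->
  \sum_(i < k) u i n @[n --> \oo] --> \sum_(i < k) l i.
Proof.
move=> ul; elim: k => [|k IH].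
  rewrite big_ord0 (_ : (fun n => _) = (fun=> 0)); first exact: cvg_cst.
  by apply/funext => n; rewrite big_ord0.
rewrite big_ord_recr/= (_ : (fun n => _) = (fun n => \sum_(i < k) u i n + u k n)).
  exact: (cvgD IH (ul k)).
by apply/funext => n; rewrite big_ord_recr.
Qed.

Lemma cvg_series_conv (g : nat -> C) (u : nat -> nat -> C) (v : nat -> C) k :
  (forall j, series (fun n => u n j) @ \oo --> v j) ->
  series (fun n => conv g (u n) k : C) @ \oo --> (conv g v k : C).
Proof.
move=> uv.
rewrite (_ : series _ = (fun n => \sum_(i < k.+1) g i * series (fun n => u n (k - i)%N) n)).
  apply: (@cvg_sum_ord k.+1 (fun i n => g i * series (fun n => u n (k - i)%N) n)
    (fun i => g i * v (k - i)%N)) => i.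
  by apply: cvgM; [exact: cvg_cst|exact: uv].
apply/funext => n; rewrite /series/= /conv exchange_big/=.
by apply: eq_bigr => i _; rewrite mulr_sumr.
Qed.

Lemma Tcoef_series s (psi : R -> R) (q : nat -> R -> R) (Q : R -> R) k : 0 < s ->
  mfp psi -> (forall n, mfp (q n)) -> (forall n t, 0 < t -> 0 <= q n t) ->
  (forall t, 0 < t -> series (fun n => q n t) @ \oo --> Q t) ->
  adm s (fun t => psi t * Q t) ->
  series (fun n => Tcoef (fun t => psi t * q n t) k : C) @ \oo -->
    (Tcoef (fun t => psi t * Q t) k : C).
Proof.
move=> s0 mpsi mq q0 qQ aQ; apply: cvg_series_conv => j.
have E t : 0 < t -> ln t ^+ j * (psi t * Q t) = (ln t ^+ j * psi t) * Q t by rewrite mulrA.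
have mp : mfp (fun t => ln t ^+ j * psi t).
  by apply: mfpM => //; apply: mfpX; exact: mfp_ln.
have [_ H] := I0_series mp mq q0 qQ (itg_eq E (adm_lnX_itg j s0 aQ)).
have := cvg_seriesMl (c := (j`!%:R^-1)%:C) (cvg_series_realC H).
rewrite (_ : _ * (I0 _)%:C = mom (fun t => psi t * Q t) j).
  rewrite (_ : (fun n => _) = (fun n => mom (fun t => psi t * q n t) j))//.
  apply/funext => n; rewrite -realCM /mom mulrC; congr (_%:C); congr (_ / _).
  by apply: I0_eq => t _; rewrite mulrA.
by rewrite -realCM /mom mulrC; congr (_%:C); congr (_ / _); rewrite (I0_eq E).
Qed.

(** For k = 0 this is Binet's formula: psi(y) is ln y minus the integral of K(t) e^(-yt). Each
    log^k(z)/z is (-1)^k k! times a coefficient attached to e^(-zt), and the sum over n yields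
    (e^(-yt) - 1) / (e^t - 1) = K e^(-yt) - K e^-t + (e^(-yt) - e^-t) / t - e^(-yt). The second and
    fourth terms cancel the Stieltjes constant and log^k(y)/y; the third gives log^(k+1)(y) / (k +
    1). *)
Lemma gen_digammaE k y : 0 < y ->
  gen_digamma gamma k y%:C = (ln y)%:C ^+ k.+1 / k.+1%:R
    - (-1) ^+ k * k`!%:R * Tcoef (fun t => Kf t * Ey y t) k.
Proof.
move=> y0.
have y1 : 0 < 1 :> R by [].
have sg : (-1) ^+ k * (-1) ^+ k = 1 :> R[i] by rewrite -exprMn mulrNN mul1r expr1n.
have kf := factC_neq0 R k.
have kf1 : k.+1%:R != 0 :> R[i] by rewrite pnatr_eq0.
have TE z : 0 < z -> (clog (z%:C : C)) ^+ k / z%:C = (-1) ^+ k * k`!%:R * Tcoef (Ey z) k.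
  move=> z0; rewrite clog_real// Tcoef_Ey// /expseq realCN realCV (exprNn (ln z)%:C).
  transitivity (((-1) ^+ k * (-1) ^+ k) * ((ln z)%:C ^+ k / z%:C) : R[i]); first by rewrite sg mul1r.
  have z0' : z%:C != 0 :> R[i] by apply: contra_neq (lt0r_neq0 z0) => -[].
  move: ((-1) ^+ k) ((ln z)%:C ^+ k) => e l.
  by field; rewrite z0' kf.
pose psi t := Ey y t - 1.
pose Q t := Ey 1 t / (1 - expR (- t)).
have mpsi : mfp psi by apply: mfpB; [exact: mfp_Ey|exact: mfp_cst].
have aK := adm_KEy y0; have aK1 := adm_KEy y1.
have ad := adm_dEy y0; have aE := adm_Ey y0.
have QE t : 0 < t -> (Kf t * Ey y t + - 1 * (Kf t * Ey 1 t)) + 1 * (dEy y t + -1 * Ey y t) = psi t * Q t.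
  move=> t0; rewrite /psi /Q /dEy (KEyE _ t0).
  have E1 : Kf t * Ey 1 t = Kf t + t^-1 - 1 - Ey 1 t / t.
    rewrite /Kf (_ : Ey 1 t = expR (- t)); last by rewrite /Ey mul1r.
    have := one_sub_expN_gt0 t0; move: (expR (- t)) => e e1; field.
    by rewrite !gt_eqF.
  by rewrite E1; ring.
have aq1 := admD aK (admZ (-1) aK1); have aq2 := admD ad (admZ (-1) aE).
have aQ : adm 2^-1 (fun t => psi t * Q t) by apply: adm_eq QE (admD aq1 (admZ 1 aq2)).
have H := Tcoef_series (k := k) (half_gt0 R) mpsi (fun n => mfp_Ey n.+1%:R)
  (fun n t _ => expR_ge0 _) (@geo_series R) aQ.
have TQ : Tcoef (fun t => psi t * Q t) k = Tcoef (fun t => Kf t * Ey y t) k -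
    Tcoef (fun t : R => Kf t * Ey 1 t) k + (Tcoef (dEy y) k - Tcoef (Ey y) k).
  rewrite -(Tcoef_eq QE) (Tcoef_lin 1 k (half_gt0 R) aq1 aq2).
  rewrite (Tcoef_lin (-1) k (half_gt0 R) aK aK1) (Tcoef_lin (-1) k (half_gt0 R) ad aE).
  by rewrite !realCN !mulN1r mul1r.
have uE : (fun m => let n : C := m.+1%:R in clog (n + y%:C) ^+ k / (n + y%:C) - clog n ^+ k / n) =
    (fun n => (-1) ^+ k * k`!%:R * Tcoef (fun t => psi t * Ey n.+1%:R t) k).
  apply/funext => n /=.
  have n0 : 0 < n.+1%:R :> R by [].
  have ny0 : 0 < n.+1%:R + y by rewrite addr_gt0.
  rewrite natrC -realCD (TE _ n0) (TE _ ny0) -mulrBr; congr (_ * _).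
  rewrite -[X in X - _]addr0 -(mulN1r (Tcoef (Ey n.+1%:R) k)) addr0.
  rewrite -(realCN 1) -(Tcoef_lin (-1) k (half_gt0 R) (adm_Ey ny0) (adm_Ey n0)).
  apply: Tcoef_eq => t _; rewrite /psi mulN1r mulrBl mul1r; congr (_ - _).
  by rewrite /Ey -expRD; congr expR; ring.
rewrite /gen_digamma uE.
have HL : limn (series (fun n => (-1) ^+ k * k`!%:R * Tcoef (fun t => psi t * Ey n.+1%:R t) k : C)) =
    (-1) ^+ k * k`!%:R * Tcoef (fun t => psi t * Q t) k.
  exact: (cvg_lim (@norm_hausdorff _ C) (cvg_seriesMl (c := (-1) ^+ k * k`!%:R) H)).
rewrite HL TQ Tcoef_KEy1 Tcoef_dEy// TE//.
have -> : expseq (- ln y) k.+1 = - ((-1) ^+ k * (ln y)%:C ^+ k.+1 / (k.+1%:R * k`!%:R)).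
  by rewrite /expseq realCN (exprNn (ln y)%:C) [in LHS]exprS factS natrM mulN1r !mulNr.
move: sg kf kf1; move: (Tcoef (Ey y) k) (Tcoef (fun t => Kf t * Ey y t) k) => a b.
move: (gamma k : R[i]) ((ln y)%:C ^+ k.+1) ((-1) ^+ k) k`!%:R k.+1%:R => g l e f f1 sg kf kf1.
(* [e] is the sign (-1)^k; its square is kept as a factor until [sg] replaces it by 1. *)
transitivity (- g - e * f * a - e * f * (b - a) + (e * e) * (g + l / f1) : R[i]).
  by field; rewrite kf kf1.
by rewrite sg mul1r; ring.
Qed.

(** The logarithm subtracted in the definition is exactly the leading term of [gen_digammaE]. What
    remains are the kernels K(t) e^(-nxt) / n, and summing over n gives - K(t) ln(1 - e^(-xt)). *)
Lemma IshibashiE k x : 0 < x ->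
  Ishibashi gamma k.+1 x%:C = (-1) ^+ k * k.+1`!%:R * Tcoef (KlnE x) k.
Proof.
move=> x0; rewrite /Ishibashi.
have mq n : mfp (fun t => Ey (n.+1%:R * x) t / n.+1%:R).
  by apply: mfpM; [exact: mfp_Ey|exact: mfp_cst].
have q0 n t : 0 < t -> 0 <= Ey (n.+1%:R * x) t / n.+1%:R.
  by move=> _; rewrite divr_ge0// expR_ge0.
have E t : 0 < t -> -1 * KlnE x t = Kf t * - lnE (x * t).
  by move=> t0; rewrite /KlnE; ring.
have aQ : adm 2^-1 (fun t => Kf t * - lnE (x * t)).
  by apply: adm_eq E (admZ (-1) (adm_KlnE x0)).
have H := Tcoef_series (k := k) (half_gt0 R) (@mfp_Kf R) mq q0 (fun t => @lnE_series R x t x0) aQ.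
have {}H := cvg_seriesMl (c := - ((-1) ^+ k * k.+1`!%:R)) H.
transitivity (- ((-1) ^+ k * k.+1`!%:R) * Tcoef (fun t => Kf t * - lnE (x * t)) k : R[i]); last first.
  rewrite -(Tcoef_eq E) (TcoefZ (-1) k (half_gt0 R) (adm_KlnE x0)) realCN; ring.
apply: (cvg_lim (@norm_hausdorff _ C)); move: H.
rewrite (_ : (fun n => _ * _) = (fun m => let n : C := m.+1%:R in
  (k.+1%:R * gen_digamma gamma k.+1.-1 (n * x%:C) - clog (n * x%:C) ^+ k.+1) / n))//.
apply/funext => n /=.
have nx : 0 < n.+1%:R * x by rewrite mulr_gt0.
have n0 : n.+1%:R != 0 :> R[i] by rewrite pnatr_eq0.
have k0 : k.+1%:R != 0 :> R[i] by rewrite pnatr_eq0.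
rewrite -[X in Tcoef X](_ : (fun t => n.+1%:R^-1 * (Kf t * Ey (n.+1%:R * x) t)) = _); last first.
  by apply/funext => t; ring.
rewrite (TcoefZ _ k (half_gt0 R) (adm_KEy nx)) (natrC R n.+1) -realCM gen_digammaE// clog_real//.
rewrite realCV -(natrC R n.+1) factS natrM; field.
by rewrite ![1 + _]addrC !natr1 n0 k0.
Qed.

End Digamma.

(** * Zeta at 2, the functions L*, and the relation between coefficients *)

Section ZetaAndLstar.
Variable R : realType.
Local Notation C := (Cplx R).
Local Notation Re := (@complex.Re R).
Implicit Types (x t : R) (phi psi : R -> R).
Variable zeta : C -> C.
Hypothesis hzeta : is_riemann_zeta zeta.

(** Near 2, zeta(z) is the transform of - ln(1 - e^-t) at z - 2 divided by Gamma(z - 1), which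
    equals 1 at z = 2. *)
Lemma csmooth_zeta2 : csmooth 2 zeta.
Proof.
have [S1 _] := cMel_csmooth 2 (half_gt0 R) (adm_Ey (ltr01 : 0 < 1 :> R)).
have aL : adm 2^-1 (fun t : R => - lnE t) := admN (@adm_lnE1 R).
have [S2 _] := cMel_csmooth 2 (half_gt0 R) aL.
have g2 : cMel (Ey 1) (2 - 2 : C) = 1 by rewrite subrr (cMel_real _ 0) -/(G1 0) G1_0.
have g20 : cMel (Ey 1) (2 - 2 : C) != 0 by rewrite g2 oner_neq0.
have S3 := csmoothM S2 (@csmoothV R 2 (fun z => cMel (Ey 1) (z - 2)) g20 S1).
apply: csmooth_near S3.
have c1 := csmooth_continuous (k := 0) S1.
have n1 : nbhs (2 : C) [set z : C | cMel (Ey 1) (z - 2) != 0].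
  have /cvgrPdist_lt/(_ 1 ltr01) := c1; apply: filterS => z /=.
  rewrite g2 => h; apply/eqP => z0; move: h; rewrite z0 subr0 normr1.
  by rewrite ltxx.
have n2 : nbhs (2 : C) [set z : C | `|Re (z - 2)| < 2^-1].
  exists (2^-1)%:C; first by rewrite /= ltcR.
  move=> z /= h; rewrite -ltcR; apply: le_lt_trans (normC_ge_Re _) _.
  by rewrite distrC.
apply: filterS2 n1 n2 => z /= h1 h2.
rewrite (cMel_lnE hzeta h2) cGamma1D mulrAC mulfV// mul1r.
by rewrite addrCA subrr addr0.
Qed.

Lemma derive_zeta2 k : derive1n k zeta 2 = - (k`!%:R * Tcoef (@lnE R) k).
Proof.
have H1 := asym_Tcoef (half_gt0 R) (@adm_lnE1 R).
have H2 := csmooth_asym csmooth_zeta2.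
suff H : @asym R[i] (fun w => (cGamma (1 + w))^-1 * cMel (@lnE R) w)
    (fun k => - (derive1n k zeta 2 / k`!%:R)).
  by rewrite (asym_uniq H1 H k) mulrN opprK mulrC divfK// factC_neq0.
apply: asym_eq (asymN H2).
have h : near0 (fun w : R[i] => `|Re w| < 2^-1).
  by apply: (near0_real (P := fun r => `|r| < 2^-1) (half_gt0 R)) => r r0 r2; rewrite gtr0_norm.
apply: near0W (near0_and h (@cGamma_near_neq0 R)) => w w0 [h1 h2].
have E : cMel (@lnE R) w = - cMel (fun t => - lnE t) w.
  move: (w0) => /posC[r r0 wr]; rewrite wr in h1 *.
  rewrite !cMel_real -realCN; congr (_%:C).
  have -> : Mel (fun t : R => - lnE t) r = Mel (fun t => -1 * lnE t) r.
    by apply: Mel_eq => t _; rewrite mulN1r.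
  by rewrite (MelZ (-1) h1 (@adm_lnE1 R)) mulN1r opprK.
by rewrite E (cMel_lnE hzeta h1) mulrN mulKf.
Qed.

Lemma I_funE x (z : C) : I_fun x z = (cGamma z)^-1 * cMel (DLf x) (z - 1).
Proof.
congr (_ * _); apply: cintegral_eq => t t0.
have -> : z - 2 = (z - 1) + (-1)%:C by rewrite realCN; ring.
rewrite cpowD cpow_real -mulrA -realCM; congr (_ * _%:C).
rewrite (_ : expR (-1 * ln t) = t^-1); last by rewrite mulN1r expRN lnK ?posrE.
by rewrite /DLf mulrC.
Qed.

Lemma csmooth_I x : 0 < x -> csmooth 1 (I_fun x).
Proof.
move=> x0; have [S1 _] := cMel_csmooth 1 (half_gt0 R) (adm_DLf x0).
have g : cGamma (1 : C) != 0 by rewrite cGamma1 oner_neq0.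
rewrite (_ : I_fun x = (fun z => (cGamma z)^-1 * cMel (DLf x) (z - 1))).
  exact: (csmoothM (@csmoothV R 1 (@cGamma R) g (@csmooth_cGamma R)) S1).
by apply/funext => z; exact: I_funE.
Qed.

Lemma LstarE x (k : nat) : 0 < x -> Lstar x k = k`!%:R * Tcoef (DLf x) k.
Proof.
move=> x0; have S := csmooth_I x0.
have H1 := asym_Tcoef (half_gt0 R) (adm_DLf x0).
have H2 := csmooth_asym S.
have E : Tcoef (DLf x) k = derive1n k (I_fun x) 1 / k`!%:R.
  suff H : @asym R[i] (fun w => (cGamma (1 + w))^-1 * cMel (DLf x) w)
      (fun k => derive1n k (I_fun x) 1 / k`!%:R) by exact: (asym_uniq H1 H).
  apply: asym_eq H2; apply: near0T => w _.
  by rewrite I_funE addrAC subrr add0r.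
rewrite E mulrC divfK ?factC_neq0//=.
(* [Lstar] is a limit along punctured neighbourhoods; continuity of the k-th derivative at 1
   identifies it with the value there. *)
apply: (cvg_lim (@norm_hausdorff _ C)).
apply: cvg_trans (csmooth_continuous (k := k) S).
by apply: cvg_app; exact: cvg_within.
Qed.

Lemma Tcoef_xKlnE x : 0 < x -> Tcoef (xKlnE x) =1 conv (expseq (- ln x)) (Tcoef (KlnE x^-1)).
Proof.
move=> x0; have xi : 0 < x^-1 by rewrite invr_gt0.
have H1 := asym_Tcoef (half_gt0 R) (adm_xKlnE x0).
have H2 := asymM (asym_exp (- ln x)) (asym_Tcoef (half_gt0 R) (adm_KlnE xi)).
apply: (asym_uniq H1); apply: asym_eq H2.
apply: (near0_realC (half_gt0 R)) => r r0 r2; rewrite mulrCA; congr (_ * _).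
rewrite !cMel_real -realCM cexp_real -realCM; congr (_%:C).
have nr := half_norm r0 r2.
have E t : x * KlnE x^-1 (x * t) = xKlnE x t.
  by rewrite /KlnE /xKlnE (mulrA x^-1) mulVf ?gt_eqF// mul1r.
have ii : itg (fun t => expR (r * ln t) * KlnE x^-1 (x * t)).
  apply: itg_eq (itgZ x^-1 (Mel_itg nr (adm_xKlnE x0))) => t _.
  by rewrite -E mulrCA (mulrA x^-1) mulVf ?gt_eqF// mul1r.
rewrite (I0_pow_dilation x0 (adm_mfp (adm_KlnE xi)) ii).
have -> : Mel (fun t => KlnE x^-1 (x * t)) r = x^-1 * Mel (xKlnE x) r.
  rewrite -(MelZ _ nr (adm_xKlnE x0)); apply: Mel_eq => t _.
  by rewrite -E mulrA mulVf ?gt_eqF// mul1r.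
move: (Mel _ _) => M; rewrite mulNr.
rewrite (_ : _ * _ = (x * x^-1) * (expR (- (ln x * r)) * expR (r * ln x)) * M); last by ring.
by rewrite mulfV ?gt_eqF// -expRD mulrC [r * _]mulrC addNr expR0 !mulr1.
Qed.

Lemma Tcoef_lnEx x : 0 < x ->
  Tcoef (fun t => lnE (x * t)) =1 (fun k => x^-1%:C * conv (expseq (- ln x)) (Tcoef (@lnE R)) k).
Proof.
move=> x0.
have H1 := asym_Tcoef (half_gt0 R) (adm_lnE x0).
have H2 := asymZ x^-1%:C (asymM (asym_exp (- ln x)) (asym_Tcoef (half_gt0 R) (@adm_lnE1 R))).
apply: (asym_uniq H1); apply: asym_eq H2.
apply: (near0_realC (half_gt0 R)) => r r0 r2; rewrite !mulrA [in RHS]mulrC -mulrA mulrCA.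
rewrite [in RHS]mulrC; congr (_ * _).
rewrite !cMel_real -[(- ln x)%:C * _]realCM cexp_real -!realCM; congr (_%:C).
have nr := half_norm r0 r2.
have ii : itg (fun t => expR (r * ln t) * lnE (x * t)) := Mel_itg nr (adm_lnE x0).
rewrite (I0_pow_dilation x0 (adm_mfp (@adm_lnE1 R)) ii).
move: (Mel _ _) => M.
rewrite (_ : _ * _ = (x * x^-1) * (expR (- ln x * r) * expR (r * ln x)) * M); last by ring.
by rewrite mulfV ?gt_eqF// -expRD mulNr [r * _]mulrC addNr expR0 !mul1r.
Qed.

(* The Taylor coefficients at [w = 0] of
   [ln x * Gamma (1 + w) + w * Mel (D1tf x) w]. *)
Definition nseqx x (k : nat) : R[i] :=
  (ln x)%:C * mom (Ey 1) k + shift_seq (mom (D1tf x)) k.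

(** Let N(w) be the function expanded by [nseqx]. Differentiation in w inserts [ln t], so the
    bracket with [ln x] and [D1tf] in [Mellin_functional_equation] is N'(w); these are the
    coefficients of N'(w) / Gamma(1 + w). *)
Definition Scoef x : nat -> R[i] := conv (@invgam R) (fun j => j.+1%:R * nseqx x j.+1).

Lemma Scoef_asym x : 0 < x -> @asym R[i] (fun w => (cGamma (1 + w))^-1 *
  ((ln x)%:C * cMel (fun t => ln t * Ey 1 t) w +
   (w * cMel (fun t => ln t * D1tf x t) w + cMel (D1tf x) w))) (Scoef x).
Proof.
move=> x0; apply: asymM; first exact: asym_invGamma.
have q2 : 4^-1 < 2^-1 :> R by rewrite ltf_pV2 ?posrE// ltr_nat.
have q0 : 0 < 4^-1 :> R by [].
have b1 := cMel_asym q0 (adm_lnmul q2 (adm_Ey (ltr01 : 0 < 1 :> R))).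
have b2 := cMel_asym q0 (adm_lnmul q2 (adm_D1tf x0)).
have b3 := cMel_asym (half_gt0 R) (adm_D1tf x0).
apply: asym_eqr (asymD (asymZ (ln x)%:C b1) (asymD (asym_shift b2) b3)) => k.
rewrite /nseqx mulrDr mom_ln mulrCA; congr (_ + _).
case: k => [|k] /=; first by rewrite add0r mul1r.
by rewrite mom_ln -[k.+2%:R]natr1 mulrDl mul1r.
Qed.

(** The Mellin relation divided by Gamma(1 + w), compared with the expansion of the zero
    function. *)
Lemma functional_equation_coef x k : 0 < x ->
  Tcoef (KlnE x) k + conv (expseq (- ln x)) (Tcoef (KlnE x^-1)) k - 2 * Tcoef (KlnE (1 : R)) k
  - (x^-1%:C * conv (expseq (- ln x)) (Tcoef (@lnE R)) k + (x%:C - 2) * Tcoef (@lnE R) k)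
  + Scoef x k + shift_seq (Tcoef (DLf x)) k = 0.
Proof.
move=> x0.
rewrite -Tcoef_xKlnE// -Tcoef_lnEx//.
pose A phi (a : adm 2^-1 phi) := asym_Tcoef (half_gt0 R) a.
have H := asymD (asymD (asymB (asymB (asymD (A _ (adm_KlnE x0)) (A _ (adm_xKlnE x0)))
    (asymZ 2 (A _ (adm_KlnE (ltr01 : 0 < 1 :> R)))))
  (asymD (A _ (adm_lnE x0)) (asymZ (x%:C - 2) (A _ (@adm_lnE1 R)))))
  (Scoef_asym x0)) (asym_shift (A _ (adm_DLf x0))).
suff H0 : @asym R[i] (fun=> 0) (fun=> 0).
  apply: (asym_uniq (asym_eq _ H) H0); apply: (near0_realC (half_gt0 R)) => r r0 r2.
  have E := Mellin_functional_equation x0 r0 r2.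
  have E' : cMel (KlnE x) r%:C + cMel (xKlnE x) r%:C - 2 * cMel (KlnE 1) r%:C
      - (cMel (fun t => lnE (x * t)) r%:C + (x%:C - 2) * cMel (@lnE R) r%:C)
      + ((ln x)%:C * cMel (fun t => ln t * Ey 1 t) r%:C +
        (r%:C * cMel (fun t => ln t * D1tf x t) r%:C + cMel (D1tf x) r%:C))
      + r%:C * cMel (DLf x) r%:C = (0 : R)%:C.
    rewrite !cMel_real (natrC R 2) -[x%:C - 2%:C]realCB -!realCM -!realCD -!realCN -!realCD.
    by rewrite E.
  move: (cGamma (1 + r%:C))^-1 => g.
  move: E'; rewrite -[(0 : R)%:C]/(0 : R[i]).
  move: (ln x)%:C r%:C x%:C (cMel (KlnE x) _ : R[i]) (cMel (xKlnE x) _ : R[i]) (cMel (KlnE 1) _ : R[i])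
    (cMel (fun t => lnE (x * t)) _ : R[i]) (cMel (@lnE R) _ : R[i])
    (cMel (fun t => ln t * Ey 1 t) _ : R[i]) (cMel (fun t => ln t * D1tf x t) _ : R[i])
    (cMel (D1tf x) _ : R[i]) (cMel (DLf x) _ : R[i])
    => l q X a1 a2 a3 a4 a5 a6 a7 a8 a9 E'.
  transitivity (g * 0 : R[i]); last by rewrite mulr0.
  by rewrite -E'; ring.
by apply: asym_eqr (asym_eq _ (asymZ 0 (@asym1 R[i]))) => [j|]; [rewrite mul0r|
  apply: near0T => w _; rewrite mul0r].
Qed.

End ZetaAndLstar.

(** * The constants c_k and the explicit logarithmic polynomials *)

Section Constants.
Variable R : realType.
Local Notation C := (Cplx R).
Implicit Types (x t s : R).
Variable zeta : C -> C.
Hypothesis hzeta : is_riemann_zeta zeta.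
Variable c : nat -> C.
Hypothesis hc : is_Gamma_zeta_coef zeta c.

(** The function expanded by [nseqx] is - (x^-w - 1) Gamma(1 + w) zeta(1 + w). Both sides are
    multiplied by w, and w Gamma(1 + w) zeta(1 + w) expands as 1 plus the shifted [c]: the 1 gives
    the isolated term, [c] the convolution. *)
Lemma nseqxE x k : 0 < x -> nseqx x k =
  - (expseq (- ln x) k.+1 + conv (fun i => expseq (- ln x) i - seq1 R[i] i) c k).
Proof.
move=> x0.
pose E' i : R[i] := expseq (- ln x) i - seq1 R[i] i.
have H1 := asym_shift (asymD (asymZ (ln x)%:C (cMel_asym (half_gt0 R) (adm_Ey (ltr01 : 0 < 1 :> R))))
  (asym_shift (cMel_asym (half_gt0 R) (adm_D1tf x0)))).
have H2 := asymN (asymM (asymB (asym_exp (- ln x)) (@asym1 R[i]))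
  (asymD (asym_shift (asym_power_series hc)) (@asym1 R[i]))).
suff H : @asym R[i] (fun w => w * ((ln x)%:C * cMel (Ey 1) w + w * cMel (D1tf x) w))
    (fun k => - conv E' (fun k => shift_seq c k + seq1 R[i] k) k).
  have := asym_uniq H1 H k.+1; rewrite /= -/(nseqx x k) => ->.
  rewrite convDr conv_shift /= [conv E' (seq1 _) _]convC conv1 addrC.
  by rewrite /E' /seq1 /= subr0.
apply: asym_eq H2; apply: (near0_realC (half_gt0 R)) => r r0 r2.
have rC : r%:C != 0 :> R[i] by apply: contra_neq (lt0r_neq0 r0) => -[].
have nr := half_norm r0 r2.
have i1 := itg_powV_lnE r0 (ltW r2) x0.
have i2 : itg (fun t => expR (r * ln t) * (lnE t / t)).
  by apply: itg_eq (itg_powV_lnE r0 (ltW r2) ltr01) => t _; rewrite mul1r.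
have i3 := itg_powV_Ey r0 (ltW r2) (ltr01 : 0 < 1 :> R).
have i4 : itg (fun t => expR (r * ln t) * D1tf x t) := Mel_itg nr (adm_D1tf x0).
have E1 : ln x * G0 r + Mel (D1tf x) r =
    I0 (fun t => expR (r * ln t) * (lnE (x * t) / t)) - I0 (fun t => expR (r * ln t) * (lnE t / t)).
  rewrite /G0 /Mel -I0Z// -I0D//; last exact: itgZ.
  rewrite -I0B//; apply: I0_eq => t t0.
  by rewrite /D1tf /D1f DfE//; ring.
have z1 := I0_powV_lnE hzeta r0 r2 x0.
have z2 := I0_powV_lnE hzeta r0 r2 (ltr01 : 0 < 1 :> R).
have e2 : I0 (fun t => expR (r * ln t) * (lnE (1 * t) / t)) = I0 (fun t => expR (r * ln t) * (lnE t / t)).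
  by apply: I0_eq => t _; rewrite mul1r.
rewrite e2 ln1 mulr0 expR0 mul1r in z2.
have {}E1 := congr1 (fun u : R => u%:C : R[i]) E1.
rewrite /= (realCD (ln x * G0 r)) (realCM (ln x)) realCB in E1.
have {}E1 := etrans E1 (congr2 (fun u v : R[i] => u - v) z1 z2).
rewrite (realCM (expR _)) in E1.
have g : (G1 r)%:C = r%:C * (G0 r)%:C :> R[i] by rewrite -(G0G1 r0 r2) realCM.
rewrite cGamma1D !cMel_real -/(G1 r) g -[(- ln x)%:C * _]realCM cexp_real.
have -> : - ln x * r = - r * ln x by ring.
have -> : 1 + r%:C - 1 = r%:C :> R[i] by rewrite addrAC subrr add0r.
transitivity (r%:C * (r%:C * ((ln x)%:C * (G0 r)%:C + (Mel (D1tf x) r)%:C)) : R[i]); last first.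
  by ring.
rewrite E1; move: (zeta _ : R[i]) (expR _)%:C (G0 r)%:C => z e q.
by field.
Qed.

Lemma Scoef0 x : Scoef x 0 = nseqx x 1.
Proof. by rewrite /Scoef /conv big_ord1 /invgam acoef_diag// fact0 divr1 !mul1r. Qed.

Lemma nseqx1 x : 0 < x -> nseqx x 1 = (ln x)%:C * c 0%N - (ln x)%:C ^+ 2 / 2.
Proof.
move=> x0; rewrite nseqxE// /conv !big_ord_recl big_ord0 /expseq /seq1 /=.
rewrite realCN !fact0 !expr0 expr1 sqrrN (_ : 2`! = 2)%N// divr1 subrr mul0r add0r subr0 addr0.
by rewrite (_ : 1`! = 1)%N// divr1; ring.
Qed.

(* The difference of the coefficient relations for [x] and [x^-1] at [k = 0] is
   [2 * ln x * c 0]. *)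
Lemma Gamma_zeta_coef0 : c 0%N = 0.
Proof.
pose x : R := expR 1.
have x0 : 0 < x by exact: expR_gt0.
have xi : 0 < x^-1 by rewrite invr_gt0.
have lx : ln x = 1 by rewrite /x expRK.
have H1 := functional_equation_coef 0 x0.
have H2 := functional_equation_coef 0 xi.
have e0 a (f : nat -> R[i]) : conv (expseq a) f 0 = f 0%N.
  by rewrite /conv big_ord1 /expseq expr0 fact0 divr1 mul1r.
have o : 1%:C = 1 :> R[i] by [].
rewrite !e0 /= addr0 Scoef0 (nseqx1 x0) lx o in H1.
rewrite !e0 /= addr0 Scoef0 (nseqx1 xi) invrK lnV ?posrE// lx realCN o in H2.
have := congr1 (fun u => u / 2) (etrans H1 (esym H2)).
move: (Tcoef (KlnE x) 0) (Tcoef (KlnE x^-1) 0) (Tcoef (KlnE 1) 0) (Tcoef (@lnE R) 0)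
  (x^-1)%:C x%:C (c 0%N : R[i]) => a b d e X Y c0 E.
transitivity ((a + b - 2 * d - (X * e + (Y - 2) * e) + (1 * c0 - 1 ^+ 2 / 2)) / 2 -
  ((b + a - 2 * d - (Y * e + (X - 2) * e) + (- 1 * c0 - (- 1) ^+ 2 / 2)) / 2) : R[i]).
  by field.
by rewrite E subrr.
Qed.

Lemma nseqx_fact x l : 0 < x -> l.+1`!%:R * nseqx x l.+1 =
  - (\sum_(0 <= n < l) (-1) ^+ n.+1 * c (l - n)%N * (l.+1`!%:R / n.+1`!%:R) * (ln x)%:C ^+ n.+1
     + (-1) ^+ l / l.+2%:R * (ln x)%:C ^+ l.+2) :> R[i].
Proof.
move=> x0; rewrite nseqxE// mulrN; congr (- _).
have f0 := @factC_neq0 R l.+1.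
have pw n : (- ln x)%:C ^+ n = (-1) ^+ n * (ln x)%:C ^+ n :> R[i] by rewrite realCN (@exprNn R[i]).
rewrite mulrDr addrC; congr (_ + _); last first.
  rewrite /expseq pw (_ : (-1) ^+ l.+2 = (-1) ^+ l :> R[i]); last by rewrite !exprS; ring.
  rewrite [l.+2`!%N]factS natrM invfM.
  move: (l.+1`!%:R : R[i]) (l.+2%:R^-1 : R[i]) ((-1) ^+ l : R[i]) ((ln x)%:C ^+ l.+2 : R[i]) f0 => f v s z f0.
  by field.
rewrite /conv big_ord_recl {1}/expseq {1}/seq1 /= expr0 fact0 divr1 subrr mul0r add0r.
(* The last term of the convolution carries c_0 = 0; this is why the sum over n stops before [l]. *)
rewrite big_ord_recr /= subnn (Gamma_zeta_coef0) mulr0 addr0 mulr_sumr big_mkord.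
apply: eq_bigr => i _; rewrite /seq1 subr0 subSS /expseq pw.
move: (l.+1`!%:R : R[i]) ((i.+1`!%:R)^-1 : R[i]) ((-1) ^+ i.+1 : R[i]) ((ln x)%:C ^+ i.+1 : R[i])
  (c (l - i)%N : R[i]) => f v s z u.
by ring.
Qed.

Lemma nseqx1_sqr x : 0 < x -> nseqx x 1 = - 2^-1 * (ln x)%:C ^+ 2.
Proof.
move=> x0; rewrite nseqx1// Gamma_zeta_coef0 mulr0 sub0r.
by move: ((ln x)%:C ^+ 2 : R[i]) => z; ring.
Qed.

(** By [acoefE], j! (m + 1) invgam(j - m) = (m + 1)! a_{j+1,m}. The term m = 0 is the one in log^2;
    for m = l >= 1, a_{j+1,l} = (j / l) a_{j,l-1} produces the outer factor [j] and the quotient by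
    [l]. *)
Lemma Scoef_fact x j : 0 < x -> j`!%:R * Scoef x j =
  - 2^-1 * acoef R j.+1 0 * (ln x)%:C ^+ 2
  - j%:R * \sum_(1 <= l < j.+1) acoef R j (l - 1) / l%:R *
     (\sum_(0 <= n < l) (-1) ^+ n.+1 * c (l - n)%N * (l.+1`!%:R / n.+1`!%:R) * (ln x)%:C ^+ n.+1
     + (-1) ^+ l / l.+2%:R * (ln x)%:C ^+ l.+2) :> R[i].
Proof.
move=> x0.
have -> : j`!%:R * Scoef x j = \sum_(m < j.+1) acoef R j.+1 m * (m.+1`!%:R * nseqx x m.+1) :> R[i].
  rewrite /Scoef convC /conv mulr_sumr; apply: eq_bigr => m _.
  have mj : (m <= j)%N by rewrite -ltnS.
  rewrite acoefE// factS natrM.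
  move: (j`!%:R : R[i]) (m`!%:R : R[i]) (m.+1%:R : R[i]) (nseqx x m.+1) (invgam R (j - m))
    (factC_neq0 R m) => a b d e f b0.
  by field.
rewrite big_ord_recl /= (nseqx1_sqr x0) (_ : 1`! = 1)%N// mul1r.
rewrite mulrCA mulrA; congr (_ + _).
rewrite big_add1 /= big_mkord mulr_sumr -sumrN; apply: eq_bigr => i _.
rewrite /bump /= add1n (nseqx_fact _ x0) !mulrN; congr (- _).
rewrite mulrA; congr (_ * _).
rewrite subn1 /=.
have := ltn_ord i; move: (i : nat) => n nj; case: j i nj => // j _ nj.
rewrite acoefE// acoefE// subSS.
rewrite !factS !natrM.
have := pnatr_eq0 R[i] n.+1; move: (n.+1%:R : R[i]) (j.+1%:R : R[i]) (factC_neq0 R n) (invgam R _) => a b.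
move: (n`!%:R : R[i]) (j`!%:R : R[i]) => d e d0 v /= /negbT a0.
by field; rewrite ?a0 ?d0.
Qed.

End Constants.

(** * The symmetric form and the final identity *)

Section Exponential.
Variable R : realType.

(** The binomial theorem, read off from e^(aw) e^(bw) = e^((a+b)w) by uniqueness of expansions. *)
Lemma conv_expseq (a b : R) : conv (expseq a) (expseq b) =1 expseq (a + b).
Proof.
have H := asymM (asym_exp a) (asym_exp b).
suff K : @asym R[i] (fun w => cexp (a%:C * w) * cexp (b%:C * w)) (expseq (a + b)) by exact: (asym_uniq H K).
apply: asym_eq (asym_exp (a + b)); apply: near0T => w _.
by rewrite realCD mulrDl cexpD.
Qed.
End Exponential.

Section SymmetricForm.
Variable R : realType.

Lemma mul_Lstar_pred (x : R) j : 0 < x ->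
  j%:R * Lstar x (j%:Z - 1) = j`!%:R * shift_seq (Tcoef (DLf x)) j :> R[i].
Proof.
(* For j = 0 the index of [Lstar] is -1 and both sides vanish. *)
move=> x0; case: j => [|i]; first by rewrite mul0r mulr0.
rewrite (_ : i.+1%:Z - 1 = i); last by rewrite -addn1 PoszD addrK.
by rewrite (LstarE _ x0) /= factS natrM mulrA.
Qed.

Lemma functional_equation_sym (x : R) k : 0 < x ->
  conv (expseq (ln x / 2)) (Tcoef (KlnE x)) k
  + conv (expseq (- (ln x / 2))) (Tcoef (KlnE x^-1)) k =
  conv (expseq (ln x / 2)) (fun j => 2 * Tcoef (KlnE 1) j + (x%:C - 2) * Tcoef (@lnE R) j
    - Scoef x j - shift_seq (Tcoef (DLf x)) j) k
  + x^-1%:C * conv (expseq (- (ln x / 2))) (Tcoef (@lnE R)) k :> R[i].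
Proof.
move=> x0.
(* x^(-w/2) is rewritten as x^(w/2) x^-w: all terms then share the factor x^(w/2), and the relation
   applies to the other factors coefficient by coefficient. *)
have E f j : conv (expseq (- (ln x / 2))) f j =
    conv (expseq (ln x / 2)) (conv (expseq (- ln x)) f) j.
  rewrite convA; apply: eq_conv => // i.
  by rewrite conv_expseq; congr expseq; field.
rewrite !E -convZr -!convDr.
apply: eq_conv => // j.
have := functional_equation_coef j x0.
move: (Tcoef (KlnE x) j) (conv _ (Tcoef (KlnE x^-1)) j) (Tcoef (KlnE 1) j)
  (conv _ (Tcoef (@lnE R)) j) (Tcoef (@lnE R) j) (Scoef x j) (shift_seq _ j) (x^-1%:C) (x%:C : R[i])
  => a b d e f s l X Y H.
apply/eqP; rewrite -subr_eq0 -[X in _ == X]H; apply/eqP; ring.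
Qed.
End SymmetricForm.

Theorem theorem3p4 (R : realType) (zeta : Cplx R -> Cplx R)
    (gamma c : nat -> Cplx R)
    (hzeta : is_riemann_zeta zeta)
    (hgamma : is_stieltjes zeta gamma)
    (hc : is_Gamma_zeta_coef zeta c)
    (k : nat) (x : R) (hx : 0 < x) :
  let Phi := Ishibashi gamma in
  let X : Cplx R := x%:C in
  let logx : Cplx R := (ln x)%:C in
  \sum_(0 <= j < k.+1)
    (-1) ^+ j.+1 / j.+1%:R * 'C(k, j)%:R * (logx ^+ (k - j) / 2 ^+ (k - j))
    * (Phi j.+1 X + (-1) ^+ (k - j) * Phi j.+1 X^-1)
  = \sum_(0 <= j < k.+1)
    'C(k, j)%:R * (logx ^+ (k - j) / 2 ^+ (k - j)) *
    (j%:R * Lstar x (j%:Z - 1)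
     - 2^-1 * acoef R j.+1 0 * logx ^+ 2
     + (X + (-1) ^+ (k - j) / X - 2) * derive1n j zeta 2
     - j%:R * \sum_(1 <= l < j.+1) acoef R j (l - 1) / l%:R *
         (\sum_(0 <= n < l)
            (-1) ^+ n.+1 * c (l - n)%N * (l.+1`!%:R / n.+1`!%:R)
            * logx ^+ n.+1
          + (-1) ^+ l / l.+2%:R * logx ^+ l.+2)
     + 2 * ((-1) ^+ j.+1 / j.+1%:R) * Phi j.+1 1).
Proof.
move=> Phi X logx.
pose e : nat -> R[i] := expseq (ln x / 2).
pose e' : nat -> R[i] := expseq (- (ln x / 2)).
have xi : 0 < x^-1 by rewrite invr_gt0.
have Xi : X^-1 = (x^-1)%:C :> R[i] by rewrite /X realCV.
(* The weights of the statement are k!/j! times the coefficients of x^(w/2), so each sum is k! times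
   a Cauchy product, up to sign. *)
have eE j : (j <= k)%N ->
    'C(k, j)%:R * (logx ^+ (k - j) / 2 ^+ (k - j)) = k`!%:R * e (k - j)%N / j`!%:R :> R[i].
  move=> jk; have := congr1 (fun n => n%:R : R[i]) (bin_fact jk); rewrite !natrM => <-.
  rewrite /e /expseq -expr_div_n realCM realCV (natrC R 2).
  have := factC_neq0 R j; have := factC_neq0 R (k - j).
  move: (j`!%:R : R[i]) ((k - j)`!%:R : R[i]) ('C(k, j)%:R : R[i]) (_ ^+ (k - j) : R[i]) => a b d z b0 a0.
  by field; rewrite a0 b0.
(* The coefficients of x^(-w/2) and x^(w/2) differ by a parity sign, the origin of (-1)^(k-j) before
   Phi at 1/x. *)
have e'E j : e' j = (-1) ^+ j * e j by rewrite /e' /e /expseq realCN (@exprNn R[i]) mulrA.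
have key := functional_equation_sym k hx.
have convE (a b : nat -> R[i]) : conv a b k = \sum_(0 <= j < k.+1) a (k - j)%N * b j.
  by rewrite convC /conv big_mkord; apply: eq_bigr => i _; rewrite mulrC.
(* The factor (-1)^(j+1) / (j + 1) meets (-1)^j (j + 1)! from [IshibashiE], which leaves - j! times
   a coefficient. *)
transitivity (- (k`!%:R * (conv e (Tcoef (KlnE x)) k + conv e' (Tcoef (KlnE x^-1)) k)) : R[i]).
  rewrite !convE -big_split mulr_sumr -sumrN; apply: eq_big_nat => j /andP[_]; rewrite ltnS => jk.
  rewrite /Phi Xi /X (IshibashiE hzeta hgamma j hx) (IshibashiE hzeta hgamma j xi).
  rewrite -[X in X * (_ + _)]mulrA (eE j jk) e'E factS natrM.
  have s1 : (-1) ^+ j * (-1) ^+ j = 1 :> R[i] by rewrite -exprMn mulrNN mulr1 expr1n.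
  rewrite exprS; move: s1 (factC_neq0 R j) (pnatr_eq0 R[i] j.+1).
  move: ((-1) ^+ j : R[i]) ((-1) ^+ (k - j) : R[i]) (k`!%:R : R[i]) (j`!%:R : R[i]) (j.+1%:R : R[i]).
  move: (e (k - j)%N) (Tcoef (KlnE x) j) (Tcoef (KlnE x^-1) j) => a t t' s u f g d s1 g0 /= /negbT d0.
  transitivity (- (s * s) * (f * (a * t + u * a * t')) : R[i]); first by field; rewrite g0 d0.
  by rewrite s1 mulN1r.
transitivity (- (k`!%:R * (conv e (fun j => 2 * Tcoef (KlnE 1) j + (x%:C - 2) * Tcoef (@lnE R) j
    - Scoef x j - shift_seq (Tcoef (DLf x)) j) k
  + x^-1%:C * conv e' (Tcoef (@lnE R)) k)) : R[i]); first by rewrite key.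
rewrite !convE mulr_sumr -big_split mulr_sumr -sumrN; apply: eq_big_nat => j /andP[_]; rewrite ltnS => jk.
rewrite (eE j jk) e'E (mul_Lstar_pred j hx) (derive_zeta2 hzeta).
have P1 : Phi j.+1 1 = (-1) ^+ j * (j.+1%:R * j`!%:R) * Tcoef (KlnE 1) j.
  by rewrite -natrM -factS; exact: (IshibashiE hzeta hgamma j (ltr01 : 0 < 1 :> R)).
rewrite P1 Xi [(-1) ^+ j.+1]exprS /X /=.
have s1 : (-1) ^+ j * (-1) ^+ j = 1 :> R[i] by rewrite -exprMn mulrNN mulr1 expr1n.
have := Scoef_fact hzeta hc j hx; rewrite -/logx.
move: (\sum_(1 <= l < j.+1) _) => Y.
move: s1 (factC_neq0 R j) (pnatr_eq0 R[i] j.+1).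
move: ((-1) ^+ j : R[i]) ((-1) ^+ (k - j) : R[i]) (k`!%:R : R[i]) (j`!%:R : R[i]) (j.+1%:R : R[i]).
move: (e (k - j)%N) (Tcoef (KlnE 1) j) (Tcoef (@lnE R) j) (Scoef x j) (shift_seq _ j)
  (acoef R j.+1 0) (logx ^+ 2 : R[i]) (x^-1)%:C (x%:C : R[i]) (j%:R : R[i])
  => a t t' S D A L2 x' X' j0 s u f g d s1 g0 /= /negbT d0 hS.
transitivity (f * a / g * (g * D + (- 2^-1 * A * L2 - j0 * Y) +
  (X' + u * x' - 2) * - (g * t') - 2 * (s * s) * g * t) : R[i]).
  by rewrite -hS s1; field.
by field; rewrite g0 d0.
Qed.
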